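(* For the knot $9_{42}$ of Rolfsen's table, the representation variety $J_C(9_{42})$ is homeomorphic to the disjoint union of one $2$-sphere and seven copies of real projective $3$-space: $$J_C(9_{42})=S^2\sqcup\bigsqcup_{i=1}^{7}\mathbb{RP}^3.$$
   Context: $C=\{A\in SU(2):\operatorname{tr}A=0\}$. For a knot $L$ in $S^3$, $J_C(L)$ is the space of homomorphisms $\pi_1(S^3\setminus L)\to SU(2)$ mapping the positively oriented meridians of $L$ into the conjugacy class $C$ (with the topology of a subspace of a finite product of copies of $C$, via the images of a finite set of meridians generating the group). *)

(* Defs.v *)
From HB Require Import structures.
From mathcomp Require Import all_boot all_order all_algebra.
From mathcomp Require Import all_classical all_reals all_analysis.
From mathcomp Require Import homotopy complex ring lra.

Set Implicit Arguments.
Unset Strict Implicit.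
Unset Printing Implicit Defensive.

Import Order.TTheory GRing.Theory Num.Theory.
Import numFieldNormedType.Exports.

Local Open Scope classical_set_scope.
Local Open Scope ring_scope.
Local Open Scope quotient_scope.
Local Open Scope sesquilinear_scope.

Definition unit_itv (R : realType) : Type := set_type `[(0 : R), 1]%classic.

Section UnitInterval.
Context {R : realType}.
Local Notation I := (unit_itv R).

HB.instance Definition _ := Topological.copy I (set_type `[(0 : R), 1]%classic).

Lemma clip_subproof (t : R) : Num.max 0 (Num.min 1 t) \in `[(0 : R), 1]%classic.
Proof.
apply/mem_set; rewrite /= in_itv /= le_max lexx /= ge_max ler01 /=.
by rewrite ge_min lexx.
Qed.

Definition clip (t : R) : I := exist _ (Num.max 0 (Num.min 1 t)) (clip_subproof t).

Definition coord (t : I) : R := set_val t.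

Lemma coord_itv (t : I) : 0 <= coord t <= 1.
Proof. by have := set_mem (svalP t); rewrite /= in_itv. Qed.

Lemma clipK (t : R) : 0 <= t <= 1 -> coord (clip t) = t.
Proof.
by case/andP=> t0 t1; rewrite /coord /set_val /= (min_idPr t1) (max_idPr t0).
Qed.

Lemma coordK : cancel coord clip.
Proof. by move=> t; apply/val_inj/clipK/coord_itv. Qed.

Lemma unit_itv_neq : clip 0 != clip 1.
Proof.
apply/eqP => /(congr1 coord); rewrite !clipK ?lexx ?ler01 // => /esym/eqP.
by rewrite oner_eq0.
Qed.

HB.instance Definition _ := @isBiPointed.Build I (clip 0) (clip 1) unit_itv_neq.

Lemma coord_continuous : continuous coord.
Proof. exact: initial_continuous. Qed.

Lemma clip_continuous : continuous clip.
Proof.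
apply/continuous_comp_initial => t.
apply: (@continuous_comp _ _ _ (fun t : R => Num.min 1 t) (Num.max 0)).
  by apply: continuous_min; [exact: cvg_cst|exact: cvg_id].
by apply: continuous_max; [exact: cvg_cst|exact: cvg_id].
Qed.

End UnitInterval.

Section Paths.
Context {R : realType} {T : topologicalType}.
Local Notation I := (unit_itv R).
Local Notation pathI x y := {path I from x to y in T}.

Lemma coord0 : coord (zero : I) = 0. Proof. by rewrite clipK ?lexx ?ler01. Qed.

Lemma coord1 : coord (one : I) = 1. Proof. by rewrite clipK ?lexx ?ler01. Qed.

Lemma clip_le0 (t : R) : t <= 0 -> clip t = zero.
Proof.
move=> t0; apply: val_inj; rewrite /= (min_idPr (le_trans t0 ler01)).
by rewrite (max_idPl t0) (min_idPr ler01) maxxx.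
Qed.

Lemma clip_ge1 (t : R) : 1 <= t -> clip t = one.
Proof. by move=> t1; apply: val_inj; rewrite /= (min_idPl t1) minxx. Qed.

Lemma paste_continuous (Z U : topologicalType) (h : Z -> R) (c : R)
    (f g : Z -> U) :
  continuous h -> continuous f -> continuous g ->
  (forall z, h z = c -> f z = g z) ->
  continuous (fun z => if h z <= c then f z else g z).
Proof.
move=> ch cf cg fg; apply/continuous_closedP => A cA.
have -> : (fun z => if h z <= c then f z else g z) @^-1` A =
    ((h @^-1` [set r | r <= c]) `&` (f @^-1` A)) `|`
    ((h @^-1` [set r | c <= r]) `&` (g @^-1` A)).
  apply/seteqP; split => z /=.
    by case: leP => [hz|/ltW hz] Az; [left|right].
  case=> -[hz Az]; first by rewrite hz.
  by case: leP => // hz'; rewrite fg //; apply/le_anti; rewrite hz hz'.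
apply: closedU; apply: closedI; try by move/continuous_closedP: cf; exact.
- by move/continuous_closedP: ch; apply; exact: closed_le.
- by move/continuous_closedP: ch; apply; exact: closed_ge.
- by move/continuous_closedP: cg; exact.
Qed.

Lemma comp_cts (X Y Z : topologicalType) (g : Y -> Z) (f : X -> Y) :
  continuous f -> continuous g -> continuous (g \o f).
Proof. by move=> cf cg x; apply: continuous_comp; [exact: cf|exact: cg]. Qed.

Lemma clip_comp_cts (X Y : topologicalType) (g : I -> Y) (f : X -> R) :
  continuous g -> continuous f -> continuous (fun x => g (clip (f x))).
Proof.
move=> cg cf; apply: (@comp_cts _ _ _ g (clip \o f)) => //.
exact: comp_cts cf clip_continuous.
Qed.

Definition path_cat_fun (f g : I -> T) (t : I) : T :=
  if coord t <= 2^-1 then f (clip (2 * coord t))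
  else g (clip (2 * coord t - 1)).

Definition path_rev_fun (f : I -> T) (t : I) : T := f (clip (1 - coord t)).

Lemma affine_cts (X : topologicalType) (h : X -> R) (a b : R) :
  continuous h -> continuous (fun x => a * h x + b).
Proof.
by move=> ch x; apply: cvgD; [apply: cvgM; [exact: cvg_cst|exact: ch]|exact: cvg_cst].
Qed.

Lemma scale_cts (X : topologicalType) (h : X -> R) (a : R) :
  continuous h -> continuous (fun x => a * h x).
Proof. by move=> ch x; apply: cvgM; [exact: cvg_cst|exact: ch]. Qed.

Lemma onem_cts (X : topologicalType) (h : X -> R) :
  continuous h -> continuous (fun x => 1 - h x).
Proof.
move=> ch; have -> : (fun x => 1 - h x) = (fun x => -1 * h x + 1).
  by apply/funext => x; rewrite mulN1r addrC.
exact: affine_cts.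
Qed.

Lemma path_cts x y (f : pathI x y) : continuous f.
Proof. exact: cts_fun. Qed.

Lemma path_cat_cts x y z (f : pathI x y) (g : pathI y z) :
  continuous (path_cat_fun f g).
Proof.
apply: paste_continuous; first exact: coord_continuous.
- apply: clip_comp_cts; first exact: path_cts.
  exact: (scale_cts (coord_continuous (R:=R))).
- apply: clip_comp_cts; first exact: path_cts.
  exact: (affine_cts (coord_continuous (R:=R))).
- move=> t ->; rewrite divff ?pnatr_eq0 // subrr clip_ge1 // clip_le0 //.
  by rewrite path_zero path_one.
Qed.

Lemma path_cat0 x y z (f : pathI x y) (g : pathI y z) : path_cat_fun f g zero = x.
Proof.
rewrite /path_cat_fun coord0 mulr0 clip_le0 // path_zero.
by rewrite invr_ge0 ler0n.
Qed.

Lemma path_cat1 x y z (f : pathI x y) (g : pathI y z) : path_cat_fun f g one = z.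
Proof.
rewrite /path_cat_fun coord1 ifF; last by apply/negbTE; rewrite -ltNge; lra.
by rewrite clip_ge1 ?path_one //; lra.
Qed.

Definition path_cat x y z (f : pathI x y) (g : pathI y z) : pathI x z :=
  mk_path (@path_cat_cts _ _ _ f g) (path_cat0 f g) (path_cat1 f g).

Lemma path_rev_cts x y (f : pathI x y) : continuous (path_rev_fun f).
Proof.
apply: (@clip_comp_cts _ _ f (fun t => 1 - coord t)); first exact: path_cts.
exact: (onem_cts (@coord_continuous R)).
Qed.

Lemma path_rev0 x y (f : pathI x y) : path_rev_fun f zero = y.
Proof. by rewrite /path_rev_fun coord0 subr0 clip_ge1 // path_one. Qed.

Lemma path_rev1 x y (f : pathI x y) : path_rev_fun f one = x.
Proof. by rewrite /path_rev_fun coord1 subrr clip_le0 // path_zero. Qed.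

Definition path_rev x y (f : pathI x y) : pathI y x :=
  mk_path (@path_rev_cts _ _ f) (path_rev0 f) (path_rev1 f).

Definition path_cst x : pathI x x := cst x.

Definition path_homotopic x y (f g : pathI x y) : Prop :=
  exists H : I * I -> T,
    [/\ continuous H,
        (forall t, H (zero, t) = f t), (forall t, H (one, t) = g t) &
        (forall s, H (s, zero) = x /\ H (s, one) = y)].

Lemma pair_cts (X Y Z : topologicalType) (f : X -> Y) (g : X -> Z) :
  continuous f -> continuous g -> continuous (fun x => (f x, g x)).
Proof. by move=> cf cg x; apply: cvg_pair; [exact: cf|exact: cg]. Qed.

Lemma fst_cts (X Y : topologicalType) : continuous (@fst X Y).
Proof. by move=> [x y]; exact: cvg_fst. Qed.

Lemma snd_cts (X Y : topologicalType) : continuous (@snd X Y).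
Proof. by move=> [x y]; exact: cvg_snd. Qed.

Lemma coord_fst_cts (X : topologicalType) :
  continuous (fun p : I * X => coord p.1).
Proof. exact: (comp_cts (@fst_cts I X) (@coord_continuous R)). Qed.

Lemma coord_snd_cts (X : topologicalType) :
  continuous (fun p : X * I => coord p.2).
Proof. exact: (comp_cts (@snd_cts X I) (@coord_continuous R)). Qed.

Lemma itv_fst_cts (H : I * I -> T) (f : I * I -> R) :
  continuous H -> continuous f -> continuous (fun p => H (clip (f p), p.2)).
Proof.
move=> cH cf; apply: (@comp_cts _ _ _ H (fun p => (clip (f p), p.2))) => //.
apply: pair_cts; last exact: snd_cts.
exact: comp_cts cf clip_continuous.
Qed.

Lemma itv_snd_cts (H : I * I -> T) (f : I * I -> R) :
  continuous H -> continuous f -> continuous (fun p => H (p.1, clip (f p))).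
Proof.
move=> cH cf; apply: (@comp_cts _ _ _ H (fun p => (p.1, clip (f p)))) => //.
apply: pair_cts; first exact: fst_cts.
exact: comp_cts cf clip_continuous.
Qed.

Lemma path_homotopic_refl x y (f : pathI x y) : path_homotopic f f.
Proof.
exists (fun p => f p.2); split => //.
- exact: (comp_cts (@snd_cts I I) (@path_cts _ _ f)).
- by move=> s; rewrite path_zero path_one.
Qed.

Lemma path_homotopic_sym x y (f g : pathI x y) :
  path_homotopic f g -> path_homotopic g f.
Proof.
case=> H [cH H0 H1 Hxy]; exists (fun p => H (clip (1 - coord p.1), p.2)).
split=> /=.
- by apply: itv_fst_cts => //; apply: onem_cts; exact: coord_fst_cts.
- by move=> t; rewrite coord0 subr0 clip_ge1.
- by move=> t; rewrite coord1 subrr clip_le0.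
- by move=> s; exact: Hxy.
Qed.

Lemma path_homotopic_trans x y (f g h : pathI x y) :
  path_homotopic f g -> path_homotopic g h -> path_homotopic f h.
Proof.
case=> H [cH H0 H1 Hxy] [K [cK K0 K1 Kxy]].
exists (fun p => if coord p.1 <= 2^-1 then H (clip (2 * coord p.1), p.2)
                 else K (clip (2 * coord p.1 - 1), p.2)); split=> /=.
- apply: (@paste_continuous _ _ (fun p : I * I => coord p.1) 2^-1
    (fun p => H (clip (2 * coord p.1), p.2))
    (fun p => K (clip (2 * coord p.1 - 1), p.2))).
  + exact: coord_fst_cts.
  + apply: itv_fst_cts => //; apply: scale_cts; exact: coord_fst_cts.
  + apply: itv_fst_cts => //; apply: affine_cts; exact: coord_fst_cts.
  + move=> p ->; rewrite divff ?pnatr_eq0 // subrr clip_ge1 // clip_le0 //.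
    by rewrite H1 K0.
- by move=> t; rewrite coord0 mulr0 clip_le0 // invr_ge0 ler0n H0.
- move=> t; rewrite coord1 ifF; last by apply/negbTE; rewrite -ltNge; lra.
  by rewrite clip_ge1 ?K1 //; lra.
- by move=> s; case: ifP => _; [exact: Hxy|exact: Kxy].
Qed.

Lemma path_cat_homotopic x y z (f f' : pathI x y) (g g' : pathI y z) :
  path_homotopic f f' -> path_homotopic g g' ->
  path_homotopic (path_cat f g) (path_cat f' g').
Proof.
case=> H [cH H0 H1 Hxy] [K [cK K0 K1 Kxy]].
exists (fun p => if coord p.2 <= 2^-1 then H (p.1, clip (2 * coord p.2))
                 else K (p.1, clip (2 * coord p.2 - 1))); split=> /=.
- apply: (@paste_continuous _ _ (fun p : I * I => coord p.2) 2^-1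
    (fun p => H (p.1, clip (2 * coord p.2)))
    (fun p => K (p.1, clip (2 * coord p.2 - 1)))).
  + exact: coord_snd_cts.
  + apply: itv_snd_cts => //; apply: scale_cts; exact: coord_snd_cts.
  + apply: itv_snd_cts => //; apply: affine_cts; exact: coord_snd_cts.
  + move=> p ->; rewrite divff ?pnatr_eq0 // subrr clip_ge1 // clip_le0 //.
    by case: (Hxy p.1) => _ ->; case: (Kxy p.1) => ->.
- by move=> t; rewrite H0 K0.
- by move=> t; rewrite H1 K1.
- move=> s; rewrite coord0 coord1 mulr0 invr_ge0 ler0n clip_le0 //.
  rewrite ifF; last by apply/negbTE; rewrite -ltNge; lra.
  rewrite clip_ge1; last by lra.
  by case: (Hxy s); case: (Kxy s).
Qed.

Lemma path_rev_homotopic x y (f g : pathI x y) :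
  path_homotopic f g -> path_homotopic (path_rev f) (path_rev g).
Proof.
case=> H [cH H0 H1 Hxy]; exists (fun p => H (p.1, clip (1 - coord p.2))).
split=> /=.
- by apply: itv_snd_cts => //; apply: onem_cts; exact: coord_snd_cts.
- by move=> t; rewrite H0.
- by move=> t; rewrite H1.
- move=> s; rewrite coord0 coord1 subr0 subrr clip_ge1 // clip_le0 //.
  by case: (Hxy s).
Qed.

Lemma path_reparam_homotopic x y x' y' (f : pathI x y) (g h : pathI x' y')
    (u v : R -> R) :
  continuous u -> continuous v ->
  (forall t, 0 <= t <= 1 -> 0 <= u t <= 1 /\ 0 <= v t <= 1) ->
  u 0 = v 0 -> u 1 = v 1 ->
  (forall t, g t = f (clip (u (coord t)))) ->
  (forall t, h t = f (clip (v (coord t)))) -> path_homotopic g h.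
Proof.
move=> cu cv uv uv0 uv1 gE hE.
exists (fun p => f (clip ((1 - coord p.1) * u (coord p.2) +
                          coord p.1 * v (coord p.2)))); split=> /=.
- apply: clip_comp_cts; first exact: path_cts.
  have cu2 : continuous (fun p : I * I => u (coord p.2)).
    exact: (comp_cts (@coord_snd_cts I) cu).
  have cv2 : continuous (fun p : I * I => v (coord p.2)).
    exact: (comp_cts (@coord_snd_cts I) cv).
  move=> p; apply: cvgD; apply: cvgM; try exact: cu2; try exact: cv2.
  + exact: (onem_cts (@coord_fst_cts I)).
  + exact: coord_fst_cts.
- by move=> t; rewrite coord0 subr0 mul1r mul0r addr0 gE.
- by move=> t; rewrite coord1 subrr mul1r mul0r add0r hE.
- move=> s; rewrite coord0 coord1 uv0 uv1 -!mulrDl subrK !mul1r.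
  have := @path_zero _ _ _ _ h; have := @path_one _ _ _ _ h.
  by rewrite !hE coord0 coord1.
Qed.

End Paths.

Section FundamentalGroup.
Context (R : realType) (T : topologicalType) (x : T).
Local Notation I := (unit_itv R).

Definition loop : Type := {path I from x to x in T}.

HB.instance Definition _ := Choice.on loop.

Definition loop_homotopic : rel loop := fun f g => `[< path_homotopic f g >].

Lemma loop_homotopic_refl : reflexive loop_homotopic.
Proof. by move=> f; apply/asboolP; exact: path_homotopic_refl. Qed.

Lemma loop_homotopic_sym : symmetric loop_homotopic.
Proof.
by move=> f g; apply/idP/idP => /asboolP fg; apply/asboolP;
  exact: path_homotopic_sym.
Qed.

Lemma loop_homotopic_trans : transitive loop_homotopic.
Proof.
move=> g f h /asboolP fg /asboolP gh; apply/asboolP.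
exact: path_homotopic_trans fg gh.
Qed.

Canonical loop_homotopic_equiv := EquivRel loop_homotopic
  loop_homotopic_refl loop_homotopic_sym loop_homotopic_trans.

Definition fundamental_group : Type := {eq_quot loop_homotopic}.

HB.instance Definition _ := Choice.on fundamental_group.

Definition homotopy_class (f : loop) : fundamental_group :=
  \pi_{eq_quot loop_homotopic} f.

Definition pi1_mul (a b : fundamental_group) : fundamental_group :=
  homotopy_class (path_cat (repr a) (repr b)).

Definition pi1_inv (a : fundamental_group) : fundamental_group :=
  homotopy_class (path_rev (repr a)).

Definition pi1_one : fundamental_group := homotopy_class (path_cst x).

Lemma homotopy_class_eq (f g : loop) :
  homotopy_class f = homotopy_class g <-> path_homotopic f g.
Proof. by split=> [/eqmodP/asboolP|fg] //; apply/eqmodP/asboolP. Qed.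

Lemma homotopy_class_repr (a : fundamental_group) : homotopy_class (repr a) = a.
Proof. exact: reprK. Qed.

Lemma homotopy_class_surj (a : fundamental_group) :
  exists f : loop, a = homotopy_class f.
Proof. by exists (repr a); rewrite homotopy_class_repr. Qed.

Lemma homotopy_class_cat (f g : loop) :
  pi1_mul (homotopy_class f) (homotopy_class g) = homotopy_class (path_cat f g).
Proof.
apply/homotopy_class_eq/path_cat_homotopic;
  by apply/homotopy_class_eq; rewrite homotopy_class_repr.
Qed.

Lemma homotopy_class_rev (f : loop) :
  pi1_inv (homotopy_class f) = homotopy_class (path_rev f).
Proof.
by apply/homotopy_class_eq/path_rev_homotopic/homotopy_class_eq;
  rewrite homotopy_class_repr.
Qed.

End FundamentalGroup.

Section PathGroupoid.
Context {R : realType} {T : topologicalType}.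
Local Notation I := (unit_itv R).
Local Notation pathI x y := {path I from x to y in T}.

Lemma max_cts (X : topologicalType) (f g : X -> R) :
  continuous f -> continuous g -> continuous (fun x => Num.max (f x) (g x)).
Proof.
by move=> cf cg x; apply: (@continuous_max R X f g x); [exact: cf|exact: cg].
Qed.

Lemma path_cat_cst x y (f : pathI x y) : path_homotopic (path_cat f (path_cst y)) f.
Proof.
apply: (@path_reparam_homotopic _ _ _ _ _ _ f _ _
  (fun t => Num.min 1 (2 * t)) id).
- move=> t; apply: continuous_min; first exact: cvg_cst.
  by apply: scale_cts => s; exact: cvg_id.
- by move=> t; exact: cvg_id.
- move=> t t01; split=> //; rewrite le_min ge_min; lra.
- by rewrite mulr0 (min_idPr ler01).
- by rewrite mulr1; apply/min_idPl; lra.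
- move=> t; rewrite /= /mk_path /path_cat_fun; case: leP => tE.
    by rewrite (min_idPr _) //; lra.
  by rewrite (min_idPl _) ?[RHS]path_one //; lra.
- by move=> t; rewrite coordK.
Qed.

Lemma path_cst_cat x y (f : pathI x y) : path_homotopic (path_cat (path_cst x) f) f.
Proof.
apply: (@path_reparam_homotopic _ _ _ _ _ _ f _ _
  (fun t => Num.max 0 (2 * t - 1)) id).
- apply: max_cts; first by move=> s; exact: cvg_cst.
  by apply: affine_cts => s; exact: cvg_id.
- by move=> t; exact: cvg_id.
- move=> t t01; split=> //; rewrite le_max ge_max; lra.
- by rewrite mulr0; apply/max_idPl; lra.
- by rewrite mulr1 (max_idPr _); lra.
- move=> t; rewrite /= /mk_path /path_cat_fun; case: leP => tE.
    by rewrite (max_idPl _) ?[RHS]path_zero //; lra.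
  by rewrite (max_idPr _) //; lra.
- by move=> t; rewrite coordK.
Qed.

Lemma path_cat_assoc w x y z (f : pathI w x) (g : pathI x y) (h : pathI y z) :
  path_homotopic (path_cat (path_cat f g) h) (path_cat f (path_cat g h)).
Proof.
apply/path_homotopic_sym.
apply: (@path_reparam_homotopic _ _ _ _ _ _ (path_cat (path_cat f g) h) _ _
  (fun t => Num.max (2^-1 * t) (Num.max (1 * t - 4^-1) (2 * t - 1))) id).
- apply: max_cts; first by apply: scale_cts => s; exact: cvg_id.
  by apply: max_cts; apply: affine_cts => s; exact: cvg_id.
- by move=> t; exact: cvg_id.
- move=> t t01; split=> //; rewrite le_max !ge_max; lra.
- by rewrite !mulr0 !(max_idPl _) //; lra.
- by rewrite !mulr1 !(max_idPr _) //; lra.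
- move=> t; have t01 := coord_itv t.
  rewrite /= /mk_path /path_cat_fun /= /mk_path /path_cat_fun.
  case: (leP (coord t)) => t2.
    have -> : Num.max (2^-1 * coord t)
        (Num.max (1 * coord t - 4^-1) (2 * coord t - 1)) = 2^-1 * coord t.
      by rewrite (max_idPl _) // ge_max; lra.
    have E : coord (clip (2^-1 * coord t)) = 2^-1 * coord t by rewrite clipK; lra.
    have E2 : coord (clip (2 * coord (clip (2^-1 * coord t)))) = coord t.
      by rewrite E mulrA divff ?pnatr_eq0 // mul1r coordK.
    by rewrite E2 E t2 ifT //; lra.
  have E : coord (clip (2 * coord t - 1)) = 2 * coord t - 1 by rewrite clipK; lra.
  rewrite E; case: leP => t3.
    have -> : Num.max (2^-1 * coord t)
        (Num.max (1 * coord t - 4^-1) (2 * coord t - 1)) = coord t - 4^-1.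
      by rewrite mul1r (max_idPr _) ?(max_idPl _) //; lra.
    have E2 : coord (clip (coord t - 4^-1)) = coord t - 4^-1 by rewrite clipK; lra.
    have E3 : coord (clip (2 * (coord t - 4^-1))) = 2 * coord t - 2^-1.
      by rewrite clipK; lra.
    rewrite E2 E3 ifT; last by lra.
    rewrite ifF; last by apply/negbTE; rewrite -ltNge; lra.
    by congr (g (clip _)); lra.
  have -> : Num.max (2^-1 * coord t)
      (Num.max (1 * coord t - 4^-1) (2 * coord t - 1)) = 2 * coord t - 1.
    by rewrite mul1r (max_idPr _) ?(max_idPr _) //; lra.
  by rewrite E ifF //; apply/negbTE; rewrite -ltNge; lra.
- by move=> t; rewrite coordK.
Qed.

Lemma path_revK x y (f : pathI x y) : path_rev (path_rev f) = f.
Proof.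
apply/path_eqP => t; rewrite /= /mk_path /path_rev_fun /= /mk_path /path_rev_fun.
have t01 := coord_itv t; rewrite (@clipK _ (1 - coord t)) //; last by lra.
by rewrite opprB addrC subrK coordK.
Qed.

Lemma path_rev_cat x y (f : pathI x y) :
  path_homotopic (path_cat (path_rev f) f) (path_cst y).
Proof.
apply: (@path_reparam_homotopic _ _ _ _ _ _ f _ _
  (fun t => `|2 * t - 1|) (fun=> 1)).
- move=> t; apply: (@continuous_comp _ _ _ (fun t : R => 2 * t - 1) Num.norm).
    by apply: affine_cts => s; exact: cvg_id.
  exact: norm_continuous.
- by move=> t; exact: cvg_cst.
- move=> t t01; split; last by rewrite ler01 lexx.
  by rewrite normr_ge0 ler_norml; lra.
- by rewrite mulr0 sub0r normrN1.
- by rewrite mulr1 [2 - 1](_ : _ = 1) ?normr1 //; lra.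
- move=> t; have t01 := coord_itv t.
  rewrite /= /mk_path /path_cat_fun /= /mk_path /path_rev_fun.
  case: leP => t2; last by rewrite ger0_norm //; lra.
  rewrite ler0_norm; last by lra.
  by rewrite clipK ?opprB //; lra.
- by move=> t; rewrite clip_ge1 // path_one.
Qed.

End PathGroupoid.

Section FundamentalGroupStructure.
Context {R : realType} {T : topologicalType} {x : T}.
Local Notation pi1 := (fundamental_group R x).

Lemma pi1_mulA : associative (@pi1_mul R T x).
Proof.
move=> a b c; have [f ->] := homotopy_class_surj a.
have [g ->] := homotopy_class_surj b; have [h ->] := homotopy_class_surj c.
rewrite !homotopy_class_cat; apply/homotopy_class_eq/path_homotopic_sym.
exact: path_cat_assoc.
Qed.

Lemma pi1_mul1g : left_id (pi1_one R x) (@pi1_mul R T x).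
Proof.
move=> a; have [f ->] := homotopy_class_surj a.
by rewrite homotopy_class_cat; apply/homotopy_class_eq/path_cst_cat.
Qed.

Lemma pi1_mulg1 : right_id (pi1_one R x) (@pi1_mul R T x).
Proof.
move=> a; have [f ->] := homotopy_class_surj a.
by rewrite homotopy_class_cat; apply/homotopy_class_eq/path_cat_cst.
Qed.

Lemma pi1_mulVg : left_inverse (pi1_one R x) (@pi1_inv R T x) (@pi1_mul R T x).
Proof.
move=> a; have [f ->] := homotopy_class_surj a.
rewrite homotopy_class_rev homotopy_class_cat.
exact/homotopy_class_eq/path_rev_cat.
Qed.

Lemma pi1_mulgV : right_inverse (pi1_one R x) (@pi1_inv R T x) (@pi1_mul R T x).
Proof.
move=> a; have [f ->] := homotopy_class_surj a.
rewrite homotopy_class_rev homotopy_class_cat.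
apply/homotopy_class_eq; rewrite -{1}(path_revK f); exact: path_rev_cat.
Qed.

HB.instance Definition _ := isGroup.Build (fundamental_group R x)
  pi1_mulA pi1_mul1g pi1_mulg1 pi1_mulVg pi1_mulgV.

End FundamentalGroupStructure.

Definition generates (G : groupType) (A : set G) : Prop :=
  forall S : {pred G}, group_closed S -> (forall a, A a -> a \in S) ->
    forall g, g \in S.

Definition homeomorphic (T U : topologicalType) : Prop :=
  exists (f : T -> U) (g : U -> T),
    [/\ continuous f, continuous g, cancel f g & cancel g f].

Definition sphere (R : realType) (n : nat) : set 'rV[R]_n.+1 :=
  [set x | \sum_i x 0 i ^+ 2 = 1].
Arguments sphere R n : clear implicits.

Section ProjectiveSpace.
Context (R : realType) (n : nat).

Definition antipodal : rel (sphere R n) :=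
  fun x y => (set_val x == set_val y) || (set_val x == - set_val y).

Lemma antipodal_refl : reflexive antipodal.
Proof. by move=> x; rewrite /antipodal eqxx. Qed.

Lemma antipodal_sym : symmetric antipodal.
Proof.
by move=> x y; rewrite /antipodal eq_sym -eqr_oppLR [- _ == _]eq_sym.
Qed.

Lemma antipodal_trans : transitive antipodal.
Proof.
move=> y x z; rewrite /antipodal => /orP[]/eqP -> // /orP[]/eqP ->.
  by rewrite eqxx orbT.
by rewrite opprK eqxx.
Qed.

Canonical antipodal_equiv :=
  EquivRel antipodal antipodal_refl antipodal_sym antipodal_trans.

Definition projective_space : topologicalType :=
  quotient_topology {eq_quot antipodal}.

End ProjectiveSpace.

Definition Cplx (R : realType) : numClosedFieldType := R[i].

Definition SU2_set (R : realType) : set 'M[Cplx R]_2 :=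
  [set A | A \is unitarymx /\ \det A = 1].
Arguments SU2_set R : clear implicits.

Definition SU2 (R : realType) : Type := set_type (SU2_set R).

Section SU2Group.
Context {R : realType}.

HB.instance Definition _ := Topological.copy (SU2 R) (set_type (SU2_set R)).

Definition SU2_mx (A : SU2 R) : 'M[Cplx R]_2 := set_val A.

Lemma SU2_mxP (A : SU2 R) : SU2_set R (SU2_mx A).
Proof. exact: set_mem (svalP A). Qed.

Lemma SU2_mul_subproof (A B : SU2 R) : SU2_mx A *m SU2_mx B \in SU2_set R.
Proof.
have [UA dA] := SU2_mxP A; have [UB dB] := SU2_mxP B; apply/mem_set; split.
  exact: mul_unitarymx.
by rewrite det_mulmx dA dB mulr1.
Qed.

Lemma SU2_one_subproof : 1%:M \in SU2_set R.
Proof.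
by apply/mem_set; split; [apply/unitarymxP; rewrite mul1mx trmx1 map_mx1|exact: det1].
Qed.

Lemma SU2_inv_subproof (A : SU2 R) : (SU2_mx A)^t* \in SU2_set R.
Proof.
have [UA dA] := SU2_mxP A; apply/mem_set; split.
  by rewrite trmxC_unitary.
by rewrite det_map_mx det_tr dA rmorph1.
Qed.

Definition SU2_mul (A B : SU2 R) : SU2 R :=
  exist _ (SU2_mx A *m SU2_mx B) (SU2_mul_subproof A B).
Definition SU2_one : SU2 R := exist _ 1%:M SU2_one_subproof.
Definition SU2_inv (A : SU2 R) : SU2 R :=
  exist _ ((SU2_mx A)^t*) (SU2_inv_subproof A).

Lemma SU2_mx_inj : injective SU2_mx. Proof. exact: val_inj. Qed.

Lemma SU2_mulA : associative SU2_mul.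
Proof. by move=> A B D; apply: SU2_mx_inj; exact: mulmxA. Qed.

Lemma SU2_mul1 : left_id SU2_one SU2_mul.
Proof. by move=> A; apply: SU2_mx_inj; exact: mul1mx. Qed.

Lemma SU2_mulr1 : right_id SU2_one SU2_mul.
Proof. by move=> A; apply: SU2_mx_inj; exact: mulmx1. Qed.

Lemma SU2_mulrV : right_inverse SU2_one SU2_inv SU2_mul.
Proof. by move=> A; apply: SU2_mx_inj; apply/unitarymxP; case: (SU2_mxP A). Qed.

Lemma SU2_mulV : left_inverse SU2_one SU2_inv SU2_mul.
Proof.
by move=> A; apply: SU2_mx_inj; apply: mulmx1C; apply/unitarymxP; case: (SU2_mxP A).
Qed.

HB.instance Definition _ := Choice.on (SU2 R).
HB.instance Definition _ :=
  isGroup.Build (SU2 R) SU2_mulA SU2_mul1 SU2_mulr1 SU2_mulV SU2_mulrV.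

End SU2Group.

Definition SU2_traceless (R : realType) : set (SU2 R) :=
  [set A | \tr (SU2_mx A) = 0].
Arguments SU2_traceless R : clear implicits.

(* A rectangular (grid) diagram of size n is given by two permutations X, O of
   0, ..., n-1 with X_i <> O_i: in column i there are two marks, in the rows
   X_i and O_i; columns are joined to rows, the vertical segments passing over
   the horizontal ones.  View S^3, the unit sphere of R^4 = R^2 x R^2, as the
   join of the unit circles of the two factors, and put n equally spaced points
   a_0, ..., a_{n-1} (columns) on the first circle and b_0, ..., b_{n-1} (rows)
   on the second one.  grid_knot is the union, over all marks
   (i, j), of the great circle arcs from a_i to b_j; it is the link of the
   diagram, up to mirror image. *)
Section GridKnot.
Context (R : realType) (X O : seq nat).
Local Notation I := (unit_itv R).

Definition first_circle (theta : R) : 'rV[R]_4 :=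
  \row_i [:: cos theta; sin theta; 0; 0]`_i.

Definition second_circle (theta : R) : 'rV[R]_4 :=
  \row_i [:: 0; 0; cos theta; sin theta]`_i.

Definition grid_angle (k : nat) : R := 2 * pi * k%:R / (size X)%:R.

Definition grid_arc (i j : nat) (t : R) : 'rV[R]_4 :=
  cos t *: first_circle (grid_angle i) + sin t *: second_circle (grid_angle j).

Definition grid_arc_tangent (i j : nat) (t : R) : 'rV[R]_4 :=
  - sin t *: first_circle (grid_angle i) +
    cos t *: second_circle (grid_angle j).

Definition grid_knot : set 'rV[R]_4 :=
  [set p | exists (i j : nat) (t : R),
    [/\ (i < size X)%N, j = nth 0%N X i \/ j = nth 0%N O i,
        0 <= t <= pi / 2 & p = grid_arc i j t]].

Definition knot_complement : set 'rV[R]_4 := sphere R 3 `\` grid_knot.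

(* v is the positive unit tangent vector of the link at p, an interior point of
   one of the arcs.  The link is oriented from the mark X to the mark O in every
   column, that is, from b_{X_i} through a_i to b_{O_i}. *)
Definition positive_tangent (p v : 'rV[R]_4) : Prop :=
  exists (i : nat) (t : R), [/\ (i < size X)%N, 0 < t < pi / 2 &
    (p = grid_arc i (nth 0%N O i) t /\ v = grid_arc_tangent i (nth 0%N O i) t)
    \/
    (p = grid_arc i (nth 0%N X i) t /\
     v = - grid_arc_tangent i (nth 0%N X i) t)].

Definition oriented_frame (p v u w : 'rV[R]_4) : Prop :=
  let F : 'M[R]_4 := \matrix_(i < 4) ([:: p; v; u; w]`_i) in
  F *m F^T = 1%:M /\ \det F = 1.

(* the point at (angular) distance s from p in the direction cos a u + sin a w *)
Definition disc_point (p u w : 'rV[R]_4) (s a : R) : 'rV[R]_4 :=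
  cos s *: p + sin s *: (cos a *: u + sin a *: w).

(* The positive meridians: the classes of the loops g c g^-1, where c runs once
   along the boundary of a geodesic disc that is orthogonal to the link at its
   centre p and does not meet the link elsewhere, and g is a path from the base
   point to c.  Orienting S^3 as the boundary of the unit ball, a basis (v, u, w)
   of the tangent space at p is positive iff (p, v, u, w) is a positive basis of
   R^4, so c turns around the link by the right-hand rule. *)
Definition positive_meridian (x0 : knot_complement) :
    set (fundamental_group R x0) :=
  [set m | exists (p v u w : 'rV[R]_4) (eps : R) (y : knot_complement)
      (c : {path I from y to y in knot_complement})
      (g : {path I from x0 to y in knot_complement}),
    [/\ positive_tangent p v /\ oriented_frame p v u w,
        0 < eps < pi,
        (forall s a, 0 <= s <= eps -> grid_knot (disc_point p u w s a) -> s = 0),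
        (forall t : I, set_val (c t) = disc_point p u w eps (2 * pi * coord t)) &
        m = homotopy_class (path_cat (path_cat g c) (path_rev g))]].

Definition SU2_representation (x0 : knot_complement) : Type :=
  {multiplicative fundamental_group R x0 -> SU2 R}.

HB.instance Definition _ x0 := gen_eqMixin (SU2_representation x0).
HB.instance Definition _ x0 := gen_choiceMixin (SU2_representation x0).

Definition traceless_representation (x0 : knot_complement) :
    set (SU2_representation x0) :=
  [set rho | forall m, positive_meridian m -> SU2_traceless R (rho m)].
Arguments traceless_representation x0 : clear implicits.

Definition meridian_eval (x0 : knot_complement) (k : nat)
    (m : 'I_k -> fundamental_group R x0)
    (mP : forall i, positive_meridian (m i))
    (rho : traceless_representation x0) :
    prod_topology (fun _ : 'I_k => SU2_traceless R) :=
  fun i => exist _ (set_val rho (m i))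
             (mem_set (set_mem (svalP rho) (m i) (mP i))).

(* J_C, topologized as a subspace of the product of k copies of C by means of
   the images of the meridians m_i, which are meant to generate the group *)
Definition J_C (x0 : knot_complement) (k : nat)
    (m : 'I_k -> fundamental_group R x0)
    (mP : forall i, positive_meridian (m i)) : topologicalType :=
  initial_topology (@meridian_eval x0 k m mP).

End GridKnot.

Arguments grid_knot R X O : clear implicits.
Arguments knot_complement R X O : clear implicits.
Arguments positive_meridian {R X O} x0.
Arguments J_C {R X O x0 k m} mP.

(* A rectangular diagram of 9_42 with 9 crossings.  Its Alexander polynomial is
   t^4 - 2 t^3 + t^2 - 2 t + 1, which no other knot with at most 9 crossings
   has; the mirror image has a homeomorphic representation variety. *)
Definition X_9_42 : seq nat := [:: 0; 5; 6; 7; 3; 4; 1; 2]%N.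
Definition O_9_42 : seq nat := [:: 3; 1; 2; 4; 5; 0; 6; 7]%N.

Definition complement_9_42 (R : realType) : set 'rV[R]_4 :=
  knot_complement R X_9_42 O_9_42.
Arguments complement_9_42 R : clear implicits.

Definition sphere_or_RP3 (R : realType) (i : option 'I_7) : topologicalType :=
  if i is Some _ then projective_space R 3 else set_type (sphere R 2).

Definition sphere_and_seven_RP3 (R : realType) : topologicalType :=
  {i : option 'I_7 & sphere_or_RP3 R i}.

(* Main.v *)
From HB Require Import structures.
From mathcomp Require Import all_boot all_order all_algebra.
From mathcomp Require Import all_classical all_reals all_analysis.
From mathcomp Require Import homotopy complex ring lra.
Require Import Defs.

Set Implicit Arguments.
Unset Strict Implicit.
Unset Printing Implicit Defensive.

Import Order.TTheory GRing.Theory Num.Theory.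
Import numFieldNormedType.Exports.

Local Open Scope classical_set_scope.
Local Open Scope ring_scope.

(** The complement of the grid knot is covered by the cones over convex pieces:
    first coordinate in an open octant, second coordinate in an open octant, and a
    neighbourhood of the arc from a_i to b_j for every pair (i, j) without a mark.
    Intersections of pieces are empty or simply joined by normalized segments, so
    holonomies of cocycles on this cover identify the fundamental group with the
    group on x_0, ..., x_7 (one generator per column) with one relation per row:
    the ordered product of the generators of the columns active at that row is 1.
    A small circle around an arc crosses four pieces, hence is conjugate to a
    generator of its column or to its inverse.

    Eliminating generators leaves b = x_1 and g = x_0 x_1 x_2 with one relation.
    In SU(2), a pair (b, g) with b traceless is conjugate to b = i and
    g = s + x i + y j with y >= 0, and then the relation and tr x_0 = 0 say that
    either g = b, or s = 0 and 8 x^3 + 4 x^2 - 4 x - 1 = 0, or y = 1/2 and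
    4 x^2 + 2 x - 1 = 0. The first case gives the 2-sphere of all traceless b; the
    others give 3 + 4 = 7 pairs with centralizer {1, -1}, so that the conjugates of
    each form an RP^3. The resulting continuous bijection onto J_C goes from a
    compact space to a Hausdorff one. *)

(** The group consists of classes of actual loops, so generators, relations and meridians must all
    be read off curves. One device serves three times: cocycle values multiplied along a
    subdivision. Values in the fundamental group itself give generators; values in any group
    satisfying the row relations give the universal property; free homotopies of circles give the
    meridians.

    The pieces are cut out by linear inequalities with rational coefficients, so that incidences
    become finite case checks. Orientation signs are not computed: traceless matrices are stable
    under conjugation and inversion, hence a meridian matters only up to both.

    The pair [(b, g)] comes from the fact that conjugation by [g] carries [x_1] to [x_2] and [x_2]
    to [x_3]; moreover all eight generators are conjugates of [x_0], [x_1] or their inverses, which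
    leaves two trace conditions. The roots of the cubic are cos(2 pi/7), cos(4 pi/7), cos(6 pi/7):
    with [s = 0] these are the binary dihedral representations, (7 - 1)/2 in number since the
    determinant is 7. The roots of the quadratic are cos(2 pi/5) and cos(4 pi/5), each taken with
    both signs of [s]. *)

Section Subdivision.
Context {R : realType}.

(** Continuous induction: the supremum of the points reachable from [a] is itself reached by the
    local hypothesis, and a further step of [d / 2] would exceed it unless it is [b]. It plays the
    role of a Lebesgue number for curves and rectangles. *)
Lemma cousin (P : R -> R -> Prop) :
    (forall a b c, a <= b -> b <= c -> P a b -> P b c -> P a c) ->
    (forall t, exists2 d, 0 < d &
       forall a b, t - d < a -> a <= b -> b < t + d -> P a b) ->
  forall a b, a <= b -> P a b.
Proof.
move=> Padd Ploc a b ab.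
pose E := [set x | a <= x <= b /\ P a x].
have Ea : E a.
  split; first by rewrite lexx.
  by have [d d0 Pd] := Ploc a; apply: Pd => //; lra.
have hE : has_sup E by split; [exists a|exists b => x [] /andP[]].
have [d d0 Pd] := Ploc (sup E).
have [x [/andP[ax xb] Pax] xd] := sup_adherent d0 hE.
have xs : x <= sup E by apply: ub_le_sup; [case: hE|split; rewrite ?ax].
pose y := Num.min b (sup E + d / 2).
have sb : sup E <= b by apply: ge_sup; [exists a|move=> z [] /andP[]].
have sy : sup E <= y by rewrite le_min sb /=; lra.
have xy : x <= y by exact: le_trans xs sy.
have yd : y < sup E + d by rewrite gt_min; apply/orP; right; lra.
have Pay : P a y by apply: (Padd _ x) => //; apply: Pd => //; lra.
have yE : E y by split=> //; rewrite (le_trans ax xy) ge_min lexx.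
have : y <= sup E by apply: ub_le_sup => //; case: hE.
rewrite ge_min => /orP[bs|]; last by lra.
suff -> : b = y by [].
by rewrite /y; apply/esym/min_idPl; lra.
Qed.

End Subdivision.

(** * Holonomy of a group-valued cocycle along curves *)

Section Holonomy.
Context {R : realType} {T : topologicalType} {A : Type} (O : A -> set T).
Context (al : T -> A).
Hypothesis Oop : forall a, open (O a).
Hypothesis alP : forall y, O (al y) y.

(** The condition is imposed only where three pieces meet, so values on disjoint pairs are
    arbitrary; the unit and inverse laws hold for pieces that do meet. *)
Definition cocycle (G : groupType) (g : A -> A -> G) :=
  forall a b c y, O a y -> O b y -> O c y -> (g a b * g b c = g a c)%g.

Context {G : groupType} (g : A -> A -> G).
Hypothesis gP : cocycle g.

Lemma cocycle_diag a y : O a y -> g a a = 1%g.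
Proof. by move=> ay; apply: (mulgI (g a a)); rewrite mulg1 (gP ay). Qed.

Lemma cocycleV a b y : O a y -> O b y -> (g a b = (g b a)^-1)%g.
Proof.
move=> ay by_; apply: (mulIg (g b a)).
by rewrite (gP ay by_ ay) mulVg (cocycle_diag ay).
Qed.

(* The curve f, cut at finitely many points into pieces lying in members of the
   cover, has holonomy h from a to b; al normalises the contribution of the end
   points. *)
Inductive hol (f : R -> T) : R -> R -> G -> Prop :=
| hol_step a b i : a <= b -> (forall t, a <= t <= b -> O i (f t)) ->
    hol f a b (g (al (f a)) i * g i (al (f b)))%g
| hol_cat a b c h k : a <= b -> b <= c -> hol f a b h -> hol f b c k ->
    hol f a c (h * k)%g.

Lemma hol_le f a b h : hol f a b h -> a <= b.
Proof. by elim=> // x y z _ _ xy yz _ _ _ _; exact: le_trans xy yz. Qed.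

(** Near [t] the curve stays in the piece [al (f t)], so a single step exists locally and [cousin]
    chains the steps. *)
Lemma hol_ex f a b : continuous f -> a <= b -> exists h, hol f a b h.
Proof.
move=> cf; apply: (@cousin R (fun a b => exists h, hol f a b h)).
  by move=> {}a {}b c ab bc [h H] [k K]; exists (h * k)%g; exact: hol_cat H K.
move=> t; have : nbhs t (f @^-1` O (al (f t))).
  by apply: cf; apply: open_nbhs_nbhs; split.
case/nbhs_ballP => d /= d0 dO; exists d => // x y tx xy yt.
exists (g (al (f x)) (al (f t)) * g (al (f t)) (al (f y)))%g.
apply: hol_step => // z /andP[xz zy]; apply: dO.
by rewrite /ball /= ltr_distlC; apply/andP; split; lra.
Qed.

Lemma hol_split f a b c h : hol f a b h -> a <= c <= b ->
  exists h1 h2, [/\ hol f a c h1, hol f c b h2 & h = h1 * h2]%g.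
Proof.
move=> H; elim: H c => {a b h}
    [a b i ab fO|a b e h k ab be H IH K IK] c /andP[ac cb].
  have Oc : O i (f c) by apply: fO; rewrite ac cb.
  exists (g (al (f a)) i * g i (al (f c)))%g.
  exists (g (al (f c)) i * g i (al (f b)))%g; split.
  - apply: hol_step => // t /andP[at_ tc]; apply: fO.
    by rewrite at_ (le_trans tc cb).
  - apply: hol_step => // t /andP[ct tb]; apply: fO.
    by rewrite (le_trans ac ct) tb.
  - rewrite -!mulgA; congr (_ * _)%g; rewrite mulgA.
    by rewrite (gP Oc (alP _) Oc) (cocycle_diag Oc) mul1g.
have [cb'|/ltW bc] := leP c b.
  have [|h1 [h2 [H1 H2 ->]]] := IH c; first by rewrite ac.
  exists h1, (h2 * k)%g; split; rewrite ?mulgA //; exact: hol_cat H2 K.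
have [|h1 [h2 [H1 H2 ->]]] := IK c; first by rewrite bc.
exists (h * h1)%g, h2; split; rewrite ?mulgA //; exact: hol_cat H H1.
Qed.

(** Inside one piece the intermediate contributions telescope whatever the subdivision was; this is
    the source of uniqueness. *)
Lemma hol_in f a b i h : (forall t, a <= t <= b -> O i (f t)) ->
  hol f a b h -> h = (g (al (f a)) i * g i (al (f b)))%g.
Proof.
move=> fO H; elim: H fO => {a b h} [a b j ab fj|a b e h k ab be H IH K IK] fi.
  have [ja jb] : O j (f a) /\ O j (f b) by split; apply: fj; rewrite ?lexx ?ab.
  have [ia ib] : O i (f a) /\ O i (f b) by split; apply: fi; rewrite ?lexx ?ab.
  rewrite -(gP (alP _) ia ja) -(gP jb ib (alP _)) -mulgA; congr (_ * _)%g.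
  by rewrite mulgA (gP ia ja ia) (cocycle_diag ia) mul1g.
rewrite IH; last by move=> t /andP[at_ tb]; apply: fi; rewrite at_ (le_trans tb).
rewrite IK; last by move=> t /andP[bt te]; apply: fi; rewrite te (le_trans ab).
have ib : O i (f b) by apply: fi; rewrite ab be.
rewrite -!mulgA; congr (_ * _)%g; rewrite mulgA.
by rewrite (gP ib (alP _) ib) (cocycle_diag ib) mul1g.
Qed.

(** The second derivation is split at the cut points of the first, which reduces to curves inside
    one piece. *)
Lemma hol_uniq f a b h k : hol f a b h -> hol f a b k -> h = k.
Proof.
move=> H; elim: H k => {a b h} [a b i ab fO|a b e h k ab be H IH K IK] l L.
  by rewrite (hol_in fO L).
have [|l1 [l2 [L1 L2 ->]]] := hol_split (c := b) L; first by rewrite ab.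
by rewrite (IH _ L1) (IK _ L2).
Qed.

Lemma hol_cst f a b h :
  (forall t, a <= t <= b -> f t = f a) -> hol f a b h -> h = 1%g.
Proof.
move=> fc H; rewrite (hol_in (i := al (f a)) _ H); last first.
  by move=> t /fc ->; exact: alP.
rewrite (fc b) ?(hol_le H) ?lexx //.
by rewrite (cocycle_diag (alP _)) mulg1.
Qed.

Lemma hol_affine f f' k c a b h : 0 < k ->
  (forall t, a <= t <= b -> f' t = f (k * t + c)) ->
  hol f (k * a + c) (k * b + c) h -> hol f' a b h.
Proof.
(* The end points become variables, so that induction on the derivation is possible. *)
move=> k0; move: {-1}(k * a + c) (erefl (k * a + c)) => p pE.
move: {-1}(k * b + c) (erefl (k * b + c)) => q qE ff' H.
have kle x y : (k * x + c <= k * y + c) = (x <= y) by rewrite lerD2r ler_pM2l.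
elim: H a b ff' pE qE => {p q h} [p q i pq fO|p q e h l pq qe H IH L IL] a b ff' pE qE.
  have ab : a <= b by rewrite -kle pE qE.
  rewrite -pE -qE -!ff' ?lexx ?ab //; apply: hol_step => // t tab.
  by rewrite ff' //; apply: fO; rewrite -pE -qE !kle.
have qE' : k * ((q - c) / k) + c = q by rewrite mulrC divfK ?gt_eqF // subrK.
have aq : a <= (q - c) / k by rewrite -kle qE' pE.
have qb : (q - c) / k <= b by rewrite -kle qE' qE.
apply: (hol_cat aq qb).
  apply: IH => // t /andP[t1 t2]; apply: ff'; rewrite t1; exact: le_trans qb.
apply: IL => // t /andP[t1 t2]; apply: ff'; rewrite t2 andbT; exact: le_trans t1.
Qed.

(** The identity is additive under cuts in both directions, and on a rectangle inside one piece both
    sides telescope to the same product. *)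
Lemma hol_rect (H : R -> R -> T) : continuous (fun p : R * R => H p.1 p.2) ->
  forall a b, a <= b -> forall c d, c <= d -> forall hb hr hl ht,
  hol (H^~ c) a b hb -> hol (H b) c d hr -> hol (H a) c d hl ->
  hol (H^~ d) a b ht -> (hb * hr = hl * ht)%g.
Proof.
move=> cH.
have cH1 t : continuous (H^~ t).
  by apply: (comp_cts (f := fun s => (s, t)) _ cH); apply: pair_cts => s;
    [exact: cvg_id|exact: cvg_cst].
have cH2 s : continuous (H s).
  by apply: (comp_cts (f := fun t => (s, t)) _ cH); apply: pair_cts => t;
    [exact: cvg_cst|exact: cvg_id].
pose Q a b c d := a <= b -> c <= d -> forall hb hr hl ht,
  hol (H^~ c) a b hb -> hol (H b) c d hr -> hol (H a) c d hl ->
  hol (H^~ d) a b ht -> (hb * hr = hl * ht)%g.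
have Qadd1 a b e c d : a <= b -> b <= e -> Q a b c d -> Q b e c d -> Q a e c d.
  move=> ab be Q1 Q2 ae cd hb hr hl ht Hb Hr Hl Ht.
  have [|b1 [b2 [Hb1 Hb2 ->]]] := hol_split (c := b) Hb; first by rewrite ab.
  have [|t1 [t2 [Ht1 Ht2 ->]]] := hol_split (c := b) Ht; first by rewrite ab.
  have [m Hm] := hol_ex (cH2 b) cd.
  by rewrite -mulgA (Q2 be cd _ _ _ _ Hb2 Hr Hm Ht2) mulgA
    (Q1 ab cd _ _ _ _ Hb1 Hm Hl Ht1) mulgA.
have Qadd2 a b c d e : c <= d -> d <= e -> Q a b c d -> Q a b d e -> Q a b c e.
  move=> cd de Q1 Q2 ab ce hb hr hl ht Hb Hr Hl Ht.
  have [|r1 [r2 [Hr1 Hr2 ->]]] := hol_split (c := d) Hr; first by rewrite cd.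
  have [|l1 [l2 [Hl1 Hl2 ->]]] := hol_split (c := d) Hl; first by rewrite cd.
  have [m Hm] := hol_ex (cH1 d) ab.
  by rewrite mulgA (Q1 ab cd _ _ _ _ Hb Hr1 Hl1 Hm) -!mulgA
    (Q2 ab de _ _ _ _ Hm Hr2 Hl2 Ht).
suff QT a b c d : Q a b c d by move=> a b ab c d cd; exact: QT.
have [ab|nab] := boolP (a <= b); last by move=> ab; rewrite ab in nab.
have [cd|ncd] := boolP (c <= d); last by move=> _ cd; rewrite cd in ncd.
(* The outer [cousin] glues thin strips of full width [[a, b]]; the inner one builds such a strip
   from small rectangles, keeping the minimum of the heights. *)
suff loc t : exists2 e, 0 < e & forall x y, t - e < x -> x <= y -> y < t + e ->
    Q a b x y.
  apply: (@cousin R (fun c d => Q a b c d)) => // x y z xy yz; exact: Qadd2.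
pose P a b := exists2 e, 0 < e & forall x y, t - e < x -> x <= y -> y < t + e ->
  Q a b x y.
apply: (@cousin R P) => // [x y z xy yz [e e0 Pe] [e' e'0 Pe']|s].
  exists (Num.min e e'); first by rewrite lt_min e0.
  have [m1 m2] : Num.min e e' <= e /\ Num.min e e' <= e'.
    by rewrite !ge_min !lexx orbT.
  move=> u v uu uv vv; apply: (Qadd1 _ y) => //; first by apply: Pe => //; lra.
  by apply: Pe' => //; lra.
have : nbhs (s, t) ((fun p : R * R => H p.1 p.2) @^-1` O (al (H s t))).
  by apply: cH; apply: open_nbhs_nbhs; split.
case=> -[B1 B2] /= [/nbhs_ballP[e /= e0 eB] /nbhs_ballP[e' /= e'0 eB']] BO.
set i := al (H s t) in BO.
have HO x y : s - e < x -> x < s + e -> t - e' < y -> y < t + e' -> O i (H x y).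
  move=> x1 x2 y1 y2; apply: (BO (x, y)); split=> /=; [apply: eB|apply: eB'];
    by rewrite /ball /= ltr_distlC; apply/andP; split; lra.
exists e => // x y sx xy ys; exists e' => // u v tu uv vt _ _ hb hr hl ht Hb Hr Hl Ht.
have xi z w : x <= z <= y -> u <= w <= v -> O i (H z w).
  by move=> /andP[? ?] /andP[? ?]; apply: HO; lra.
rewrite (hol_in (i := i) _ Hb) => [|z zxy]; last by apply: xi; rewrite ?lexx.
rewrite (hol_in (i := i) _ Ht) => [|z zxy]; last by apply: xi; rewrite ?lexx ?uv.
rewrite (hol_in (i := i) _ Hl) => [|z zxy]; last by apply: xi; rewrite ?lexx ?xy.
rewrite (hol_in (i := i) _ Hr) => [|z zxy]; last by apply: xi; rewrite ?lexx ?xy.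
have Oi z w : x <= z <= y -> u <= w <= v ->
    (g i (al (H z w)) * g (al (H z w)) i = 1)%g.
  by move=> zx wu; rewrite (gP (xi _ _ zx wu) (alP _) (xi _ _ zx wu))
    (cocycle_diag (xi _ _ zx wu)).
rewrite -!mulgA; congr (_ * _)%g; rewrite [LHS]mulgA [RHS]mulgA !Oi //;
  by rewrite ?lexx ?xy ?uv.
Qed.

Section Loops.
Local Notation I := (unit_itv R).
Local Notation pathI x y := {path I from x to y in T}.

(** Choice turns the relation into a function; by [hol_ex] the default 1 does not occur for
    continuous paths. *)
Definition path_hol (f : I -> T) : G := xget 1%g (hol (f \o clip) 0 1).

Lemma path_holP (f : I -> T) : continuous f -> hol (f \o clip) 0 1 (path_hol f).
Proof.
move=> cf; have [|h H] := @hol_ex (f \o clip) 0 1 _ ler01.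
  exact: comp_cts (@clip_continuous R) cf.
by rewrite /path_hol; apply: (@xgetPex _ 1%g (hol (f \o clip) 0 1)); exists h.
Qed.

Lemma path_hol_eq f h : continuous f -> hol (f \o clip) 0 1 h -> path_hol f = h.
Proof. by move=> /path_holP H K; exact: hol_uniq H K. Qed.

Lemma path_hol_in x y (f : pathI x y) i : (forall t, O i (f t)) ->
  path_hol f = (g (al x) i * g i (al y))%g.
Proof.
move=> fO; have cf : continuous f by exact: path_cts.
have -> := @hol_in (f \o clip) 0 1 i _ (fun t _ => fO (clip t)) (path_holP cf).
by rewrite /= -[clip 0]/zero -[clip 1]/one path_zero path_one.
Qed.

Lemma path_hol_cat x y z (f : pathI x y) (f' : pathI y z) :
  path_hol (path_cat f f') = (path_hol f * path_hol f')%g.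
Proof.
apply: path_hol_eq; first exact: path_cts.
apply: (@hol_cat _ _ 2^-1); try lra.
  apply: (@hol_affine (f \o clip) _ 2 0); rewrite ?ltr0n //.
    move=> t t01; rewrite addr0 /= /mk_path /path_cat_fun clipK ?ifT //; lra.
  by rewrite mulr0 divff ?pnatr_eq0 // !addr0; apply: path_holP; exact: path_cts.
apply: (@hol_affine (f' \o clip) _ 2 (-1)); rewrite ?ltr0n //.
  move=> t t01; rewrite /= /mk_path /path_cat_fun clipK; last by lra.
  case: leP => // t2; have -> : t = 2^-1 by lra.
  rewrite divff ?pnatr_eq0 // subrr clip_ge1 // clip_le0 //.
  by rewrite path_zero path_one.
rewrite divff ?pnatr_eq0 // subrr (_ : 2 * 1 - 1 = 1); last by lra.
by apply: path_holP; exact: path_cts.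
Qed.

(** All four sides may move. Constant vertical sides give invariance under homotopy of paths; equal
    vertical sides compare freely homotopic loops. *)
Lemma path_hol_square (H : R -> R -> T) (h0 h1 v0 v1 : I -> T) :
  continuous (fun p : R * R => H p.1 p.2) ->
  continuous h0 -> continuous h1 -> continuous v0 -> continuous v1 ->
  (forall t, 0 <= t <= 1 -> H 0 t = h0 (clip t)) ->
  (forall t, 0 <= t <= 1 -> H 1 t = h1 (clip t)) ->
  (forall t, 0 <= t <= 1 -> H t 0 = v0 (clip t)) ->
  (forall t, 0 <= t <= 1 -> H t 1 = v1 (clip t)) ->
  (path_hol v0 * path_hol h1 = path_hol h0 * path_hol v1)%g.
Proof.
move=> cH ch0 ch1 cv0 cv1 H0 H1 V0 V1.
have aff (f f' : R -> T) h : (forall t, 0 <= t <= 1 -> f' t = f t) ->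
    hol f 0 1 h -> hol f' 0 1 h.
  move=> ff' F; apply: (@hol_affine f _ 1 0) => // [t t01|].
    by rewrite mul1r addr0 ff'.
  by rewrite !mul1r !addr0.
exact: (hol_rect cH ler01 ler01 (aff _ _ _ V0 (path_holP cv0))
  (aff _ _ _ H1 (path_holP ch1)) (aff _ _ _ H0 (path_holP ch0))
  (aff _ _ _ V1 (path_holP cv1))).
Qed.

Lemma path_hol_constant (x : T) : path_hol (fun=> x) = 1%g.
Proof.
have cf : continuous (fun _ : I => x) by exact: cst_continuous.
exact: (@hol_cst ((fun _ : I => x) \o clip) 0 1 _ _ (path_holP cf)).
Qed.

Lemma clip2_cts (H : I * I -> T) : continuous H ->
  continuous (fun p : R * R => H (clip p.1, clip p.2)).
Proof.
move=> cH; apply: (comp_cts (f := fun p : R * R => (clip p.1, clip p.2)) _ cH).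
by apply: pair_cts; apply: comp_cts (@clip_continuous R);
  [exact: fst_cts|exact: snd_cts].
Qed.

Lemma path_hol_homotopic x y (f f' : pathI x y) :
  path_homotopic f f' -> path_hol f = path_hol f'.
Proof.
case=> H [cH H0 H1 Hxy].
have E := @path_hol_square (fun s t => H (clip s, clip t)) f f'
  (fun=> x) (fun=> y) (clip2_cts cH) (@path_cts _ _ _ _ f) (@path_cts _ _ _ _ f')
  (@cst_continuous _ _ x) (@cst_continuous _ _ y) (fun t _ => H0 (clip t))
  (fun t _ => H1 (clip t)) (fun t _ => (Hxy (clip t)).1)
  (fun t _ => (Hxy (clip t)).2).
by move: E; rewrite !path_hol_constant mulg1 mul1g.
Qed.

Lemma path_hol_rev x y (f : pathI x y) : path_hol (path_rev f) = (path_hol f)^-1%g.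
Proof.
apply: (mulIg (path_hol f)); rewrite mulVg -path_hol_cat.
by rewrite (path_hol_homotopic (path_rev_cat f)) path_hol_constant.
Qed.

Lemma path_hol_mem (S : {pred G}) : group_closed S ->
  (forall a b y, O a y -> O b y -> g a b \in S) ->
  forall f : I -> T, continuous f -> path_hol f \in S.
Proof.
move=> Sg gS f /path_holP; move: (path_hol f) (0 : R) (1 : R) => h a b.
have SM : forall x y, x \in S -> y \in S -> (x * y)%g \in S.
  by move=> x y xS yS; exact: (group_closedM Sg).
elim=> {a b h} [a b i ab fO|a b e h k _ _ _ hS _ kS]; last exact: SM.
apply: SM; [apply: (gS _ _ (f (clip a)))|apply: (gS _ _ (f (clip b)))];
  rewrite ?alP //; apply: fO; by rewrite ?lexx ?ab.
Qed.

Definition loop_hol (x0 : T) (m : fundamental_group R x0) : G := path_hol (repr m).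

Lemma loop_hol_class x0 (f : pathI x0 x0) : loop_hol (homotopy_class f) = path_hol f.
Proof.
by apply: path_hol_homotopic; apply/homotopy_class_eq; rewrite homotopy_class_repr.
Qed.

Lemma loop_holM x0 : {morph @loop_hol x0 : m n / (m * n)%g}.
Proof.
move=> m n; rewrite -(homotopy_class_repr m) -(homotopy_class_repr n).
have -> : forall a b : fundamental_group R x0, (a * b)%g = pi1_mul a b by [].
by rewrite homotopy_class_cat !loop_hol_class path_hol_cat.
Qed.

End Loops.

End Holonomy.

Lemma gauge_cocycle (T : topologicalType) (A : Type) (O : A -> set T) (G : groupType)
    (g : A -> A -> G) (k : A -> G) :
  cocycle O g -> cocycle O (fun a b => (k a)^-1 * g a b * k b)%g.
Proof.
move=> gP a b c y ay by_ cy; rewrite -(gP _ _ _ _ ay by_ cy).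
by rewrite !mulgA mulgK.
Qed.

(** The inner gauge factors cancel, so loops change by a conjugation only. A cocycle may therefore
    be normalized along a tree of pieces. *)
Lemma path_hol_gauge (R : realType) (T : topologicalType) (A : Type)
    (O : A -> set T) (al : T -> A) (G : groupType) (g : A -> A -> G) (k : A -> G) :
  (forall a, open (O a)) -> (forall y, O (al y) y) -> cocycle O g ->
  forall f : unit_itv R -> T, continuous f ->
  path_hol O al (fun a b => (k a)^-1 * g a b * k b)%g f =
  ((k (al (f zero)))^-1 * path_hol O al g f * k (al (f one)))%g.
Proof.
move=> Oop alP gP f cf; apply: path_hol_eq => //; first exact: gauge_cocycle.
change zero with (clip (0 : R)); change one with (clip (1 : R)).
elim: (path_holP Oop alP g cf) => [a b i ab fO|a b c h l ab bc _ H _ K].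
  have -> : ((k (al (f (clip a))))^-1 * (g (al (f (clip a))) i *
      g i (al (f (clip b)))) * k (al (f (clip b))) =
      ((k (al (f (clip a))))^-1 * g (al (f (clip a))) i * k i) *
      ((k i)^-1 * g i (al (f (clip b))) * k (al (f (clip b)))))%g.
    by rewrite !mulgA mulgK.
  exact: (hol_step _ (fun a b => (k a)^-1 * g a b * k b)%g).
move: (hol_cat ab bc H K); rewrite /= !mulgA.
by rewrite -!mulgA mulVKg.
Qed.

(** * The universal cocycle of a cover, with values in the fundamental group *)

Section VanKampen.
Context {R : realType} {T : topologicalType} {A : Type} (O : A -> set T).
Context (al : T -> A).
Local Notation I := (unit_itv R).
Local Notation pathI x y := {path I from x to y in T}.
Hypothesis Oop : forall a, open (O a).
Hypothesis alP : forall y, O (al y) y.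
Hypothesis joined : forall a b y y', O a y -> O b y -> O a y' -> O b y' ->
  exists f : pathI y y', forall t, O a (f t) /\ O b (f t).
Hypothesis unique : forall a y y' (f f' : pathI y y'),
  (forall t, O a (f t)) -> (forall t, O a (f' t)) -> path_homotopic f f'.
Context (x0 : T) (p : forall y, pathI x0 y).
Local Notation pi1 := (fundamental_group R x0).

(** A multiplicative map on all paths, not only loops. As [p x0] may be any loop, a loop is sent to
    a conjugate of its class. *)
Definition path_class x y (f : pathI x y) : pi1 :=
  homotopy_class (path_cat (path_cat (p x) f) (path_rev (p y))).

Lemma path_class_homotopic x y (f f' : pathI x y) :
  path_homotopic f f' -> path_class f = path_class f'.
Proof.
move=> ff'; apply/homotopy_class_eq; apply: path_cat_homotopic.
  by apply: path_cat_homotopic => //; exact: path_homotopic_refl.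
exact: path_homotopic_refl.
Qed.

Lemma path_class_cat x y z (f : pathI x y) (g : pathI y z) :
  path_class (path_cat f g) = (path_class f * path_class g)%g.
Proof.
rewrite [RHS]homotopy_class_cat; apply/homotopy_class_eq/path_homotopic_sym.
pose r := p y; pose q := path_rev (p z).
have H1 : path_homotopic (path_cat (path_rev r) (path_cat (path_cat r g) q))
    (path_cat g q).
  apply: path_homotopic_trans (path_cst_cat _).
  apply: path_homotopic_trans; last first.
    by apply: path_cat_homotopic (path_homotopic_refl _); exact: (path_rev_cat r).
  apply: path_homotopic_trans (path_homotopic_sym (path_cat_assoc _ _ _)).
  apply: path_cat_homotopic (path_homotopic_refl _) _; exact: path_cat_assoc.
apply: path_homotopic_trans (path_cat_assoc _ _ _) _.
apply: path_homotopic_trans (path_cat_homotopic (path_homotopic_refl _) H1) _.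
apply: path_homotopic_trans (path_homotopic_sym (path_cat_assoc _ _ _)) _.
by apply: path_cat_homotopic (path_homotopic_refl _); exact: path_cat_assoc.
Qed.

Lemma path_class_loop (f : pathI x0 x0) :
  path_class f = (homotopy_class (p x0) * homotopy_class f *
                  (homotopy_class (p x0))^-1)%g.
Proof.
have -> : (homotopy_class (p x0))^-1%g = homotopy_class (path_rev (p x0)).
  exact: homotopy_class_rev.
by rewrite [X in (X * _)%g]homotopy_class_cat [RHS]homotopy_class_cat.
Qed.

Definition center a : T := xget x0 (O a).

Lemma centerP a y : O a y -> O a (center a).
Proof. by move=> ay; apply: xgetPex; exists y. Qed.

Definition radial a y : pi1 := xget 1%g [set m | exists f : pathI y (center a),
  (forall t, O a (f t)) /\ m = path_class f].

Lemma radialE a y (f : pathI y (center a)) :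
  (forall t, O a (f t)) -> radial a y = path_class f.
Proof.
move=> fO; pose P := [set m | exists f : pathI y (center a),
  (forall t, O a (f t)) /\ m = path_class f].
have /(xgetPex (1%g : pi1)) [g [gO E]] : exists m, P m by exists (path_class f), f.
by rewrite /radial E; apply: path_class_homotopic; exact: unique gO fO.
Qed.

Lemma path_class_in a y y' (f : pathI y y') : (forall t, O a (f t)) ->
  path_class f = (radial a y * (radial a y')^-1)%g.
Proof.
move=> fO; have ay' : O a y' by rewrite -[y'](@path_one _ _ _ _ f).
have [g gO] := joined ay' ay' (centerP ay') (centerP ay').
have g1 t : O a (g t) by case: (gO t).
have fgO t : O a (path_cat f g t).
  by rewrite /= /mk_path /path_cat_fun; case: ifP.
by rewrite (radialE g1) (radialE fgO) path_class_cat mulgK.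
Qed.

(** The transition between the radial trivializations over two pieces. Path connected overlaps make
    it independent of the common point; disjoint pairs get the default 1. *)
Definition overlap a b : pi1 := xget 1%g [set m | exists y,
  [/\ O a y, O b y & m = (radial a y)^-1 * radial b y]%g].

Lemma overlapE a b y : O a y -> O b y ->
  overlap a b = ((radial a y)^-1 * radial b y)%g.
Proof.
move=> ay by_; pose P := [set m | exists y,
  [/\ O a y, O b y & m = (radial a y)^-1 * radial b y]%g].
have /(xgetPex (1%g : pi1)) [y' [ay' by' E']] : exists m, P m.
  by exists ((radial a y)^-1 * radial b y)%g, y.
rewrite /overlap E' {E' P}.
have [f fO] := joined ay by_ ay' by'.
have := path_class_in (a := a) (fun t => (fO t).1).
rewrite (path_class_in (a := b) (fun t => (fO t).2)) => E.
apply: (mulgI (radial a y)); rewrite mulVKg.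
by rewrite mulgA -E mulgVK.
Qed.

Lemma overlap_cocycle : cocycle O overlap.
Proof.
move=> a b c y ay by_ cy; rewrite !(@overlapE _ _ y) //.
by rewrite mulgA mulgK.
Qed.

(** The holonomy of [overlap] is the path class itself, up to the radial factors at both ends, which
    cancel when curves are joined. *)
Lemma hol_path_class (f : R -> T) a b h : continuous f ->
  hol O al overlap f a b h -> forall phi : pathI (f a) (f b),
  (forall t, phi t = f (a + (b - a) * coord t)) ->
  path_class phi = (radial (al (f a)) (f a) * h * (radial (al (f b)) (f b))^-1)%g.
Proof.
move=> cf; elim=> {a b h} [a b i ab fO|a b c h k ab bc _ IH _ IK] phi phiE.
  have phiO t : O i (phi t).
    have /andP[t0 t1] := coord_itv t; rewrite phiE; apply: fO; nra.
  have [ia ib] : O i (f a) /\ O i (f b) by split; apply: fO; rewrite ?lexx ?ab.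
  rewrite (path_class_in phiO) (overlapE (alP (f a)) ia) (overlapE ib (alP (f b))).
  by rewrite !mulgA mulgV mul1g mulgK.
have mk u v : exists psi : pathI (f u) (f v),
    forall t, psi t = f (u + (v - u) * coord t).
  have c1 : continuous (fun t : I => f (u + (v - u) * coord t)).
    apply: (comp_cts (f := fun t : I => u + (v - u) * coord t)) cf.
    rewrite (_ : (fun _ => _) = (fun t : I => (v - u) * coord t + u)).
      exact: (affine_cts (@coord_continuous R)).
    by apply/funext => t; rewrite addrC.
  have e0 : f (u + (v - u) * coord (zero : I)) = f u by rewrite coord0 mulr0 addr0.
  have e1 : f (u + (v - u) * coord (one : I)) = f v.
    by rewrite coord1 mulr1 addrC subrK.
  by exists (mk_path c1 e0 e1).
have [p1 p1E] := mk a b; have [p2 p2E] := mk b c.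
(* The cut point in the parameter of [phi]. For [a = c] the quotient is 0 by convention, which
   agrees with [b = a]. The homotopy below moves the cut from [l] to 1/2. *)
pose l := (b - a) / (c - a).
have lE : l * (c - a) = b - a.
  have [ac|ac] := eqVneq (c - a) 0; last by rewrite divfK.
  by rewrite ac mulr0; lra.
have l01 : 0 <= l <= 1.
  have [ac|ac] := eqVneq (c - a) 0; first by rewrite /l ac invr0 mulr0 lexx ler01.
  have ac0 : 0 < c - a by rewrite lt_def ac /=; lra.
  by apply/andP; split; [apply: divr_ge0; lra|rewrite ler_pdivrMr // mul1r; lra].
have H : path_homotopic phi (path_cat p1 p2).
  apply: (@path_reparam_homotopic _ _ _ _ _ _ phi _ _ id
    (fun t => l * Num.min 1 (2 * t) + (1 - l) * Num.max 0 (2 * t - 1))).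
  - by move=> t; exact: cvg_id.
  - have c1 : continuous (fun t : R => Num.min 1 (2 * t)).
      move=> t; apply: continuous_min; first exact: cvg_cst.
      by apply: scale_cts => s; exact: cvg_id.
    have c2 : continuous (fun t : R => Num.max 0 (2 * t - 1)).
      apply: max_cts; first exact: cst_continuous.
      by apply: affine_cts => s; exact: cvg_id.
    by move=> t; apply: cvgD; apply: (scale_cts (h := fun t => _)).
  - move=> t t01; split=> //.
    by case: (leP 1 (2 * t)) => h1; case: (leP 0 (2 * t - 1)) => h2; nra.
  - by rewrite mulr0 sub0r (min_idPr ler01) max_l ?mulr0 ?addr0 //; lra.
  - rewrite mulr1 min_l ?max_r; lra.
  - by move=> t; rewrite coordK.
  - move=> t; have t01 := coord_itv t.
    rewrite /= /mk_path /path_cat_fun.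
    case: (leP (coord t)) => t2.
      have -> : Num.min 1 (2 * coord t) = 2 * coord t by apply/min_idPr; lra.
      have -> : Num.max 0 (2 * coord t - 1) = 0 by apply/max_idPl; lra.
      have E1 : coord (clip (2 * coord t)) = 2 * coord t by apply: clipK; lra.
      have E2 : coord (clip (l * (2 * coord t) + (1 - l) * 0)) = l * (2 * coord t).
        by rewrite mulr0 addr0; apply: clipK; nra.
      rewrite p1E phiE E1 E2; congr (f (_ + _)).
      by rewrite -lE; ring.
    have -> : Num.min 1 (2 * coord t) = 1 by apply/min_idPl; lra.
    have -> : Num.max 0 (2 * coord t - 1) = 2 * coord t - 1 by apply/max_idPr; lra.
    have E1 : coord (clip (2 * coord t - 1)) = 2 * coord t - 1 by apply: clipK; lra.
    have E2 : coord (clip (l * 1 + (1 - l) * (2 * coord t - 1))) =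
        l * 1 + (1 - l) * (2 * coord t - 1) by apply: clipK; nra.
    rewrite p2E phiE E1 E2; congr (f _).
    have -> : b = a + l * (c - a) by rewrite lE; ring.
    by ring.
rewrite (path_class_homotopic H) path_class_cat (IH _ p1E) (IK _ p2E).
by rewrite !mulgA mulgVK.
Qed.

Lemma path_hol_class x y (f : pathI x y) :
  path_class f = (radial (al x) x * path_hol O al overlap f * (radial (al y) y)^-1)%g.
Proof.
have [e0 e1] : (f \o clip) 0 = x /\ (f \o clip) 1 = y.
  by rewrite /= -[clip 0]/zero -[clip 1]/one path_zero path_one.
have cf : continuous (f \o clip).
  exact: comp_cts (@clip_continuous R) (@path_cts _ _ _ _ f).
have := hol_path_class cf (path_holP Oop alP overlap (@path_cts _ _ _ _ f)).
rewrite e0 e1; apply=> t.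
by rewrite /= add0r subr0 mul1r coordK.
Qed.

(** For the tautological cocycle holonomy is an inner automorphism, so a loop is recovered from its
    holonomy. *)
Lemma loop_hol_overlap : exists c, forall m : pi1,
  loop_hol O al overlap m = (m ^ c)%g.
Proof.
exists ((homotopy_class (p x0))^-1 * radial (al x0) x0)%g => m.
have := path_hol_class (repr m); rewrite path_class_loop homotopy_class_repr.
rewrite /loop_hol => /(congr1 (fun z => (radial (al x0) x0)^-1 * z *
  radial (al x0) x0)%g).
by rewrite -!mulgA mulKg mulVg mulg1 /conjg invgM invgK !mulgA.
Qed.

(** Every element is a holonomy, hence a product of transitions; the gauge [k] is free, so that
    transitions along a tree can be made trivial before testing membership. *)
Lemma overlap_generates (S : {pred pi1}) (k : A -> pi1) : group_closed S ->
  (forall a b y, O a y -> O b y -> (k a)^-1 * overlap a b * k b \in S)%g ->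
  forall m, m \in S.
Proof.
move=> Sg ES m; have [c cE] := loop_hol_overlap.
rewrite -(conjgK (c * k (al x0))^-1%g m) invgK conjgM -cE; set n := (m ^ _)%g.
have -> : ((loop_hol O al overlap n) ^ k (al x0) =
    loop_hol O al (fun a b => (k a)^-1 * overlap a b * k b) n)%g.
  have := path_hol_gauge k Oop alP overlap_cocycle (@path_cts _ _ _ _ (repr n)).
  by rewrite path_zero path_one /conjg mulgA => <-.
exact: (path_hol_mem Oop alP Sg ES (@path_cts _ _ _ _ (repr _))).
Qed.

(** Universality: the homomorphism defined by [g] turns the tautological cocycle back into [g], up
    to the gauge given by the holonomy of the base path to the centre of each piece. *)
Lemma loop_hol_of_overlap (G : groupType) (g : A -> A -> G) : cocycle O g ->
  exists k : A -> G, forall a b y, O a y -> O b y ->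
  (loop_hol O al g (overlap a b) = k a * g a b * (k b)^-1)%g.
Proof.
move=> gP; pose P y := path_hol O al g (p y).
have LM : forall m n : pi1, (loop_hol O al g (m * n) =
    loop_hol O al g m * loop_hol O al g n)%g.
  by move=> m n; exact: loop_holM.
have L1 : (loop_hol O al g (1 : pi1) = 1)%g.
  by apply: (mulgI (loop_hol O al g (1 : pi1)%g)); rewrite -LM !mulg1.
have LV (m : pi1) : (loop_hol O al g m^-1 = (loop_hol O al g m)^-1)%g.
  by apply: (mulgI (loop_hol O al g m)); rewrite -LM !mulgV L1.
have clsE x y (f : pathI x y) :
    (loop_hol O al g (path_class f) = P x * path_hol O al g f * (P y)^-1)%g.
  by rewrite /path_class loop_hol_class // !path_hol_cat // path_hol_rev.
exists (fun a => (P (center a) * (g a (al (center a)))^-1)%g) => a b y ay by_.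
have rad c : O c y -> (loop_hol O al g (radial c y) =
    P y * g (al y) c * (P (center c) * (g c (al (center c)))^-1)^-1)%g.
  move=> cy; have [f fO] := joined cy cy (centerP cy) (centerP cy).
  rewrite (radialE (fun t => (fO t).1)) clsE.
  by rewrite (path_hol_in Oop alP gP (fun t => (fO t).1)) invgM invgK !mulgA.
rewrite (overlapE ay by_) LM LV !rad //.
move: (P (center a) * _)%g (P (center b) * _)%g => ka kb.
rewrite !invgM invgK -(gP _ _ _ _ ay (alP y) by_) (cocycleV gP ay (alP y)).
by rewrite -!mulgA mulKg.
Qed.

End VanKampen.

(** * Octants of the plane and wedges around the eight rays *)

Section Octants.
Context {R : realType}.

(** The multiples of [pi / 4] as integer vectors, the diagonal ones of length sqrt 2, so that linear
    arithmetic decides all incidences. *)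
Definition dx (i : nat) : R := [:: 1; 1; 0; -1; -1; -1; 0; 1]`_(i %% 8).
Definition dy (i : nat) : R := [:: 0; 1; 1; 1; 0; -1; -1; -1]`_(i %% 8).

Definition crossd i (x y : R) : R := dx i * y - dy i * x.
Definition dotd i (x y : R) : R := dx i * x + dy i * y.

(** Since [crossd] is positive to the left of a ray, this is the open octant between rays [i] and
    [i + 1]. A half sector adds ray [i]; the eight of them partition the punctured plane. *)
Definition sector i (x y : R) := 0 < crossd i x y /\ crossd i.+1 x y < 0.
Definition half_sector i (x y : R) := 0 <= crossd i x y /\ crossd i.+1 x y < 0.
(** The angle to ray [i] has tangent below 1/4 in absolute value. As 1/4 < tan(pi/8), the wedges are
    disjoint and each meets only the two octants beside its ray. *)
Definition near_ray i (x y : R) :=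
  crossd i x y < dotd i x y / 4 /\ - crossd i x y < dotd i x y / 4.

Definition pred8 (i : nat) : nat := ((i + 7) %% 8)%N.

Lemma lt8_ind (P : nat -> Prop) : P 0%N -> P 1%N -> P 2%N -> P 3%N -> P 4%N ->
  P 5%N -> P 6%N -> P 7%N -> forall i, (i < 8)%N -> P i.
Proof. by move=> P0 P1 P2 P3 P4 P5 P6 P7 [|[|[|[|[|[|[|[|]]]]]]]]. Qed.

Local Ltac octants := rewrite /sector /half_sector /near_ray /crossd /dotd /dx /dy /=.

Lemma half_sector_ex x y : ~ (x = 0 /\ y = 0) ->
  exists2 i, (i < 8)%N & half_sector i x y.
Proof.
move=> xy.
have [y0|y0] := leP 0 y; have [x0|x0] := leP 0 x.
- have [h|h] := leP x y.
    have [x1|x1] := eqVneq x 0.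
      have [y1|y1] := eqVneq y 0; first by case: xy.
      have y2 : 0 < y by rewrite lt_def y1.
      by exists 2%N => //; octants; split; lra.
    have x2 : 0 < x by rewrite lt_def x1.
    by exists 1%N => //; octants; split; lra.
  by exists 0%N => //; octants; split; lra.
- have [h|h] := leP (- x) y.
    have [e|e] := eqVneq (- x) y.
      by exists 3%N => //; octants; split; lra.
    have e2 : - x < y by rewrite lt_def eq_sym e.
    by exists 2%N => //; octants; split; lra.
  have [y1|y1] := eqVneq y 0.
    by exists 4%N => //; octants; split; lra.
  have y2 : 0 < y by rewrite lt_def y1.
  by exists 3%N => //; octants; split; lra.
- have [h|h] := leP x (- y).
    have [e|e] := eqVneq x (- y).
      by exists 7%N => //; octants; split; lra.
    have e2 : x < - y by rewrite lt_def eq_sym e.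
    by exists 6%N => //; octants; split; lra.
  by exists 7%N => //; octants; split; lra.
- have [h|h] := leP y x.
    have [e|e] := eqVneq y x.
      by exists 5%N => //; octants; split; lra.
    have e2 : y < x by rewrite lt_def eq_sym e.
    by exists 5%N => //; octants; split; lra.
  by exists 4%N => //; octants; split; lra.
Qed.

Lemma half_sector_uniq i k x y : (i < 8)%N -> (k < 8)%N ->
  half_sector i x y -> half_sector k x y -> i = k.
Proof.
move=> + k8; move: i; apply: lt8_ind; move: k k8; apply: lt8_ind => //;
  octants => -[? ?] [? ?]; exfalso; lra.
Qed.

Lemma near_ray_half i x y : (i < 8)%N -> near_ray i x y ->
  half_sector i x y \/ half_sector (pred8 i) x y.
Proof.
move=> + /[dup] h; have [c|c] := leP 0 (crossd i x y) => i8 _; [left|right];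
  move: i i8 h c; apply: lt8_ind; octants => -[? ?] ?; split; lra.
Qed.

Lemma near_ray_uniq i k x y : (i < 8)%N -> (k < 8)%N ->
  near_ray i x y -> near_ray k x y -> i = k.
Proof.
move=> + k8; move: i; apply: lt8_ind; move: k k8; apply: lt8_ind => //;
  octants => -[? ?] [? ?]; exfalso; lra.
Qed.

Lemma half_sector_cases i x y : (i < 8)%N -> half_sector i x y ->
  sector i x y \/ exists2 k, 0 < k & x = k * dx i /\ y = k * dy i.
Proof.
move=> i8 [h1 h2]; have [h0|h0] := eqVneq (crossd i x y) 0; last first.
  by left; split=> //; rewrite lt_def h0.
right; move: i i8 h0 h2 {h1}; apply: lt8_ind; octants => h1 h2;
  [exists x|exists x|exists y|exists y|exists (- x)|exists (- x)|exists (- y)|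
   exists (- y)]; rewrite /dx /dy /=; try (split; lra); lra.
Qed.

Lemma dir_neq0 i : (i < 8)%N -> 0 < dx i ^+ 2 + dy i ^+ 2.
Proof. by move: i; apply: lt8_ind; rewrite /dx /dy /=; lra. Qed.

Lemma sector_ray i k n : (i < 8)%N -> (k < 8)%N -> 0 <= n ->
  ~ sector i (n * dx k) (n * dy k).
Proof.
move=> i8; move: k; apply: lt8_ind; move: i i8; apply: lt8_ind => n0;
  octants => -[h1 h2]; lra.
Qed.

Lemma near_ray_self i n : (i < 8)%N -> 0 < n -> near_ray i (n * dx i) (n * dy i).
Proof. by move: i; apply: lt8_ind => n0; octants; split; lra. Qed.

Lemma near_ray_ray i k n : (i < 8)%N -> (k < 8)%N -> 0 <= n ->
  near_ray i (n * dx k) (n * dy k) -> 0 < n /\ i = k.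
Proof.
move=> i8 k8; rewrite le_eqVlt => /orP[/eqP <-|n0] H.
  by case: H; rewrite /near_ray /crossd /dotd !mul0r !mulr0 subrr addr0 mul0r ltxx.
by split=> //; exact: near_ray_uniq i8 k8 H (near_ray_self k8 n0).
Qed.

Lemma cos_sin_pi4 : exists2 r : R, 0 < r &
  [/\ cos (pi / 4) = r, sin (pi / 4) = r & r ^+ 2 * 2 = 1].
Proof.
have p0 := pi_gt0 R.
have r0 : 0 < cos (pi / 4 : R) by apply: cos_gt0_pihalf; lra.
have E : sin (pi / 4 : R) = cos (pi / 4).
  by rewrite -cosBpihalf -[RHS]cosN; congr cos; lra.
exists (cos (pi / 4)) => //; split=> //.
have := cos2Dsin2 (pi / 4 : R); rewrite E; lra.
Qed.

(** Rotation by [pi / 4] sends direction [i] to a positive multiple of direction [i + 1]; the factor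
    [k] below is 1 or 2 according to parity. *)
Lemma cos_sin_dir i : exists2 n : R, 0 < n &
  cos (2 * pi * i%:R / 8%:R) = n * dx i /\ sin (2 * pi * i%:R / 8%:R) = n * dy i.
Proof.
have [r r0 [cr sr r2]] := cos_sin_pi4.
elim: i => [|i [n n0 [cn sn]]].
  by exists 1 => //; rewrite mulr0 mul0r cos0 sin0 /dx /dy /= !mul1r.
have -> : 2 * pi * i.+1%:R / 8%:R = 2 * pi * i%:R / 8%:R + pi / 4 :> R.
  by rewrite -natr1; field.
rewrite cosD sinD cr sr cn sn.
have [k k0 [kx ky]] : exists2 k : R, 0 < k & dx i - dy i = k * dx i.+1 /\
    dx i + dy i = k * dy i.+1.
  have i8 : (i %% 8 < 8)%N by rewrite ltn_mod.
  rewrite /dx /dy -[in i.+1]addn1 -modnDml addn1.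
  move: (i %% 8)%N i8; apply: lt8_ind => /=;
    [exists 1|exists 2|exists 1|exists 2|exists 1|exists 2|exists 1|exists 2];
    try split; lra.
exists (n * r * k); first by rewrite !mulr_gt0.
by split; rewrite -!mulrA -?kx -?ky; ring.
Qed.

End Octants.

(** * Convex cones covering the complement of the knot *)

Section Cones.
Context {R : realType}.
Local Notation I := (unit_itv R).
Local Notation T := (complement_9_42 R).

Definition o4 (k : nat) (h : (k < 4)%N) : 'I_4 := Ordinal h.
Definition c0 (p : 'rV[R]_4) : R := p 0 (@o4 0 isT).
Definition c1 (p : 'rV[R]_4) : R := p 0 (@o4 1 isT).
Definition c2 (p : 'rV[R]_4) : R := p 0 (@o4 2 isT).
Definition c3 (p : 'rV[R]_4) : R := p 0 (@o4 3 isT).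
Definition vec4 (x y z w : R) : 'rV[R]_4 := \row_i [:: x; y; z; w]`_i.

Lemma vec4E x y z w : [/\ c0 (vec4 x y z w) = x, c1 (vec4 x y z w) = y,
  c2 (vec4 x y z w) = z & c3 (vec4 x y z w) = w].
Proof. by rewrite /c0 /c1 /c2 /c3 !mxE. Qed.

Lemma row4P (p q : 'rV[R]_4) :
  c0 p = c0 q -> c1 p = c1 q -> c2 p = c2 q -> c3 p = c3 q -> p = q.
Proof.
move=> h0 h1 h2 h3; apply/rowP => -[[|[|[|[|//]]]] i4].
- by move: h0; rewrite /c0 (_ : o4 _ = Ordinal i4) //; apply: val_inj.
- by move: h1; rewrite /c1 (_ : o4 _ = Ordinal i4) //; apply: val_inj.
- by move: h2; rewrite /c2 (_ : o4 _ = Ordinal i4) //; apply: val_inj.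
- by move: h3; rewrite /c3 (_ : o4 _ = Ordinal i4) //; apply: val_inj.
Qed.

Definition sumsq (p : 'rV[R]_4) : R := \sum_i p 0 i ^+ 2.

Lemma sumsqE p : sumsq p = c0 p ^+ 2 + c1 p ^+ 2 + (c2 p ^+ 2 + c3 p ^+ 2).
Proof.
rewrite /sumsq !big_ord_recl big_ord0 addr0 /c0 /c1 /c2 /c3 !addrA.
by do ![congr (_ + _)]; congr (p 0 _ ^+ 2); apply: val_inj.
Qed.

Lemma cD p q : [/\ c0 (p + q) = c0 p + c0 q, c1 (p + q) = c1 p + c1 q,
  c2 (p + q) = c2 p + c2 q & c3 (p + q) = c3 p + c3 q].
Proof. by rewrite /c0 /c1 /c2 /c3 !mxE. Qed.

Lemma cZ k p : [/\ c0 (k *: p) = k * c0 p, c1 (k *: p) = k * c1 p,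
  c2 (k *: p) = k * c2 p & c3 (k *: p) = k * c3 p].
Proof. by rewrite /c0 /c1 /c2 /c3 !mxE. Qed.

Definition mark (i j : nat) : bool :=
  (j == nth 0%N X_9_42 i) || (j == nth 0%N O_9_42 i).

Inductive piece := Upiece of nat | Vpiece of nat | Wpiece of nat & nat.

(* Points of R^4 = R^2 x R^2 whose first, respectively second, component lies in
   the i-th open octant, and the points near the plane spanned by the directions
   i and j for an unmarked pair. *)
Definition cone (a : piece) (p : 'rV[R]_4) : Prop :=
  match a with
  | Upiece i => (i < 8)%N /\ sector i (c0 p) (c1 p)
  | Vpiece j => (j < 8)%N /\ sector j (c2 p) (c3 p)
  | Wpiece i j => [/\ (i < 8)%N, (j < 8)%N & ~~ mark i j] /\
      (near_ray i (c0 p) (c1 p) /\ near_ray j (c2 p) (c3 p))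
  end.

Lemma crossdD i x y x' y' :
  crossd i (x + x') (y + y') = crossd i x y + crossd i x' y' :> R.
Proof. by rewrite /crossd; ring. Qed.

Lemma dotdD i x y x' y' :
  dotd i (x + x') (y + y') = dotd i x y + dotd i x' y' :> R.
Proof. by rewrite /dotd; ring. Qed.

Lemma crossdZ i k x y : crossd i (k * x) (k * y) = k * crossd i x y :> R.
Proof. by rewrite /crossd; ring. Qed.

Lemma dotdZ i k x y : dotd i (k * x) (k * y) = k * dotd i x y :> R.
Proof. by rewrite /dotd; ring. Qed.

(** Together with [coneZ] this makes every cone and every intersection of cones convex, which yields
    connected overlaps and straight-line homotopies. *)
Lemma coneD a p q : cone a p -> cone a q -> cone a (p + q).
Proof.
have [e0 e1 e2 e3] := cD p q.
case: a => [i|j|i j] /=; rewrite ?e0 ?e1 ?e2 ?e3 /sector /near_ray ?crossdD ?dotdD.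
- by move=> [? [? ?]] [? [? ?]]; split=> //; split; lra.
- by move=> [? [? ?]] [? [? ?]]; split=> //; split; lra.
- move=> [? [[? ?] [? ?]]] [? [[? ?] [? ?]]]; split=> //; split; split; lra.
Qed.

Lemma coneZ a k p : 0 < k -> cone a p -> cone a (k *: p).
Proof.
move=> k0; have [e0 e1 e2 e3] := cZ k p.
have P x : 0 < x -> 0 < k * x by move=> x0; exact: mulr_gt0.
have S i x y : sector i x y -> sector i (k * x) (k * y).
  by rewrite /sector !crossdZ => -[h1 h2]; split; [exact: P|rewrite pmulr_rlt0].
have N i x y : near_ray i x y -> near_ray i (k * x) (k * y).
  rewrite /near_ray !crossdZ dotdZ => -[h1 h2].
  by split; rewrite -?mulrN -mulrA ltr_pM2l.
by case: a => [i|j|i j] /=; rewrite ?e0 ?e1 ?e2 ?e3 => -[h1 h2]; split=> //;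
  [exact: S|exact: S|case: h2 => h2 h3; split; exact: N].
Qed.

Lemma sqr_sum_gt0 (x y : R) : ~ (x = 0 /\ y = 0) -> 0 < x ^+ 2 + y ^+ 2.
Proof.
move=> xy; rewrite lt_neqAle addr_ge0 ?sqr_ge0 // andbT eq_sym.
by rewrite paddr_eq0 ?sqr_ge0 // !sqrf_eq0; apply/negP => /andP[/eqP x0 /eqP y0]; exact: xy.
Qed.

Lemma sector_neq0 i (x y : R) : sector i x y -> ~ (x = 0 /\ y = 0).
Proof. by move=> + [x0 y0]; rewrite /sector /crossd x0 y0 => -[? ?]; lra. Qed.

Lemma near_neq0 i (x y : R) : near_ray i x y -> ~ (x = 0 /\ y = 0).
Proof. by move=> + [x0 y0]; rewrite /near_ray /crossd /dotd x0 y0 => -[? ?]; lra. Qed.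

Lemma cone_sumsq a p : cone a p -> 0 < sumsq p.
Proof.
rewrite sumsqE; case: a => [i|j|i j] /= [_].
- by move/sector_neq0/sqr_sum_gt0 => h; apply: ltr_wpDr => //; rewrite addr_ge0 ?sqr_ge0.
- by move/sector_neq0/sqr_sum_gt0 => h; apply: ltr_wpDl => //; rewrite addr_ge0 ?sqr_ge0.
- by case=> /near_neq0/sqr_sum_gt0 h _; apply: ltr_wpDr => //; rewrite addr_ge0 ?sqr_ge0.
Qed.

Lemma grid_arcE i j (t : R) : exists2 n : R, 0 < n & exists2 n' : R, 0 < n' &
  [/\ (n * dx i) ^+ 2 + (n * dy i) ^+ 2 = 1, (n' * dx j) ^+ 2 + (n' * dy j) ^+ 2 = 1 &
  grid_arc X_9_42 i j t = vec4 (cos t * n * dx i) (cos t * n * dy i)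
    (sin t * n' * dx j) (sin t * n' * dy j)].
Proof.
have [n n0 [cn sn]] := cos_sin_dir (R := R) i.
have [n' n'0 [cn' sn']] := cos_sin_dir (R := R) j.
exists n => //; exists n' => //; split; rewrite -?cn -?sn -?cn' -?sn' ?cos2Dsin2 //.
apply: row4P; rewrite /c0 /c1 /c2 /c3 /grid_arc /grid_angle !mxE /=;
  by rewrite ?mulr0 ?addr0 ?add0r ?cn ?sn ?cn' ?sn' ?mulrA.
Qed.

Lemma grid_knotP (p : 'rV[R]_4) : grid_knot R X_9_42 O_9_42 p <->
  exists i j t, [/\ (i < 8)%N, (j < 8)%N, mark i j, 0 <= t <= pi / 2 &
    p = grid_arc X_9_42 i j t].
Proof.
split=> [[i [j [t [i8 ij t0 pE]]]]|[i [j [t [i8 j8 ij t0 pE]]]]]; exists i, j, t.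
  have ij' : mark i j by case: ij => ->; rewrite /mark eqxx ?orbT.
  split=> //; move: i i8 ij {pE ij'}; apply: lt8_ind => -[] ->; by [].
by split=> //; case/orP: ij => /eqP; [left|right].
Qed.

(** Both components of a knot point are nonnegative multiples of directions with a marked pair of
    indices. Open octants contain no such multiple, and a wedge determines the index of its ray. *)
Lemma cone_knot a p : cone a p -> ~ grid_knot R X_9_42 O_9_42 p.
Proof.
move=> ap /grid_knotP[i [j [t [i8 j8 ij t01 pE]]]].
have [n n0 [n' n'0 [_ _ aE]]] := grid_arcE i j t.
have ct : 0 <= cos t * n.
  by rewrite mulr_ge0 ?(ltW n0) // cos_ge0_pihalf //; have := pi_gt0 R; lra.
have st : 0 <= sin t * n'.
  by rewrite mulr_ge0 ?(ltW n'0) // sin_ge0_pi //; have := pi_gt0 R; lra.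
rewrite aE in pE; have [e0 e1 e2 e3] := vec4E (cos t * n * dx i) (cos t * n * dy i)
    (sin t * n' * dx j) (sin t * n' * dy j).
move: ap; rewrite pE; case: a => [k|k|k l] /=; rewrite ?e0 ?e1 ?e2 ?e3.
- by case=> k8; exact: sector_ray.
- by case=> k8; exact: sector_ray.
- case=> -[k8 l8 kl] [/near_ray_ray h /near_ray_ray h'].
  have [_ ki] := h k8 i8 ct; have [_ lj] := h' l8 j8 st.
  by rewrite ki lj ij in kl.
Qed.

Lemma circle_angle (u v : R) : 0 <= u -> 0 <= v -> u ^+ 2 + v ^+ 2 = 1 ->
  exists2 t, 0 <= t <= pi / 2 & cos t = u /\ sin t = v.
Proof.
move=> u0 v0 uv; have p0 := pi_gt0 R.
have u1 : -1 <= u <= 1 by nra.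
have cu : cos (acos u) = u by apply: acosK; rewrite in_itv.
have su : sin (acos u) = v.
  rewrite sin_acos // (_ : 1 - u ^+ 2 = v ^+ 2); last by lra.
  by rewrite sqrtr_sqr ger0_norm.
exists (acos u) => //; rewrite acos_ge0 //= leNgt; apply/negP => h.
have hp := acos_lepi u1.
suff : cos (acos u) < 0 by rewrite cu; lra.
rewrite -[acos u](subrK (pi / 2)) cosDpihalf oppr_lt0 sin_gt0_pi //; lra.
Qed.

(** A unit vector with one component zero and the other on a ray is a vertex a_i or b_j; a mark in
    every row and column puts all vertices on the knot. *)
Lemma mark_row j : (j < 8)%N -> exists2 i, (i < 8)%N & mark i j.
Proof.
by move: j; apply: lt8_ind; [exists 0%N|exists 1%N|exists 2%N|exists 0%N|
  exists 3%N|exists 1%N|exists 2%N|exists 3%N].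
Qed.

Lemma mark_column i : (i < 8)%N -> exists2 j, (j < 8)%N & mark i j.
Proof.
by move: i; apply: lt8_ind; [exists 0%N|exists 1%N|exists 2%N|exists 4%N|
  exists 3%N|exists 0%N|exists 1%N|exists 2%N].
Qed.

Lemma ray_point_knot i j k l p : (i < 8)%N -> (j < 8)%N -> mark i j ->
  sumsq p = 1 -> 0 <= k -> 0 <= l -> c0 p = k * dx i -> c1 p = k * dy i ->
  c2 p = l * dx j -> c3 p = l * dy j -> grid_knot R X_9_42 O_9_42 p.
Proof.
move=> i8 j8 ij p1 k0 l0 e0 e1 e2 e3.
have [n n0 [n' n'0 [nE n'E _]]] := grid_arcE i j 0.
have [t t01 [ct st]] : exists2 t, 0 <= t <= pi / 2 & cos t = k / n /\ sin t = l / n'.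
  apply: circle_angle; rewrite ?divr_ge0 ?(ltW n0) ?(ltW n'0) //.
  move: p1; rewrite sumsqE e0 e1 e2 e3 => <-.
  have -> : (k * dx i) ^+ 2 + (k * dy i) ^+ 2 =
      (k / n) ^+ 2 * ((n * dx i) ^+ 2 + (n * dy i) ^+ 2) by field; lra.
  have -> : (l * dx j) ^+ 2 + (l * dy j) ^+ 2 =
      (l / n') ^+ 2 * ((n' * dx j) ^+ 2 + (n' * dy j) ^+ 2) by field; lra.
  by rewrite nE n'E !mulr1.
apply/grid_knotP; exists i, j, t; split=> //.
have [m m0 [m' m'0 [mE m'E ->]]] := grid_arcE i j t.
(* [grid_arcE] is opened twice, at 0 to find [t] and then at [t]; the normalization identifies the
   two pairs of scale factors. *)
have uniq (a b x y : R) : 0 < a -> 0 < b -> (a * x) ^+ 2 + (a * y) ^+ 2 = 1 ->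
    (b * x) ^+ 2 + (b * y) ^+ 2 = 1 -> a = b.
  move=> a0 b0; rewrite !exprMn -!mulrDr => aE bE; apply/eqP.
  rewrite -(@eqrXn2 _ 2) ?ltW //; apply/eqP.
  have h : x ^+ 2 + y ^+ 2 != 0.
    by apply/eqP => h; move: aE; rewrite h mulr0 => /eqP; rewrite eq_sym oner_eq0.
  by apply: (mulIf h); rewrite aE bE.
rewrite -(uniq _ _ _ _ n0 m0 nE mE) -(uniq _ _ _ _ n'0 m'0 n'E m'E) ct st !divfK;
  try by rewrite gt_eqF.
by have [f0 f1 f2 f3] := vec4E (k * dx i) (k * dy i) (l * dx j) (l * dy j);
  apply: row4P; rewrite ?f0 ?f1 ?f2 ?f3.
Qed.

Lemma plane_cases (x y : R) : [\/ x = 0 /\ y = 0,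
  exists2 i, (i < 8)%N & sector i x y |
  exists2 i, (i < 8)%N & exists2 k, 0 < k & x = k * dx i /\ y = k * dy i].
Proof.
have [xy|xy] := pselect (x = 0 /\ y = 0); first by constructor 1.
have [i i8 /(half_sector_cases i8)[h|h]] := half_sector_ex xy.
  by constructor 2; exists i.
by constructor 3; exists i.
Qed.

(** A component inside an open octant gives a U or V piece; two rays give a W piece unless the pair
    is marked; a ray and a zero component would be a vertex of the knot. *)
Lemma cone_cover p : sumsq p = 1 -> ~ grid_knot R X_9_42 O_9_42 p ->
  exists a, cone a p.
Proof.
move=> p1 np.
have [[z0 z1]|[i i8 si]|[i i8 [k k0 [e0 e1]]]] := plane_cases (c0 p) (c1 p);
  last 2 first.
- by exists (Upiece i).
- have [[w0 w1]|[j j8 sj]|[j j8 [l l0 [e2 e3]]]] := plane_cases (c2 p) (c3 p).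
  + have [j j8 ij] := mark_column i8; case: np.
    by apply: (ray_point_knot i8 j8 ij p1 (ltW k0) (lexx 0)); rewrite // mul0r.
  + by exists (Vpiece j).
  + have [ij|ij] := boolP (mark i j).
      by case: np; exact: (ray_point_knot i8 j8 ij p1 (ltW k0) (ltW l0)).
    by exists (Wpiece i j); rewrite /= e0 e1 e2 e3; split=> //; split;
      exact: near_ray_self.
- have [[w0 w1]|[j j8 sj]|[j j8 [l l0 [e2 e3]]]] := plane_cases (c2 p) (c3 p).
  + by move: p1; rewrite sumsqE z0 z1 w0 w1 expr0n /= !addr0 => /eqP;
      rewrite eq_sym oner_eq0.
  + by exists (Vpiece j).
  + have [i i8 ij] := mark_row j8; case: np.
    by apply: (ray_point_knot i8 j8 ij p1 (lexx 0) (ltW l0)); rewrite // mul0r.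
Qed.

Lemma c_cts (i : 'I_4) : continuous (fun p : 'rV[R]_4 => p 0 i).
Proof. exact: matrix_normedtype.coord_continuous. Qed.

Lemma crossd_cts (X : topologicalType) k (f g : X -> R) : continuous f ->
  continuous g -> continuous (fun x => crossd k (f x) (g x)).
Proof.
by move=> cf cg x; apply: cvgB; apply: cvgM; try exact: cvg_cst; [exact: cg|exact: cf].
Qed.

Lemma dotd_cts (X : topologicalType) k (f g : X -> R) : continuous f ->
  continuous g -> continuous (fun x => dotd k (f x) (g x)).
Proof.
by move=> cf cg x; apply: cvgD; apply: cvgM; try exact: cvg_cst; [exact: cf|exact: cg].
Qed.

Lemma sector_open (X : topologicalType) k (f g : X -> R) : continuous f ->
  continuous g -> open [set x | sector k (f x) (g x)].
Proof.
move=> cf cg.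
have -> : [set x | sector k (f x) (g x)] =
    (fun x => crossd k (f x) (g x)) @^-1` [set t | 0 < t] `&`
    (fun x => crossd k.+1 (f x) (g x)) @^-1` [set t | t < 0] by [].
apply: openI.
  by move/continuousP: (crossd_cts (k := k) cf cg); apply; exact: open_gt.
by move/continuousP: (crossd_cts (k := k.+1) cf cg); apply; exact: open_lt.
Qed.

Lemma near_open (X : topologicalType) k (f g : X -> R) : continuous f ->
  continuous g -> open [set x | near_ray k (f x) (g x)].
Proof.
move=> cf cg.
have cc := crossd_cts (k := k) cf cg; have cd := dotd_cts (k := k) cf cg.
have -> : [set x | near_ray k (f x) (g x)] =
    (fun x => 4^-1 * dotd k (f x) (g x) - crossd k (f x) (g x)) @^-1` [set t | 0 < t] `&`
    (fun x => 4^-1 * dotd k (f x) (g x) + crossd k (f x) (g x)) @^-1` [set t | 0 < t].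
  by apply/seteqP; split=> x; rewrite /near_ray /=; case=> ? ?; split; lra.
apply: openI.
  have c : continuous (fun x => 4^-1 * dotd k (f x) (g x) - crossd k (f x) (g x)).
    by move=> x; apply: cvgB; [exact: (scale_cts cd)|exact: cc].
  by move/continuousP: c; apply; exact: open_gt.
have c : continuous (fun x => 4^-1 * dotd k (f x) (g x) + crossd k (f x) (g x)).
  by move=> x; apply: cvgD; [exact: (scale_cts cd)|exact: cc].
by move/continuousP: c; apply; exact: open_gt.
Qed.

Lemma open_const (X : topologicalType) (P : Prop) (A : set X) :
  open A -> open [set x | P /\ A x].
Proof.
move=> oA; have [h|h] := pselect P.
  by have -> : [set x | P /\ A x] = A by apply/seteqP; split=> x //= [].
have -> : [set x | P /\ A x] = set0 by apply/seteqP; split=> x //= [].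
exact: open0.
Qed.

Definition chart (a : piece) : set T := [set y | cone a (set_val y)].

Lemma set_val_cts : continuous (set_val : T -> 'rV[R]_4).
Proof. exact: initial_continuous. Qed.

Lemma chart_open a : open (chart a).
Proof.
have cv i : continuous (fun y : T => set_val y 0 i).
  exact: (comp_cts set_val_cts (c_cts (i := i))).
case: a => [i|j|i j].
- exact: (open_const (i < 8)%N (sector_open i (cv _) (cv _))).
- exact: (open_const (j < 8)%N (sector_open j (cv _) (cv _))).
- exact: (open_const [/\ (i < 8)%N, (j < 8)%N & ~~ mark i j]
    (openI (near_open i (cv _) (cv _)) (near_open j (cv _) (cv _)))).
Qed.

Lemma chart_ex (y : T) : exists a, chart a y.
Proof. by have [y1 yK] := set_mem (svalP y); exact: cone_cover. Qed.

Definition chart_of (y : T) : piece := projT1 (cid (chart_ex y)).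

Lemma chart_ofP y : chart (chart_of y) y.
Proof. exact: (projT2 (cid (chart_ex y))). Qed.

Definition normalized (p : 'rV[R]_4) : 'rV[R]_4 := (Num.sqrt (sumsq p))^-1 *: p.

Lemma sumsqZ k p : sumsq (k *: p) = k ^+ 2 * sumsq p.
Proof. by rewrite !sumsqE; have [-> -> -> ->] := cZ k p; ring. Qed.

Lemma sumsq_normalized p : 0 < sumsq p -> sumsq (normalized p) = 1.
Proof.
by move=> p0; rewrite sumsqZ exprVn sqr_sqrtr ?ltW // mulVf // gt_eqF.
Qed.

Lemma normalized_id p : sumsq p = 1 -> normalized p = p.
Proof. by move=> p1; rewrite /normalized p1 sqrtr1 invr1 scale1r. Qed.

Lemma sumsq_cts (X : topologicalType) (q : X -> 'rV[R]_4) : continuous q ->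
  continuous (fun x => sumsq (q x)).
Proof.
move=> cq; have ci i : continuous (fun x => q x 0 i ^+ 2).
  have ce := comp_cts cq (c_cts (i := i)).
  rewrite (_ : (fun _ => _) = fun x => q x 0 i * q x 0 i); last exact/funext.
  by move=> x; apply: cvgM; exact: ce.
rewrite (_ : (fun _ => _) = fun x => c0 (q x) ^+ 2 + c1 (q x) ^+ 2 +
    (c2 (q x) ^+ 2 + c3 (q x) ^+ 2)); last by apply/funext => x; rewrite sumsqE.
by move=> x; apply: cvgD; apply: cvgD; exact: ci.
Qed.

Lemma normalized_cts (X : topologicalType) (q : X -> 'rV[R]_4) : continuous q ->
  (forall x, 0 < sumsq (q x)) -> continuous (fun x => normalized (q x)).
Proof.
move=> cq q0 x; apply: cvgZ; last exact: cq.
apply: cvgV; first by rewrite gt_eqF // sqrtr_gt0.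
exact: (comp_cts (sumsq_cts cq) (@sqrt_continuous R)).
Qed.

Section Projection.
Variable x0 : T.

(** Radial projection made total by the value [x0]; continuity is stated only for families whose
    projections avoid the knot. *)
Definition to_complement (p : 'rV[R]_4) : T :=
  match pselect (complement_9_42 R (normalized p)) with
  | left h => exist _ (normalized p) (mem_set h)
  | right _ => x0
  end.

Lemma set_val_complement p : complement_9_42 R (normalized p) ->
  set_val (to_complement p) = normalized p.
Proof. by rewrite /to_complement; case: pselect. Qed.

Lemma complementK (y : T) : to_complement (set_val y) = y.
Proof.
have Yy := set_mem (svalP y); have yE : normalized (set_val y) = set_val y.
  by apply: normalized_id; case: Yy.
apply: val_inj; change (set_val (to_complement (set_val y)) = set_val y).
by rewrite set_val_complement yE.
Qed.

Lemma to_complement_cts (X : topologicalType) (q : X -> 'rV[R]_4) : continuous q ->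
  (forall x, 0 < sumsq (q x)) -> (forall x, complement_9_42 R (normalized (q x))) ->
  continuous (fun x => to_complement (q x)).
Proof.
move=> cq q0 qY; apply/continuous_comp_initial.
rewrite (_ : _ \o _ = fun x => normalized (q x)); first exact: normalized_cts.
by apply/funext => x; exact: set_val_complement.
Qed.

Lemma cone_normalized a p : cone a p -> cone a (normalized p).
Proof. by move=> ap; apply: coneZ => //; rewrite invr_gt0 sqrtr_gt0 (cone_sumsq ap). Qed.

Lemma cone_complement a p : cone a p -> complement_9_42 R (normalized p).
Proof.
move=> ap; split; first exact: sumsq_normalized (cone_sumsq ap).
exact: cone_knot (cone_normalized ap).
Qed.

Lemma chart_complement a p : cone a p -> chart a (to_complement p).
Proof.
move=> ap; rewrite /chart /= set_val_complement; first exact: cone_normalized.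
exact: cone_complement ap.
Qed.

Lemma cone_segment a p q (t : R) : 0 <= t <= 1 -> cone a p -> cone a q ->
  cone a ((1 - t) *: p + t *: q).
Proof.
move=> /andP[]; rewrite !le_eqVlt => /predU1P[<- _ ap _|t0].
  by rewrite subr0 scale1r scale0r addr0.
move=> /predU1P[-> _ aq|t1 ap aq]; first by rewrite subrr scale0r add0r scale1r.
by apply: coneD; apply: coneZ => //; lra.
Qed.

Lemma segment_cts (X : topologicalType) (h : X -> R) (f g : X -> 'rV[R]_4) :
  continuous h -> continuous f -> continuous g ->
  continuous (fun x => (1 - h x) *: f x + h x *: g x).
Proof.
move=> ch cf cg x; apply: cvgD; apply: cvgZ; try exact: cf; try exact: cg.
  exact: onem_cts.
exact: ch.
Qed.

Local Notation pathI x y := {path I from x to y in T}.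

(** A segment inside a convex cone misses the origin, so it can be projected back to the sphere
    without leaving either piece. *)
Lemma chart_joined a b (y y' : T) : chart a y -> chart b y -> chart a y' ->
  chart b y' -> exists f : pathI y y', forall t, chart a (f t) /\ chart b (f t).
Proof.
move=> ay by_ ay' by'.
pose q (t : I) := (1 - coord t) *: set_val y + coord t *: set_val y'.
have qa t : cone a (q t) by apply: cone_segment; rewrite ?coord_itv.
have qb t : cone b (q t) by apply: cone_segment; rewrite ?coord_itv.
have cq : continuous (fun t => to_complement (q t)).
  apply: to_complement_cts => [|t|t]; [|exact: cone_sumsq (qa t)|
    exact: cone_complement (qa t)].
  by apply: segment_cts; [exact: coord_continuous|exact: cst_continuous..].
have q0 : to_complement (q zero) = y.
  by rewrite /q coord0 subr0 scale1r scale0r addr0 complementK.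
have q1 : to_complement (q one) = y'.
  by rewrite /q coord1 subrr scale0r add0r scale1r complementK.
by exists (mk_path cq q0 q1) => t; split; exact: chart_complement.
Qed.

Lemma chart_unique a (y y' : T) (f f' : pathI y y') : (forall t, chart a (f t)) ->
  (forall t, chart a (f' t)) -> path_homotopic f f'.
Proof.
move=> fa f'a.
pose q (p : I * I) := (1 - coord p.1) *: set_val (f p.2) + coord p.1 *: set_val (f' p.2).
have qa p : cone a (q p) by apply: cone_segment; rewrite ?coord_itv //; [exact: fa|exact: f'a].
exists (fun p => to_complement (q p)); split.
- apply: to_complement_cts => [|t|t]; [|exact: cone_sumsq (qa t)|
    exact: cone_complement (qa t)].
  apply: segment_cts; first exact: coord_fst_cts.
    exact: (comp_cts (comp_cts (@snd_cts _ _) (@path_cts _ _ _ _ f)) set_val_cts).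
  exact: (comp_cts (comp_cts (@snd_cts _ _) (@path_cts _ _ _ _ f')) set_val_cts).
- by move=> t; rewrite /q coord0 subr0 scale1r scale0r addr0 complementK.
- by move=> t; rewrite /q coord1 subrr scale0r add0r scale1r complementK.
- move=> s; rewrite /q !path_zero !path_one -!scalerDl !subrK !scale1r.
  by rewrite !complementK.
Qed.

Lemma octant_point i : (i < 8)%N -> exists x y, sector (R := R) i x y.
Proof.
move=> i8; exists (dx i + dx i.+1), (dy i + dy i.+1); move: i i8.
by apply: lt8_ind; rewrite /sector /crossd /dx /dy /=; split; lra.
Qed.

(** The witness makes an angle of tangent 1/8 with the ray, inside the wedge of slope 1/4 and off
    the ray. *)
Lemma near_point_after i : (i < 8)%N ->
  exists x y, near_ray (R := R) i x y /\ sector i x y.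
Proof.
move=> i8; exists (8 * dx i - dy i), (8 * dy i + dx i); move: i i8.
by apply: lt8_ind; rewrite /near_ray /dotd /sector /crossd /dx /dy /=; split; split; lra.
Qed.

Lemma near_point_before i : (i < 8)%N ->
  exists x y, near_ray (R := R) i x y /\ sector (pred8 i) x y.
Proof.
move=> i8; exists (8 * dx i + dy i), (8 * dy i - dx i); move: i i8.
by apply: lt8_ind; rewrite /near_ray /dotd /sector /crossd /dx /dy /=; split; split; lra.
Qed.

Lemma pred8_lt i : (pred8 i < 8)%N.
Proof. by rewrite /pred8 ltn_mod. Qed.

Lemma UV_point i j : (i < 8)%N -> (j < 8)%N ->
  exists y, chart (Upiece i) y /\ chart (Vpiece j) y.
Proof.
move=> i8 j8; have [x [y s]] := octant_point i8; have [z [w s']] := octant_point j8.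
have [e0 e1 e2 e3] := vec4E x y z w; exists (to_complement (vec4 x y z w)).
by split; apply: chart_complement => /=; rewrite ?e0 ?e1 ?e2 ?e3.
Qed.

(** Triple points exist on all four sides of an unmarked pair of rays; there the cocycle condition
    factors a U-V value through the W piece. *)
Lemma UVW_point i j k l : (i < 8)%N -> (j < 8)%N -> ~~ mark i j ->
  k = i \/ k = pred8 i -> l = j \/ l = pred8 j ->
  exists y, [/\ chart (Upiece k) y, chart (Vpiece l) y & chart (Wpiece i j) y].
Proof.
move=> i8 j8 ij ki lj.
have P m n : (m < 8)%N -> n = m \/ n = pred8 m ->
    exists x y, near_ray (R := R) m x y /\ sector n x y.
  by move=> m8 [->|->]; [exact: near_point_after|exact: near_point_before].
have L m n : (m < 8)%N -> n = m \/ n = pred8 m -> (n < 8)%N.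
  by move=> m8 [->|->] //; exact: pred8_lt.
have [x [y [n s]]] := P _ _ i8 ki; have [z [w [n' s']]] := P _ _ j8 lj.
have [e0 e1 e2 e3] := vec4E x y z w; exists (to_complement (vec4 x y z w)).
split; apply: chart_complement => /=; rewrite ?e0 ?e1 ?e2 ?e3; split=> //.
- exact: L ki.
- exact: L lj.
Qed.

Lemma complement_connected (y : T) : exists f : pathI x0 y, True.
Proof.
have J a (z z' : T) : chart a z -> chart a z' -> exists f : pathI z z', True.
  by move=> az az'; have [f _] := chart_joined az az az' az'; exists f.
have C (z z' z'' : T) : (exists f : pathI z z', True) ->
    (exists f : pathI z' z'', True) -> exists f : pathI z z'', True.
  by move=> [f _] [g _]; exists (path_cat f g).
have S (z z' : T) : (exists f : pathI z z', True) -> exists f : pathI z' z, True.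
  by move=> [f _]; exists (path_rev f).
have [b [b1 b2]] := @UV_point 0 0 isT isT.
suff B z : exists f : pathI z b, True by apply: C (B x0) (S _ _ (B y)).
have BU i z' : chart (Upiece i) z' -> exists f : pathI z' b, True.
  move=> h; have [u [u1 u2]] := @UV_point i 0 h.1 isT.
  exact: C (J _ _ _ h u1) (J _ _ _ u2 b2).
have [[i|j|i j] h] := chart_ex z.
- exact: BU h.
- have [u [u1 u2]] := @UV_point 0 j isT h.1.
  exact: C (J _ _ _ h u2) (J _ _ _ u1 b1).
- have [[i8 j8 ij] _] := h.
  have [u [u1 _ u3]] := UVW_point i8 j8 ij (or_introl erefl) (or_introl erefl).
  exact: C (J _ _ _ h u3) (BU _ _ u1).
Qed.

End Projection.

End Cones.

(** * Row relations from the combinatorics of the grid *)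

Section GridRelations.

(** The smaller of the two marked rows of a column, [hi] being the larger. Level 7, between the last
    row and the first, lies outside the diagram and no column is active there. *)
Definition lo (i : nat) := nth 0%N [:: 0; 1; 2; 4; 3; 0; 1; 2]%N i.
Definition hi (i : nat) := nth 0%N [:: 3; 5; 6; 7; 5; 4; 6; 7]%N i.
Definition active (i j : nat) : bool := (lo i <= j < hi i)%N.

Lemma active_pred i j : (i < 8)%N -> (j < 8)%N -> ~~ mark i j ->
  active i j = active i (pred8 j).
Proof. by move=> + j8; move: i; apply: lt8_ind; move: j j8; apply: lt8_ind. Qed.

Lemma active_mark i j : (i < 8)%N -> (j < 8)%N -> mark i j ->
  active i j = ~~ active i (pred8 j).
Proof. by move=> + j8; move: i; apply: lt8_ind; move: j j8; apply: lt8_ind. Qed.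

Lemma active7 i : (i < 8)%N -> active i 7 = false.
Proof. by move: i; apply: lt8_ind. Qed.

Lemma active_lo i : (i < 8)%N -> active i (lo i) /\ (lo i < 8)%N.
Proof. by move: i; apply: lt8_ind. Qed.

Lemma pred8S i : (i < 8)%N -> pred8 i.+1 = i.
Proof. by move: i; apply: lt8_ind. Qed.

Context {G : groupType}.

Definition letter (x : nat -> G) (j i : nat) : G := if active i j then x i else 1%g.

Fixpoint row_word (x : nat -> G) (j n : nat) : G :=
  if n is n'.+1 then (row_word x j n' * letter x j n')%g else 1%g.

(* The relation read off row j of the grid: the vertical segments crossing the
   horizontal line between rows j and j+1, from left to right. *)
Definition grid_relations (x : nat -> G) := forall j, (j < 8)%N -> row_word x j 8 = 1%g.

(** The rows form a cycle, which the two marks of column [i] cut into two arcs; [F] is constant on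
    each, and equal to 1 on the arc through row 7. *)
Lemma row_const (F : nat -> G) i : (i < 8)%N -> F 7%N = 1%g ->
  (forall j, (j < 8)%N -> ~~ mark i j -> F j = F (pred8 j)) ->
  forall j, (j < 8)%N -> F j = if active i j then F (lo i) else 1%g.
Proof.
move=> i8 F7 H.
have {}H j k : [&& (j < 8)%N, ~~ mark i j & k == pred8 j] -> F j = F k.
  by case/and3P => j8 ij /eqP ->; exact: H.
move: i i8 H; apply: lt8_ind => H;
  (* [isT] type-checks exactly at the unmarked rows of the column, so only the valid equalities
     survive the [try]. *)
  try (have h0 := H 0%N 7%N isT); try (have h1 := H 1%N 0%N isT);
  try (have h2 := H 2%N 1%N isT); try (have h3 := H 3%N 2%N isT);
  try (have h4 := H 4%N 3%N isT); try (have h5 := H 5%N 4%N isT);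
  try (have h6 := H 6%N 5%N isT); try (have h7 := H 7%N 6%N isT); clear H;
  apply: lt8_ind; rewrite /active /lo /hi /=; congruence.
Qed.

Section Normalized.
Variable f : nat -> nat -> G.
Hypothesis f7 : forall j, (j < 8)%N -> f 7 j = 1%g.
Hypothesis f_7 : forall i, (i < 8)%N -> f i 7 = 1%g.

(** The change of the transition to [V_j] across ray [i], from [U_(i-1)] to [U_i]. *)
Definition column_jump (i j : nat) : G := (f (pred8 i) j * (f i j)^-1)%g.

Hypothesis f_unmarked : forall i j, (i < 8)%N -> (j < 8)%N -> ~~ mark i j ->
  column_jump i j = column_jump i (pred8 j).

Definition column_gen (i : nat) : G := column_jump i (lo i).

Lemma column_jumpE i j : (i < 8)%N -> (j < 8)%N ->
  column_jump i j = letter column_gen j i.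
Proof.
move=> i8; apply: (@row_const (column_jump i) i) => // [|k k8].
  by rewrite /column_jump !f_7 ?invg1 ?mulg1 // pred8_lt.
exact: f_unmarked.
Qed.

(** The jumps telescope starting from column 7, the cyclic predecessor of column 0. Taking [i = 7]
    closes the cycle and gives the row relation. *)
Lemma row_wordE i j : (i < 8)%N -> (j < 8)%N -> (f i j)^-1%g = row_word column_gen j i.+1.
Proof.
move=> + j8; elim: i => [|i IH] i8.
  by rewrite /= mul1g -column_jumpE // /column_jump f7 // mul1g.
rewrite [RHS]/= -[(row_word _ _ i * _)%g]/(row_word column_gen j i.+1).
rewrite -IH; last exact: ltnW.
rewrite -column_jumpE // /column_jump pred8S ?mulKg //; exact: ltnW.
Qed.

Lemma column_gen_relations : grid_relations column_gen.
Proof. by move=> j j8; rewrite -row_wordE // f7 // invg1. Qed.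

End Normalized.

Section OfCocycle.
Context {R : realType}.
Local Notation chart := (@chart R).
Variable g : piece -> piece -> G.
Hypothesis gP : cocycle chart g.

Definition edge (i j : nat) : G := g (Upiece i) (Vpiece j).

(** The gauge that trivializes the spanning tree of the edges [U_7 V_j] and [U_i V_7]. *)
Definition normalized_edge (i j : nat) : G :=
  (edge 7 7 * (edge i 7)^-1 * edge i j * (edge 7 j)^-1)%g.

Lemma edge_unmarked (x0 : complement_9_42 R) i j : (i < 8)%N -> (j < 8)%N ->
  ~~ mark i j ->
  (edge (pred8 i) j * (edge i j)^-1 =
   edge (pred8 i) (pred8 j) * (edge i (pred8 j))^-1)%g.
Proof.
move=> i8 j8 ij.
have E k l : k = i \/ k = pred8 i -> l = j \/ l = pred8 j ->
    (edge k l = g (Upiece k) (Wpiece i j) * g (Wpiece i j) (Vpiece l))%g.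
  move=> ki lj; have [y [y1 y2 y3]] := UVW_point x0 i8 j8 ij ki lj.
  by rewrite (gP y1 y3 y2).
have r1 k : k = k \/ k = pred8 k by left.
have r2 k : pred8 k = k \/ pred8 k = pred8 k by right.
by rewrite !E // !invgM !mulgA !mulgK.
Qed.

Lemma normalized_edge7 j : normalized_edge 7 j = 1%g.
Proof. by rewrite /normalized_edge mulgV mul1g mulgV. Qed.

Lemma normalized_edge_7 i : normalized_edge i 7 = 1%g.
Proof. by rewrite /normalized_edge mulgVK mulgV. Qed.

Lemma column_jump_edge i k : (column_jump normalized_edge i k =
  edge 7 7 * (edge (pred8 i) 7)^-1 * (edge (pred8 i) k * (edge i k)^-1) *
  (edge i 7 * (edge 7 7)^-1))%g.
Proof. by rewrite /column_jump /normalized_edge !invgM !invgK !mulgA mulgVK. Qed.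

Lemma normalized_edge_unmarked (x0 : complement_9_42 R) i j : (i < 8)%N ->
  (j < 8)%N -> ~~ mark i j ->
  column_jump normalized_edge i j = column_jump normalized_edge i (pred8 j).
Proof.
by move=> i8 j8 ij; rewrite !column_jump_edge (edge_unmarked x0).
Qed.

(** The left side runs once around the pair of rays [(i, j)] through [U_i], [V_j], [U_(i-1)],
    [V_(j-1)]: the holonomy of a small circle is the discrepancy between two jumps. *)
Lemma edge_loop i j :
  (edge i j * (edge (pred8 i) j)^-1 * edge (pred8 i) (pred8 j) *
     (edge i (pred8 j))^-1 =
  ((column_jump normalized_edge i j)^-1 * column_jump normalized_edge i (pred8 j))
    ^ (edge 7 7 / edge i 7))%g.
Proof.
rewrite !column_jump_edge /conjg !invgM !invgK !mulgA.
by rewrite !(mulgVK, mulgK, mulgV, mul1g).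
Qed.

End OfCocycle.

Section FromRelations.
Context {R : realType}.
Local Notation chart := (@chart R).
Variable x : nat -> G.
Hypothesis xP : grid_relations x.

Definition word_edge (i j : nat) : G := (row_word x j i.+1)^-1%g.

Lemma word_edge7 j : (j < 8)%N -> word_edge 7 j = 1%g.
Proof. by move=> j8; rewrite /word_edge xP // invg1. Qed.

Lemma word_edge_jump i j : (i < 8)%N -> (j < 8)%N ->
  column_jump word_edge i j = letter x j i.
Proof.
move=> i8 j8; rewrite /column_jump /word_edge invgK; case: i i8 => [_|i i8].
  by rewrite (xP j8) invg1 mul1g /= mul1g.
by rewrite pred8S 1?ltnW // [row_word x j i.+2]/= mulKg.
Qed.

Lemma word_edge_7 i : (i < 8)%N -> word_edge i 7 = 1%g.
Proof.
move=> i8; rewrite /word_edge; suff -> : row_word x 7 i.+1 = 1%g by rewrite invg1.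
elim: i.+1 i8 => // n IH n8; rewrite /= IH ?(ltnW n8) // mul1g.
by rewrite /letter active7.
Qed.

(** A W piece carries the trivialization of [U_i]: value 1 with [U_i], a letter with [U_(i-1)], and
    the values of [U_i] with V pieces. The pairs of the last line meet only when they are equal. *)
Definition word_cocycle (a b : piece) : G :=
  match a, b with
  | Upiece i, Vpiece j => word_edge i j
  | Vpiece j, Upiece i => (word_edge i j)^-1
  | Upiece k, Wpiece i j => if k == i then 1 else letter x j i
  | Wpiece i j, Upiece k => if k == i then 1 else (letter x j i)^-1
  | Vpiece l, Wpiece i j => (word_edge i l)^-1
  | Wpiece i j, Vpiece l => word_edge i l
  | _, _ => 1
  end%g.

Lemma sector_half i (u v : R) : sector i u v -> half_sector i u v.
Proof. by case=> h1 h2; split=> //; exact: ltW. Qed.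

Lemma sector_uniq i k (u v : R) : (i < 8)%N -> (k < 8)%N ->
  sector i u v -> sector k u v -> i = k.
Proof. by move=> i8 k8 /sector_half h /sector_half; exact: half_sector_uniq. Qed.

Lemma near_sector i k (u v : R) : (i < 8)%N -> (k < 8)%N ->
  near_ray i u v -> half_sector k u v -> k = i \/ k = pred8 i.
Proof.
move=> i8 k8 n h; have [h'|h'] := near_ray_half i8 n.
  by left; exact: half_sector_uniq h h'.
by right; apply: half_sector_uniq h h' => //; exact: pred8_lt.
Qed.

(** At a single point the cocycle is a quotient of values attached to the pieces, which makes the
    cocycle condition immediate. If the first component vanishes, [s] takes its default 0 and only
    one V piece contains the point. *)
Definition potential (y : complement_9_42 R) (a : piece) : G :=
  let s := xget 0%N [set k | (k < 8)%N /\ half_sector k (c0 (set_val y)) (c1 (set_val y))]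
  in match a with
  | Upiece i => 1
  | Vpiece j => word_edge s j
  | Wpiece i j => if s == i then 1 else letter x j i
  end%g.

Lemma word_cocycle_potential a b y : chart a y -> chart b y ->
  word_cocycle a b = ((potential y a)^-1 * potential y b)%g.
Proof.
set z0 := c0 (set_val y); set z1 := c1 (set_val y).
pose s := xget 0%N [set k | (k < 8)%N /\ half_sector k z0 z1].
have sE k : (k < 8)%N -> half_sector k z0 z1 -> s = k.
  move=> k8 h; have /(xgetPex 0%N)[s8 sh] : exists k,
    [set k | (k < 8)%N /\ half_sector k z0 z1] k by exists k.
  exact: half_sector_uniq s8 k8 sh h.
have sU k : chart (Upiece k) y -> s = k.
  by case=> k8 /sector_half; exact: sE.
have VV j l : chart (Vpiece j) y -> chart (Vpiece l) y -> j = l.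
  by case=> j8 h [l8 h']; exact: sector_uniq h h'.
have WV i j l : chart (Wpiece i j) y -> chart (Vpiece l) y ->
    ((word_edge i l)^-1 = (word_edge s l)^-1 * (if s == i then 1 else letter x j i))%g.
  case=> -[i8 j8 ij] [n n'] [l8 l'].
  case: eqP => [->|si]; first by rewrite mulg1.
  have [k k8 kh] := half_sector_ex (near_neq0 n); rewrite (sE _ k8 kh) in si *.
  have [//|->] := near_sector i8 k8 n kh.
  have <- : letter x l i = letter x j i.
    have [->//|->] := near_sector j8 l8 n' (sector_half l').
    by rewrite /letter -active_pred.
  by rewrite -word_edge_jump // mulKg.
case: a b => [i|j|i j] [k|l|k l] ha hb; rewrite /potential -/z0 -/z1 -/s /=.
- by rewrite invg1 mul1g.
- by rewrite (sU i) // invg1 mul1g.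
- by rewrite (sU i) // invg1 mul1g.
- by rewrite (sU k) // mulg1.
- by rewrite (VV j l) // mulVg.
- exact: WV hb ha.
- by rewrite (sU k) //; case: ifP => _; rewrite ?invg1 mulg1.
- by apply: invg_inj; rewrite (WV _ _ _ ha hb) invgM [X in _ = (_ * X)%g]invgK.
- case: ha => -[i8 j8 _] [n n']; case: hb => -[k8 l8 _] [m m'].
  by rewrite (near_ray_uniq i8 k8 n m) (near_ray_uniq j8 l8 n' m') mulVg.
Qed.

Lemma word_cocycleP : cocycle chart word_cocycle.
Proof.
move=> a b c y ay by_ cy; rewrite !(@word_cocycle_potential _ _ y) //.
by rewrite mulgA mulgK.
Qed.

Lemma normalized_word_edge i j : (i < 8)%N -> (j < 8)%N ->
  normalized_edge word_cocycle i j = word_edge i j.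
Proof.
move=> i8 j8; rewrite /normalized_edge /edge /=.
by rewrite !word_edge_7 // word_edge7 // !invg1 !mul1g mulg1.
Qed.

End FromRelations.

End GridRelations.

(** * Presentation of the knot group *)

Section GridGroup.
Context {R : realType} (x0 : complement_9_42 R).
Local Notation I := (unit_itv R).
Local Notation T := (complement_9_42 R).
Local Notation pi1 := (fundamental_group R x0).
Local Notation chart := (@chart R).
Local Notation pathI x y := {path I from x to y in T}.

Definition base_path (y : T) : pathI x0 y := projT1 (cid (complement_connected x0 y)).

Definition grid_overlap : piece -> piece -> pi1 := overlap chart base_path.

Lemma grid_overlapP : cocycle chart grid_overlap.
Proof.
by apply: overlap_cocycle; [exact: (chart_joined x0)|exact: (chart_unique x0)].
Qed.

Definition grid_gen (i : nat) : pi1 := column_gen (normalized_edge grid_overlap) i.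

Lemma grid_gen_relations : grid_relations grid_gen.
Proof.
apply: column_gen_relations => [j j8|i i8|i j].
- exact: normalized_edge7.
- exact: normalized_edge_7.
- exact: (normalized_edge_unmarked grid_overlapP x0).
Qed.

Lemma grid_jump i j : (i < 8)%N -> (j < 8)%N ->
  column_jump (normalized_edge grid_overlap) i j = letter grid_gen j i.
Proof.
move=> i8 j8; apply: (column_jumpE _ _ i8 j8) => [k k8|k l].
- exact: normalized_edge_7.
- exact: (normalized_edge_unmarked grid_overlapP x0).
Qed.

(** After a gauge, the U-V transitions become normalized edges, which are inverses of row words in
    the generators. *)
Lemma grid_gen_generates (S : {pred pi1}) : group_closed S ->
  (forall i, (i < 8)%N -> grid_gen i \in S) -> forall m, m \in S.
Proof.
move=> Sg xS.
have S1 : 1%g \in S by case: Sg.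
have SM (x y : pi1) : x \in S -> y \in S -> (x * y)%g \in S.
  by move=> xS' yS'; exact: (group_closedM Sg).
have SV (x : pi1) : x \in S -> (x^-1)%g \in S by exact: (group_closedV Sg).
have fS i j : (i < 8)%N -> (j < 8)%N -> normalized_edge grid_overlap i j \in S.
  move=> i8 j8; rewrite -[normalized_edge _ _ _]invgK; apply: SV.
  rewrite (row_wordE (f := normalized_edge grid_overlap) _ _ _ i8 j8) => [|k k8|k k8|k l].
  - elim: i.+1 i8 => [|n IH] n8 //=; apply: SM; first exact: IH (ltnW n8).
    by rewrite /letter; case: ifP => _ //; exact: xS.
  - exact: normalized_edge7.
  - exact: normalized_edge_7.
  - exact: (normalized_edge_unmarked grid_overlapP x0).
pose ed := edge grid_overlap.
(* The gauge of [normalized_edge], extended to each W piece so that its transition with [U_i] is 1;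
   the remaining transitions follow through triple points. *)
pose kU i := (ed i 7%N * (ed 7%N 7%N)^-1)%g.
pose k (a : piece) : pi1 := match a with
  | Upiece i => kU i
  | Vpiece j => (ed 7%N j)^-1
  | Wpiece i j => grid_overlap (Wpiece i j) (Upiece i) * kU i
  end%g.
apply: (overlap_generates chart_open chart_ofP (chart_joined x0) (chart_unique x0)
  (k := k) Sg).
pose h a b := ((k a)^-1 * grid_overlap a b * k b)%g.
have hP : cocycle chart h := gauge_cocycle k grid_overlapP.
suff hS : forall a b y, chart a y -> chart b y -> h a b \in S by exact: hS.
move=> a b y.
have hV a' b' y' : chart a' y' -> chart b' y' -> h a' b' \in S -> h b' a' \in S.
  by move=> ha hb; rewrite (cocycleV hP hb ha); exact: SV.
have hUV i j : (i < 8)%N -> (j < 8)%N -> h (Upiece i) (Vpiece j) \in S.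
  move=> i8 j8; move: (fS i j i8 j8).
  by rewrite /normalized_edge /h /= /kU invgM invgK.
have hUW i j y' : chart (Upiece i) y' -> chart (Wpiece i j) y' ->
    h (Upiece i) (Wpiece i j) = 1%g.
  move=> yU yW; rewrite /h /= (cocycleV grid_overlapP yU yW).
  by rewrite -!mulgA mulKg mulVg.
have hVW i j l y' : chart (Vpiece l) y' -> chart (Wpiece i j) y' ->
    h (Vpiece l) (Wpiece i j) \in S.
  case=> l8 sl [[i8 j8 ij] [_ nj]].
  have lj := near_sector j8 l8 nj (sector_half sl).
  have [z [z1 z2 z3]] := UVW_point x0 i8 j8 ij (or_introl erefl) lj.
  rewrite -(hP _ _ _ _ z2 z1 z3) (hUW _ _ _ z1 z3) mulg1.
  by apply: (hV _ _ _ z1 z2); exact: hUV.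
have hUW' i j l y' : chart (Upiece l) y' -> chart (Wpiece i j) y' ->
    h (Upiece l) (Wpiece i j) \in S.
  case=> l8 sl [[i8 j8 ij] [ni _]].
  have li := near_sector i8 l8 ni (sector_half sl).
  have [z [z1 z2 z3]] := UVW_point x0 i8 j8 ij li (or_introl erefl).
  by rewrite -(hP _ _ _ _ z1 z2 z3); apply: SM; [exact: hUV|exact: hVW z2 z3].
have hD a' y' : chart a' y' -> h a' a' \in S by move=> ha; rewrite (cocycle_diag hP ha).
case: a b => [i|j|i j] [m|l|m l] ha hb.
- rewrite -(sector_uniq ha.1 hb.1 ha.2 hb.2); exact: hD ha.
- by case: ha => i8 _; case: hb => l8 _; exact: hUV.
- exact: hUW' ha hb.
- by apply: (hV _ _ _ hb ha); case: ha => j8 _; case: hb => m8 _; exact: hUV.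
- rewrite -(sector_uniq ha.1 hb.1 ha.2 hb.2); exact: hD ha.
- exact: hVW ha hb.
- by apply: (hV _ _ _ hb ha); exact: hUW' hb ha.
- by apply: (hV _ _ _ hb ha); exact: hVW hb ha.
- have [[i8 j8 _] [n n']] := ha; have [[k8 l8 _] [q q']] := hb.
  rewrite -(near_ray_uniq i8 k8 n q) -(near_ray_uniq j8 l8 n' q'); exact: hD ha.
Qed.

(** The holonomy of [word_cocycle] takes the generators to the [x i] up to one common conjugation,
    by [k (Upiece 7)], which [rho] undoes. *)
Lemma grid_gen_universal (G : groupType) (x : nat -> G) : grid_relations x ->
  exists rho : {multiplicative pi1 -> G}, forall i, (i < 8)%N -> rho (grid_gen i) = x i.
Proof.
move=> xP; have gP := word_cocycleP (R := R) xP.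
pose L (m : pi1) : G := loop_hol chart chart_of (word_cocycle x) m.
have LM : {morph L : m n / (m * n)%g} by move=> m n; exact: (loop_holM chart_open chart_ofP gP).
have L1 : (L 1 = 1)%g by apply: (mulgI (L 1%g)); rewrite -LM !mulg1.
have LV (m : pi1) : (L m^-1 = (L m)^-1)%g.
  by apply: (mulgI (L m)); rewrite -LM !mulgV L1.
have [k kP] := loop_hol_of_overlap chart_open chart_ofP (chart_joined x0)
  (chart_unique x0) base_path gP.
have LE i j : (i < 8)%N -> (j < 8)%N -> L (edge grid_overlap i j) =
    (k (Upiece i) * edge (word_cocycle x) i j * (k (Vpiece j))^-1)%g.
  by move=> i8 j8; have [y [y1 y2]] := UV_point x0 i8 j8; exact: kP y1 y2.
have LF i j : (i < 8)%N -> (j < 8)%N -> L (normalized_edge grid_overlap i j) =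
    (word_edge x i j ^ (k (Upiece 7))^-1)%g.
  move=> i8 j8; rewrite -(normalized_word_edge xP) // /normalized_edge.
  rewrite !LM !LV !LE // /conjg !invgM !invgK !mulgA.
  by rewrite !(mulgVK, mulgK).
pose rho (m : pi1) := (L m ^ k (Upiece 7))%g.
have rhoM : {morph rho : m n / (m * n)%g} by move=> m n; rewrite /rho LM conjMg.
pose rhoB := isMultiplicative.Build pi1 G rho rhoM.
pose rho' : {multiplicative pi1 -> G} := HB.pack rho rhoB.
exists rho' => i i8; rewrite /= /rho /grid_gen /column_gen /column_jump LM LV.
have [al8 l8] := active_lo i8.
rewrite !LF ?pred8_lt // -conjVg -conjMg conjgKV.
by rewrite -[LHS]/(column_jump (word_edge x) i (lo i)) word_edge_jump // /letter al8.
Qed.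

End GridGroup.

(** * Small circles around the arcs of the knot *)

Section LinkCircles.
Context {R : realType}.
Local Notation T := (complement_9_42 R).

(* The circle of radius s around the point with parameter t of the arc from a_i
   to b_j, in the sphere orthogonal to the arc. *)
Definition link_circle (i j : nat) (t s psi : R) : 'rV[R]_4 :=
  cos s *: grid_arc X_9_42 i j t + sin s *:
    (cos psi *: first_circle (grid_angle R X_9_42 i + pi / 2) +
     sin psi *: second_circle (grid_angle R X_9_42 j + pi / 2)).

Lemma link_circleE i j t s psi :
  let th := grid_angle R X_9_42 i in let th' := grid_angle R X_9_42 j in
  [/\ c0 (link_circle i j t s psi) = cos s * cos t * cos th - sin s * cos psi * sin th,
      c1 (link_circle i j t s psi) = cos s * cos t * sin th + sin s * cos psi * cos th,
      c2 (link_circle i j t s psi) = cos s * sin t * cos th' - sin s * sin psi * sin th' &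
      c3 (link_circle i j t s psi) = cos s * sin t * sin th' + sin s * sin psi * cos th'].
Proof.
split; rewrite /c0 /c1 /c2 /c3 /link_circle /grid_arc /first_circle /second_circle !mxE /=;
  by rewrite ?cosDpihalf ?sinDpihalf; ring.
Qed.

Lemma sumsq_link_circle i j t s psi : sumsq (link_circle i j t s psi) = 1.
Proof.
rewrite sumsqE; have [-> -> -> ->] := link_circleE i j t s psi.
set c := cos (grid_angle _ _ i); set d := sin (grid_angle _ _ i).
set c' := cos (grid_angle _ _ j); set d' := sin (grid_angle _ _ j).
have h : c ^+ 2 + d ^+ 2 = 1 by exact: cos2Dsin2.
have h' : c' ^+ 2 + d' ^+ 2 = 1 by exact: cos2Dsin2.
have -> : (cos s * cos t * c - sin s * cos psi * d) ^+ 2 +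
    (cos s * cos t * d + sin s * cos psi * c) ^+ 2 =
    ((cos s * cos t) ^+ 2 + (sin s * cos psi) ^+ 2) * (c ^+ 2 + d ^+ 2) by ring.
have -> : (cos s * sin t * c' - sin s * sin psi * d') ^+ 2 +
    (cos s * sin t * d' + sin s * sin psi * c') ^+ 2 =
    ((cos s * sin t) ^+ 2 + (sin s * sin psi) ^+ 2) * (c' ^+ 2 + d' ^+ 2) by ring.
rewrite h h' !mulr1.
have -> : (cos s * cos t) ^+ 2 + (sin s * cos psi) ^+ 2 +
    ((cos s * sin t) ^+ 2 + (sin s * sin psi) ^+ 2) =
    cos s ^+ 2 * (cos t ^+ 2 + sin t ^+ 2) + sin s ^+ 2 * (cos psi ^+ 2 + sin psi ^+ 2)
  by ring.
by rewrite !cos2Dsin2 !mulr1 cos2Dsin2.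
Qed.

(** The deviation from the two rays is at most [sin s], while the parts along them are
    [cos s * cos t] and [cos s * sin t]; the factor 4 is the slope bound of [near_ray]. *)
Definition thin (t s : R) :=
  [/\ 0 < sin s, 4 * sin s < cos s * cos t & 4 * sin s < cos s * sin t].

Lemma thin_ex (t : R) : 0 < t < pi / 2 -> exists2 s0, 0 < s0 < pi / 2 &
  forall s, 0 < s <= s0 -> thin t s.
Proof.
move=> t0; have p0 := pi_gt0 R.
have ct : 0 < cos t by apply: cos_gt0_pihalf; lra.
have st : 0 < sin t by apply: sin_gt0_pihalf.
(* [s0] is the angle with tangent [c]; dividing by 5 rather than 4 makes the inequalities strict. *)
pose c := Num.min (cos t) (sin t) / 5.
have c0 : 0 < c by rewrite divr_gt0 // lt_min ct st.
have [cc cs] : c <= cos t / 5 /\ c <= sin t / 5.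
  by rewrite !ler_pM2r ?invr_gt0 // !ge_min !lexx orbT.
pose m := Num.sqrt (1 + c ^+ 2).
have m2 : m ^+ 2 = 1 + c ^+ 2 by rewrite sqr_sqrtr //; nra.
have m0 : 0 < m by rewrite sqrtr_gt0; nra.
have [s0 s01 [cs0 ss0]] : exists2 s, 0 <= s <= pi / 2 & cos s = m^-1 /\ sin s = c / m.
  apply: circle_angle; [by rewrite invr_ge0 ltW|by rewrite divr_ge0 ?ltW|].
  have -> : m^-1 ^+ 2 + (c / m) ^+ 2 = (1 + c ^+ 2) / m ^+ 2 by field; lra.
  by rewrite m2 divff //; nra.
have s0pos : 0 < s0.
  rewrite lt_neqAle (andP s01).1 andbT; apply/eqP => s00.
  have : 0 < sin s0 by rewrite ss0 divr_gt0.
  by rewrite -s00 sin0 ltxx.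
have s0lt : s0 < pi / 2.
  rewrite lt_neqAle (andP s01).2 andbT; apply/eqP => s00.
  have : 0 < cos s0 by rewrite cs0 invr_gt0.
  by rewrite s00 cos_pihalf ltxx.
exists s0; first by rewrite s0pos.
move=> s /andP[sp ss].
have cp : 0 < cos s by apply: cos_gt0_pihalf; lra.
have sinp : 0 < sin s by apply: sin_gt0_pi; lra.
have : 0 <= sin (s0 - s) by apply: sin_ge0_pi; lra.
rewrite sinB cs0 ss0 => h.
have h1 : sin s <= c * cos s.
  have : 0 <= (c / m * cos s - m^-1 * sin s) * m by rewrite mulr_ge0 // ltW.
  have -> : (c / m * cos s - m^-1 * sin s) * m = c * cos s - sin s by field; lra.
  by lra.
by split=> //; nra.
Qed.

Lemma near_sector_sign i (x y : R) : (i < 8)%N -> near_ray i x y ->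
  (0 < crossd i x y -> sector i x y) /\ (crossd i x y < 0 -> sector (pred8 i) x y).
Proof.
move: i; apply: lt8_ind; rewrite /near_ray /dotd /sector /crossd /dx /dy /=;
  move=> [h1 h2]; split=> h3; split; lra.
Qed.

Lemma link_circle_near i (A B : R) : (i < 8)%N -> 4 * `|B| < A ->
  let th := grid_angle R X_9_42 i in
  let x := A * cos th - B * sin th in let y := A * sin th + B * cos th in
  [/\ near_ray i x y, 0 < B -> sector i x y & B < 0 -> sector (pred8 i) x y].
Proof.
move=> i8 AB; have [n n0 [cn sn]] := cos_sin_dir (R := R) i.
rewrite /grid_angle [size _]/= cn sn /=; set x := (A * _ - _); set y := (A * _ + _).
have N := dir_neq0 (R := R) i8; have Nn : 0 < n * (dx i ^+ 2 + dy i ^+ 2) := mulr_gt0 n0 N.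
set D := n * (dx i ^+ 2 + dy i ^+ 2) in Nn.
have cE : crossd i x y = B * D by rewrite /crossd /x /y /D; ring.
have dE : dotd i x y = A * D by rewrite /dotd /x /y /D; ring.
have [b1 b2] : 4 * B < A /\ - (4 * B) < A.
  by have := ler_norm B; have := ler_norm (- B); rewrite normrN; lra.
have nr : near_ray i x y by rewrite /near_ray cE dE; split; nra.
have [s1 s2] := near_sector_sign i8 nr; split=> // hB.
  by apply: s1; rewrite cE mulr_gt0.
by apply: s2; rewrite cE pmulr_llt0.
Qed.

Lemma link_circle_chart i j t s psi : (i < 8)%N -> (j < 8)%N -> thin t s ->
  [/\ 0 < cos psi -> cone (Upiece i) (link_circle i j t s psi),
      cos psi < 0 -> cone (Upiece (pred8 i)) (link_circle i j t s psi),
      0 < sin psi -> cone (Vpiece j) (link_circle i j t s psi) &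
      sin psi < 0 -> cone (Vpiece (pred8 j)) (link_circle i j t s psi)].
Proof.
move=> i8 j8 [sp h1 h2]; have [e0 e1 e2 e3] := link_circleE i j t s psi.
rewrite /= e0 e1 e2 e3.
have [k1 k2] : `|sin s * cos psi| <= sin s /\ `|sin s * sin psi| <= sin s.
  have C : `|cos psi| <= 1 by rewrite ler_norml cos_geN1 cos_le1.
  have S : `|sin psi| <= 1 by rewrite ler_norml sin_geN1 sin_le1.
  by rewrite !normrM (gtr0_norm sp) !ler_piMr // ltW.
have [|_ u1 u2] := @link_circle_near i (cos s * cos t) (sin s * cos psi) i8; first by lra.
have [|_ v1 v2] := @link_circle_near j (cos s * sin t) (sin s * sin psi) j8; first by lra.
split=> h; split; rewrite ?pred8_lt //.
- by apply: u1; rewrite mulr_gt0.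
- by apply: u2; rewrite pmulr_rlt0.
- by apply: v1; rewrite mulr_gt0.
- by apply: v2; rewrite pmulr_rlt0.
Qed.

Lemma link_circle_avoid i j t s psi : (i < 8)%N -> (j < 8)%N -> thin t s ->
  ~ grid_knot R X_9_42 O_9_42 (link_circle i j t s psi).
Proof.
move=> i8 j8 ts; have [a1 a2 a3 a4] := link_circle_chart psi i8 j8 ts.
have [/a1|/a2|c0] := ltrgtP 0 (cos psi); try exact: cone_knot.
have [/a3|/a4|s0] := ltrgtP 0 (sin psi); try exact: cone_knot.
by have := cos2Dsin2 psi; rewrite -c0 -s0; lra.
Qed.

Lemma link_circle_cts (X : topologicalType) i j t (s psi : X -> R) :
  continuous s -> continuous psi -> continuous (fun x => link_circle i j t (s x) (psi x)).
Proof.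
move=> cs cp.
have CC (f : X -> R) : continuous f -> continuous (fun x => cos (f x)).
  by move=> cf; exact: (comp_cts cf (@continuous_cos R)).
have CS (f : X -> R) : continuous f -> continuous (fun x => sin (f x)).
  by move=> cf; exact: (comp_cts cf (@continuous_sin R)).
move=> x; apply: cvgD; apply: cvgZ; try exact: CC; try exact: CS; try exact: cst_continuous.
by apply: cvgD; apply: cvgZ; try exact: CC; try exact: CS; exact: cst_continuous.
Qed.

Lemma unit_angle (a b : R) : a ^+ 2 + b ^+ 2 = 1 ->
  exists phi, cos phi = a /\ sin phi = b.
Proof.
move=> ab; have a1 : -1 <= a <= 1 by nra.
have ca : cos (acos a) = a by apply: acosK; rewrite in_itv.
have sa : sin (acos a) = `|b|.
  by rewrite sin_acos // (_ : 1 - a ^+ 2 = b ^+ 2) ?sqrtr_sqr //; lra.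
have [b0|b0] := leP 0 b.
  by exists (acos a); rewrite sa ger0_norm.
by exists (- acos a); rewrite cosN sinN sa ltr0_norm // opprK.
Qed.

(** [e] is the determinant of the pair, which orthonormality forces to be 1 or -1. *)
Lemma orthonormal_pair (a b c d : R) : a ^+ 2 + b ^+ 2 = 1 -> c ^+ 2 + d ^+ 2 = 1 ->
  a * c + b * d = 0 -> exists2 e : R, e = 1 \/ e = -1 & c = - e * b /\ d = e * a.
Proof.
move=> ab cd o; pose e := a * d - b * c.
have cE : c = - e * b.
  by rewrite /e -[LHS]mulr1 -ab; apply/eqP; rewrite -subr_eq0; apply/eqP;
    transitivity (a * (a * c + b * d)); [ring|rewrite o mulr0].
have dE : d = e * a.
  by rewrite /e -[LHS]mulr1 -ab; apply/eqP; rewrite -subr_eq0; apply/eqP;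
    transitivity (b * (a * c + b * d)); [ring|rewrite o mulr0].
exists e; last by [].
have : (e - 1) * (e + 1) = 0.
  transitivity (e ^+ 2 * 1 - 1); first by ring.
  by rewrite -[X in _ * X]ab -cd cE dE; ring.
move/eqP; rewrite mulf_eq0 => /orP[]/eqP h; [left|right]; lra.
Qed.

Definition dot4 (p q : 'rV[R]_4) : R :=
  c0 p * c0 q + c1 p * c1 q + (c2 p * c2 q + c3 p * c3 q).

Lemma frame_dot (p v u w : 'rV[R]_4) : oriented_frame p v u w ->
  [/\ dot4 p u = 0, dot4 v u = 0, dot4 p w = 0 & dot4 v w = 0] /\
  [/\ dot4 u u = 1, dot4 w w = 1 & dot4 u w = 0].
Proof.
case=> FF _; have E (k l : 'I_4) : dot4 ([:: p; v; u; w]`_k) ([:: p; v; u; w]`_l) = (k == l)%:R.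
  have /matrixP/(_ k l) := FF; rewrite !mxE !big_ord_recl big_ord0 addr0 !mxE => <-.
  rewrite /dot4 /c0 /c1 /c2 /c3 !addrA.
  by do ![congr (_ + _)]; congr (_ * _); congr (_ 0 _); apply: val_inj.
have := E (@o4 0 isT) (@o4 2 isT); have := E (@o4 1 isT) (@o4 2 isT).
have := E (@o4 0 isT) (@o4 3 isT); have := E (@o4 1 isT) (@o4 3 isT).
have := E (@o4 2 isT) (@o4 2 isT); have := E (@o4 3 isT) (@o4 3 isT).
by have := E (@o4 2 isT) (@o4 3 isT); rewrite /=.
Qed.

(** The point and the tangent span the plane of a_i and b_j, whose orthogonal complement is spanned
    by the tangents of the two circles at a_i and b_j. *)
Lemma orthogonal_arc i j t (u : 'rV[R]_4) : dot4 (grid_arc X_9_42 i j t) u = 0 ->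
  dot4 (grid_arc_tangent X_9_42 i j t) u = 0 -> exists a b,
  u = a *: first_circle (grid_angle R X_9_42 i + pi / 2) +
      b *: second_circle (grid_angle R X_9_42 j + pi / 2).
Proof.
rewrite /dot4 /grid_arc /grid_arc_tangent; set th := grid_angle _ _ i.
set th' := grid_angle _ _ j; rewrite /c0 /c1 /c2 /c3 !mxE /= => h1 h2.
pose x := cos th * c0 u + sin th * c1 u; pose y := cos th' * c2 u + sin th' * c3 u.
have g1 : cos t * x + sin t * y = 0 by rewrite -h1 /x /y /c0 /c1 /c2 /c3; ring.
have g2 : - sin t * x + cos t * y = 0 by rewrite -h2 /x /y /c0 /c1 /c2 /c3; ring.
have ct := cos2Dsin2 t; have c1' := cos2Dsin2 th; have c2' := cos2Dsin2 th'.
have x0 : x = 0.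
  transitivity ((cos t ^+ 2 + sin t ^+ 2) * x); first by rewrite ct mul1r.
  transitivity (cos t * (cos t * x + sin t * y) - sin t * (- sin t * x + cos t * y)).
    by ring.
  by rewrite g1 g2 !mulr0 subr0.
have y0 : y = 0.
  transitivity ((cos t ^+ 2 + sin t ^+ 2) * y); first by rewrite ct mul1r.
  transitivity (sin t * (cos t * x + sin t * y) + cos t * (- sin t * x + cos t * y)).
    by ring.
  by rewrite g1 g2 !mulr0 addr0.
exists (- sin th * c0 u + cos th * c1 u), (- sin th' * c2 u + cos th' * c3 u).
apply: row4P; [rewrite [RHS]/c0|rewrite [RHS]/c1|rewrite [RHS]/c2|rewrite [RHS]/c3];
  rewrite !mxE /= ?cosDpihalf ?sinDpihalf.
- transitivity ((cos th ^+ 2 + sin th ^+ 2) * c0 u); first by rewrite c1' mul1r.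
  transitivity (cos th * x - sin th * (- sin th * c0 u + cos th * c1 u)).
    by rewrite /x; ring.
  by rewrite x0; ring.
- transitivity ((cos th ^+ 2 + sin th ^+ 2) * c1 u); first by rewrite c1' mul1r.
  transitivity (sin th * x + cos th * (- sin th * c0 u + cos th * c1 u)).
    by rewrite /x; ring.
  by rewrite x0; ring.
- transitivity ((cos th' ^+ 2 + sin th' ^+ 2) * c2 u); first by rewrite c2' mul1r.
  transitivity (cos th' * y - sin th' * (- sin th' * c2 u + cos th' * c3 u)).
    by rewrite /y; ring.
  by rewrite y0; ring.
- transitivity ((cos th' ^+ 2 + sin th' ^+ 2) * c3 u); first by rewrite c2' mul1r.
  transitivity (sin th' * y + cos th' * (- sin th' * c2 u + cos th' * c3 u)).
    by rewrite /y; ring.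
  by rewrite y0; ring.
Qed.

Lemma dot4_ab th th' a b c d :
  dot4 (a *: first_circle (th + pi / 2) + b *: second_circle (th' + pi / 2))
       (c *: first_circle (th + pi / 2) + d *: second_circle (th' + pi / 2)) =
  a * c + b * d.
Proof.
rewrite /dot4 /c0 /c1 /c2 /c3 !mxE /=.
set x := th + _; set y := th' + _.
transitivity (a * c * (cos x ^+ 2 + sin x ^+ 2) + b * d * (cos y ^+ 2 + sin y ^+ 2)).
  by ring.
by rewrite !cos2Dsin2 !mulr1.
Qed.

Lemma dot4N p q : dot4 (- p) q = - dot4 p q.
Proof. by rewrite /dot4 /c0 /c1 /c2 /c3 !mxE; ring. Qed.

Lemma positive_tangent_arc (p v : 'rV[R]_4) : positive_tangent X_9_42 O_9_42 p v ->
  exists i j t, [/\ (i < 8)%N, (j < 8)%N & mark i j] /\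
  [/\ 0 < t < pi / 2, p = grid_arc X_9_42 i j t &
      v = grid_arc_tangent X_9_42 i j t \/ v = - grid_arc_tangent X_9_42 i j t].
Proof.
case=> i [t [i8 t0 H]].
have xo : (nth 0 X_9_42 i < 8)%N /\ (nth 0 O_9_42 i < 8)%N by move: i i8 {H}; apply: lt8_ind.
case: H => -[-> ->]; [exists i, (nth 0%N O_9_42 i), t|exists i, (nth 0%N X_9_42 i), t];
  rewrite /mark eqxx ?orbT; split; split=> //; by [case: xo|left|right].
Qed.

(** An orthonormal basis of the normal plane differs from the standard one by a rotation [phi] and
    possibly a reflection, recorded in the sign [e]. *)
Lemma disc_point_circle (p v u w : 'rV[R]_4) : positive_tangent X_9_42 O_9_42 p v ->
  oriented_frame p v u w -> exists i j t phi e,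
  [/\ (i < 8)%N, (j < 8)%N, mark i j, 0 < t < pi / 2 & e = 1 \/ e = -1] /\
  forall s a, disc_point p u w s a = link_circle i j t s (phi + e * a).
Proof.
move=> /positive_tangent_arc[i [j [t [[i8 j8 ij] [t0 pE vE]]]]].
move=> /frame_dot[[pu vu pw vw] [uu ww uw]].
have tg x : dot4 v x = 0 -> dot4 (grid_arc_tangent X_9_42 i j t) x = 0.
  by case: vE => -> //; rewrite dot4N => /eqP; rewrite oppr_eq0 => /eqP.
rewrite pE in pu pw.
have [a [b uE]] := orthogonal_arc pu (tg _ vu).
have [c [d wE]] := orthogonal_arc pw (tg _ vw).
move: uu ww uw; rewrite uE wE !dot4_ab => uu ww uw.
have [e e1 [cE dE]] := orthonormal_pair uu ww uw.
have [phi [cp sp]] := unit_angle uu.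
exists i, j, t, phi, e; split=> // s al.
rewrite /disc_point /link_circle pE; congr (_ + _ *: _).
rewrite !scalerDr !scalerA addrACA -!scalerDl.
have [ce se] : cos (e * al) = cos al /\ sin (e * al) = e * sin al.
  by case: e1 => ->; rewrite ?mulN1r ?mul1r ?cosN ?sinN.
by rewrite cosD sinD ce se cp sp cE dE; congr (_ *: _ + _ *: _); ring.
Qed.

End LinkCircles.

(** * Meridians as conjugates of generators or of their inverses *)

Section LoopAroundFour.
Context {R : realType} {T : topologicalType} {A : Type} (O : A -> set T).
Context (al : T -> A) {G : groupType} (g : A -> A -> G).
Hypothesis alP : forall y, O (al y) y.
Hypothesis gP : cocycle O g.

Lemma hol_four (Y : R -> T) a b c d t1 t2 t3 t4 t5 :
  0 <= t1 -> t1 <= t2 -> t2 <= t3 -> t3 <= t4 -> t4 <= t5 ->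
  (forall t, 0 <= t <= t1 -> O a (Y t)) -> (forall t, t1 <= t <= t2 -> O b (Y t)) ->
  (forall t, t2 <= t <= t3 -> O c (Y t)) -> (forall t, t3 <= t <= t4 -> O d (Y t)) ->
  (forall t, t4 <= t <= t5 -> O a (Y t)) -> Y t5 = Y 0 ->
  exists k, hol O al g Y 0 t5 ((g a b * g b c * g c d * g d a) ^ k)%g.
Proof.
move=> h1 h2 h3 h4 h5 Ha Hb Hc Hd Ha' Y5.
have [a1 a4] : O a (Y t1) /\ O a (Y t4) by split; [apply: Ha|apply: Ha']; lra.
have a0 : O a (Y 0) by apply: Ha; lra.
have [b1 b2] : O b (Y t1) /\ O b (Y t2) by split; apply: Hb; lra.
have [e2 e3] : O c (Y t2) /\ O c (Y t3) by split; apply: Hc; lra.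
have [d3 d4] : O d (Y t3) /\ O d (Y t4) by split; apply: Hd; lra.
exists (g a (al (Y 0))).
have H := hol_cat (le_trans (le_trans (le_trans h1 h2) h3) h4) h5
  (hol_cat (le_trans (le_trans h1 h2) h3) h4
    (hol_cat (le_trans h1 h2) h3
      (hol_cat h1 h2 (hol_step al g h1 Ha) (hol_step al g h2 Hb))
      (hol_step al g h3 Hc)) (hol_step al g h4 Hd)) (hol_step al g h5 Ha').
move: H; rewrite Y5; set X := (_ * _)%g; set W := (_ ^ _)%g; suff -> : X = W by [].
rewrite /X /W /conjg (cocycleV gP a0 (alP (Y 0))) invgK.
rewrite -(gP a1 (alP _) b1) -(gP b2 (alP _) e2).
rewrite -(gP e3 (alP _) d3) -(gP d4 (alP _) a4).
by rewrite !mulgA.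
Qed.

End LoopAroundFour.

Section Meridians.
Context {R : realType} (x0 : complement_9_42 R).
Local Notation I := (unit_itv R).
Local Notation T := (complement_9_42 R).
Local Notation pi1 := (fundamental_group R x0).
Local Notation chart := (@chart R).
Local Notation pathI x y := {path I from x to y in T}.
Local Notation K := (grid_knot R X_9_42 O_9_42).

Lemma trig_period (a e : R) : e = 1 \/ e = -1 ->
  cos (a + e * (2 * pi)) = cos a /\ sin (a + e * (2 * pi)) = sin a.
Proof.
rewrite mulr_natl => -[] ->; first by rewrite mul1r cosD2pi sinD2pi.
rewrite mulN1r; have := subrK (pi *+ 2) a; move: (a - _) => b <-.
by rewrite cosD2pi sinD2pi.
Qed.

Lemma complement_id (p : 'rV[R]_4) : sumsq p = 1 -> ~ K p ->
  complement_9_42 R (normalized p) /\ set_val (to_complement x0 p) = p.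
Proof.
move=> p1 pK; have Yp : complement_9_42 R (normalized p) by rewrite normalized_id.
by split; rewrite ?set_val_complement // normalized_id.
Qed.

(** The circle is cut at the odd multiples of [pi / 4], where consecutive pieces among the four
    overlap; for [e = -1] the circuit runs backwards. *)
Lemma link_circle_hol (G : groupType) (g : piece -> piece -> G) i j t s e :
  cocycle chart g -> (i < 8)%N -> (j < 8)%N -> thin t s -> e = 1 \/ e = -1 ->
  exists k, let W := (edge g i j * (edge g (pred8 i) j)^-1 *
    edge g (pred8 i) (pred8 j) * (edge g i (pred8 j))^-1)%g in
  let Y psi := to_complement x0 (link_circle i j t s (e * psi)) in
  hol chart chart_of g Y 0 (2 * pi) (W ^ k)%g \/
  hol chart chart_of g Y 0 (2 * pi) (W^-1 ^ k)%g.
Proof.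
move=> gP i8 j8 ts e1 /=; set W := (_ * _)%g.
pose Y (psi : R) := to_complement x0 (link_circle i j t s (e * psi)); rewrite -/Y.
have p0 : 0 < pi :> R := pi_gt0 R.
have [i8' j8'] : (pred8 i < 8)%N /\ (pred8 j < 8)%N by rewrite !pred8_lt.
have cc (psi : R) : cos (e * psi) = cos psi.
  by case: e1 => ->; rewrite ?mul1r // mulN1r cosN.
have C (psi : R) := link_circle_chart (e * psi) i8 j8 ts.
have U1 psi : 0 < cos psi -> chart (Upiece i) (Y psi).
  by move=> h; apply: chart_complement; have [+ _ _ _] := C psi; apply; rewrite cc.
have U2 psi : cos psi < 0 -> chart (Upiece (pred8 i)) (Y psi).
  by move=> h; apply: chart_complement; have [_ + _ _] := C psi; apply; rewrite cc.
have V1 psi : 0 < sin (e * psi) -> chart (Vpiece j) (Y psi).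
  by move=> h; apply: chart_complement; have [_ _ + _] := C psi; apply.
have V2 psi : sin (e * psi) < 0 -> chart (Vpiece (pred8 j)) (Y psi).
  by move=> h; apply: chart_complement; have [_ _ _ +] := C psi; apply.
have Y2 : Y (2 * pi) = Y 0.
  rewrite /Y mulr0 -[_ * (2 * pi)]add0r /link_circle.
  by have [-> ->] := trig_period 0 e1.
have B1 t' : 0 <= t' <= pi / 4 -> chart (Upiece i) (Y t').
  by move=> h; apply: U1; apply: cos_gt0_pihalf; lra.
have B5 t' : 7 * pi / 4 <= t' <= 2 * pi -> chart (Upiece i) (Y t').
  move=> h; apply: U1; rewrite -[t'](subrK (pi *+ 2)) cosD2pi.
  by apply: cos_gt0_pihalf; rewrite -[pi *+ 2]mulr_natl; lra.
have B3 t' : 3 * pi / 4 <= t' <= 5 * pi / 4 -> chart (Upiece (pred8 i)) (Y t').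
  move=> h; apply: U2; rewrite -[t'](subrK pi) cosDpi oppr_lt0.
  by apply: cos_gt0_pihalf; lra.
have S2 (t' : R) : pi / 4 <= t' <= 3 * pi / 4 -> 0 < sin t'.
  by move=> h; apply: sin_gt0_pi; lra.
have S4 (t' : R) : 5 * pi / 4 <= t' <= 7 * pi / 4 -> sin t' < 0.
  move=> h; rewrite -[t'](subrK pi) sinDpi oppr_lt0.
  by apply: sin_gt0_pi; lra.
have gVU k l : (k < 8)%N -> (l < 8)%N -> g (Vpiece l) (Upiece k) = (edge g k l)^-1%g.
  move=> k8 l8; have [y [y1 y2]] := UV_point x0 k8 l8.
  exact: (cocycleV gP y2 y1).
case: e1 => e1.
  have [||||||||||//|k H] := @hol_four R T piece chart chart_of G g chart_ofP gP Y
    (Upiece i) (Vpiece j) (Upiece (pred8 i)) (Vpiece (pred8 j)) (pi / 4) (3 * pi / 4)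
    (5 * pi / 4) (7 * pi / 4) (2 * pi); try lra; try done.
  - by move=> t' h; apply: V1; rewrite e1 mul1r; exact: S2.
  - by move=> t' h; apply: V2; rewrite e1 mul1r; exact: S4.
  by exists k; left; move: H; rewrite !gVU.
have [||||||||||//|k H] := @hol_four R T piece chart chart_of G g chart_ofP gP Y
  (Upiece i) (Vpiece (pred8 j)) (Upiece (pred8 i)) (Vpiece j) (pi / 4) (3 * pi / 4)
  (5 * pi / 4) (7 * pi / 4) (2 * pi); try lra; try done.
- by move=> t' h; apply: V2; rewrite e1 mulN1r sinN oppr_lt0; exact: S2.
- by move=> t' h; apply: V1; rewrite e1 mulN1r sinN oppr_gt0; exact: S4.
exists k; right; move: H; rewrite !gVU //.
by rewrite /W !invgM !invgK !mulgA.
Qed.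

Definition conj_gen (i : nat) (m : pi1) : Prop :=
  exists c, m = (grid_gen x0 i ^ c)%g \/ m = ((grid_gen x0 i)^-1 ^ c)%g.

Lemma conj_gen_conj i m c : conj_gen i (m ^ c)%g <-> conj_gen i m.
Proof.
split=> -[d [H|H]].
- by exists (d * c^-1)%g; left; rewrite conjgM -H conjgK.
- by exists (d * c^-1)%g; right; rewrite conjgM -H conjgK.
- by exists (d * c)%g; left; rewrite conjgM H.
- by exists (d * c)%g; right; rewrite conjgM H.
Qed.

(** A mark switches the activity of its column, so in [edge_loop] one of the two jumps is the
    generator and the other is 1. *)
Lemma corner_conj_gen i j : (i < 8)%N -> (j < 8)%N -> mark i j ->
  let g := grid_overlap x0 in
  let W := (edge g i j * (edge g (pred8 i) j)^-1 *
    edge g (pred8 i) (pred8 j) * (edge g i (pred8 j))^-1)%g in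
  conj_gen i W /\ conj_gen i W^-1%g.
Proof.
move=> i8 j8 ij g W; rewrite /W edge_loop -conjVg !grid_jump ?pred8_lt //.
rewrite !conj_gen_conj /letter (active_mark i8 j8 ij).
case: (active i (pred8 j)) => /=; rewrite !(invg1, mul1g, mulg1, invgK).
  by split; exists 1%g; rewrite !conjg1; [left|right].
by split; exists 1%g; rewrite !conjg1; [right|left].
Qed.

(** The disc of a meridian can be large, and its boundary need not stay in the four pieces around
    the arc. As the disc meets the knot only in its centre, the circle can be shrunk to a thin
    one. *)
Lemma link_circle_class i j t phi e eps (y : T) (c : pathI y y) (b : pathI x0 y) :
  (i < 8)%N -> (j < 8)%N -> mark i j -> 0 < t < pi / 2 -> e = 1 \/ e = -1 ->
  0 < eps -> (forall s a, 0 < s <= eps -> ~ K (link_circle i j t s a)) ->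
  (forall tau : I, set_val (c tau) =
     link_circle i j t eps (phi + e * (2 * pi * coord tau))) ->
  conj_gen i (homotopy_class (path_cat (path_cat b c) (path_rev b))).
Proof.
move=> i8 j8 ij t0 e1 eps0 avoid cE.
have [s0 /andP[s00 s02] s0P] := thin_ex t0.
pose s1 := Num.min s0 eps.
have [s1s s1e] : s1 <= s0 /\ s1 <= eps by rewrite !ge_min !lexx orbT.
have s1pos : 0 < s1 by rewrite lt_min s00.
have ts1 : thin t s1 by apply: s0P; rewrite s1pos.
(* Clamped time, which extends the homotopy to the whole plane. The radius moves from [eps] to [s1]
   and the phase from [phi] to 0. *)
pose ll (x : R) := coord (clip x).
have ll01 x : 0 <= ll x <= 1 by exact: coord_itv.
pose S x := (1 - ll x) * eps + ll x * s1.
pose Psi x tau := (1 - ll x) * phi + e * (2 * pi * tau).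
have S0 x : 0 < S x <= eps by have := ll01 x; rewrite /S; nra.
pose q (z : R * R) := link_circle i j t (S z.1) (Psi z.1 z.2).
pose H x tau := to_complement x0 (q (x, tau)).
have qY z := complement_id (sumsq_link_circle i j t (S z.1) (Psi z.1 z.2))
  (avoid _ _ (S0 z.1)).
have lcts : continuous ll by exact: comp_cts (@clip_continuous R) (@coord_continuous R).
have l1cts : continuous (fun z : R * R => ll z.1).
  exact: comp_cts (@fst_cts _ _) lcts.
have o1cts := onem_cts l1cts.
have Scts : continuous (fun z : R * R => S z.1).
  by move=> z; apply: cvgD; apply: cvgM; try exact: cvg_cst; [exact: o1cts|exact: l1cts].
have Pcts : continuous (fun z : R * R => Psi z.1 z.2).
  move=> z; apply: cvgD; apply: cvgM; try exact: cvg_cst; first exact: o1cts.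
  by apply: cvgM; [exact: cvg_cst|exact: snd_cts].
have cq : continuous q by exact: link_circle_cts.
have cH : continuous (fun z : R * R => H z.1 z.2).
  rewrite (_ : (fun z => _) = fun z => to_complement x0 (q z)); last first.
    by apply/funext => -[].
  apply: to_complement_cts => // z; last by case: (qY z).
  by rewrite sumsq_link_circle.
have cH1 tau : continuous (fun x : I => H (coord x) tau).
  have cp : continuous (fun x : I => (coord x, tau)).
    by apply: pair_cts; [exact: coord_continuous|exact: cst_continuous].
  exact: (comp_cts cp cH).
have cH2 x : continuous (fun tau : I => H x (coord tau)).
  have cp : continuous (fun tau : I => (x, coord tau)).
    by apply: pair_cts; [exact: cst_continuous|exact: coord_continuous].
  exact: (comp_cts cp cH).
have periodic x : H x 1 = H x 0.
  rewrite /H /q /=; congr (to_complement _ _); rewrite /Psi mulr1 !mulr0 addr0.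
  set a := (_ * phi).
  by rewrite /link_circle; have [-> ->] := trig_period a e1.
have [ll0 ll1] : ll 0 = 0 /\ ll 1 = 1 by rewrite /ll !clipK // ?lexx ?ler01.
have gP := grid_overlapP x0; set g := grid_overlap x0 in gP.
have sq := @path_hol_square R T piece chart chart_of chart_open chart_ofP pi1 g gP H
  c (fun tau => H 1 (coord tau)) (fun x => H (coord x) 0) (fun x => H (coord x) 1) cH
  (@path_cts _ _ _ _ c) (cH2 1) (cH1 0) (cH1 1).
have {}sq : (path_hol chart chart_of g (fun x => H (coord x) 0%R) *
    path_hol chart chart_of g (fun tau => H 1%R (coord tau)) =
    path_hol chart chart_of g c *
    path_hol chart chart_of g (fun x => H (coord x) 1%R))%g.
  apply: sq => t' t01; rewrite ?clipK //.
  apply: val_inj; have [_ E] := qY (0, t'); rewrite -[LHS]/(set_val _) E.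
  rewrite -[RHS]/(set_val _) cE clipK // /S /Psi /= ll0.
  by congr link_circle; ring.
(* The start point moves during the homotopy; by periodicity both vertical sides are the same path,
   so its holonomy [v] conjugates one circle into the other. *)
have E01 : (fun x : I => H (coord x) 1) = (fun x => H (coord x) 0).
  by apply/funext => x; exact: periodic.
rewrite E01 in sq; set v := path_hol _ _ _ (fun x => _) in sq.
have [z zP] := loop_hol_overlap chart_open chart_ofP (chart_joined x0)
  (chart_unique x0) (base_path x0).
apply/(conj_gen_conj _ _ z); rewrite -zP (loop_hol_class chart_open chart_ofP gP).
rewrite !(path_hol_cat chart_open chart_ofP gP) (path_hol_rev chart_open chart_ofP gP).
set b' := path_hol _ _ _ b.
have -> : path_hol chart chart_of (overlap chart (base_path x0)) c =
    (path_hol chart chart_of g (fun tau => H 1%R (coord tau)) ^ v^-1)%g.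
  by rewrite /conjg invgK mulgA sq mulgK.
rewrite -{1}[b']invgK -mulgA -[(b'^-1^-1 * _)%g]/(_ ^ b'^-1)%g.
apply/conj_gen_conj/conj_gen_conj.
have [k /= HW] := link_circle_hol gP i8 j8 ts1 e1.
set W := (_ * _)%g in HW.
have WE h : hol chart chart_of g
    (fun psi => to_complement x0 (link_circle i j t s1 (e * psi))) 0 (2 * pi) h ->
    path_hol chart chart_of g (fun tau => H 1 (coord tau)) = h.
  move=> Hh; apply: (path_hol_eq chart_open chart_ofP gP (cH2 1)).
  apply: (@hol_affine _ _ _ _ _ _ _ (fun psi =>
    to_complement x0 (link_circle i j t s1 (e * psi))) _ (2 * pi) 0).
  - exact: mulr_gt0 (ltr0Sn _ 1) (pi_gt0 R).
  - move=> t' t01; rewrite /= clipK // /H /q /S /Psi /= ll1.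
    by rewrite addr0 subrr !mul0r !add0r mul1r.
  - by rewrite mulr0 mulr1 !addr0.
have {}WE : path_hol chart chart_of g (fun tau => H 1 (coord tau)) = (W ^ k)%g \/
    path_hol chart chart_of g (fun tau => H 1 (coord tau)) = (W^-1 ^ k)%g.
  by case: HW => /WE ->; [left|right].
have WV : conj_gen i W /\ conj_gen i W^-1%g := corner_conj_gen i8 j8 ij.
by case: WE => ->; apply/conj_gen_conj; case: WV.
Qed.

Lemma positive_meridian_conj_gen (m : pi1) : positive_meridian x0 m ->
  exists2 i, (i < 8)%N & conj_gen i m.
Proof.
case=> p [v [u [w [eps [y [c [b [[pv fr] /andP[eps0 epsp] disc cE ->]]]]]]]].
have [i [j [t [phi [e [[i8 j8 ij t0 e1] dE]]]]]] := disc_point_circle pv fr.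
have avoid s a : 0 < s <= eps -> ~ K (link_circle i j t s a).
  move=> /andP[s0 se].
  have ee : e * e = 1 by case: e1 => ->; rewrite ?mulrNN mul1r.
  have -> : a = phi + e * (e * (a - phi)) by rewrite mulrA ee; ring.
  by rewrite -dE => /disc; rewrite (ltW s0) se => /(_ isT) h; rewrite h ltxx in s0.
exists i => //; apply: (@link_circle_class i j t phi e eps y c b) => // tau.
by rewrite cE dE.
Qed.

(** An orthogonal matrix has determinant 1 or -1, and replacing [w] by [- w] changes the sign. *)
Lemma frame_of_dots (p v u w : 'rV[R]_4) :
  [/\ dot4 p p = 1, dot4 v v = 1, dot4 u u = 1 & dot4 w w = 1] ->
  [/\ dot4 p v = 0, dot4 p u = 0 & dot4 p w = 0] ->
  [/\ dot4 v u = 0, dot4 v w = 0 & dot4 u w = 0] ->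
  oriented_frame p v u w \/ oriented_frame p v u (- w).
Proof.
move=> [pp vv uu ww] [pv pu pw] [vu vw uw].
have dC a b : dot4 a b = dot4 b a :> R by rewrite /dot4; ring.
pose F w' : 'M[R]_4 := \matrix_(i < 4) ([:: p; v; u; w']`_i).
have FF w' : dot4 w' w' = 1 -> dot4 p w' = 0 -> dot4 v w' = 0 -> dot4 u w' = 0 ->
    F w' *m (F w')^T = 1%:M.
  move=> ww' pw' vw' uw'; apply/matrixP => k l.
  have -> : (F w' *m (F w')^T) k l = dot4 ([:: p; v; u; w']`_k) ([:: p; v; u; w']`_l).
    rewrite !mxE !big_ord_recl big_ord0 addr0 !mxE /dot4 /c0 /c1 /c2 /c3 !addrA.
    by do ![congr (_ + _)]; congr (_ * _); congr (_ 0 _); apply: val_inj.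
  rewrite mxE; case: k => -[|[|[|[|//]]]] k4; case: l => -[|[|[|[|//]]]] l4 /=;
    by rewrite ?pp ?vv ?uu ?ww' ?pv ?pu ?pw' ?vu ?vw' ?uw' // dC.
have FN : \det (F (- w)) = - \det (F w).
  have h1 : row (@o4 3 isT) (F (- w)) = -1 *: row (@o4 3 isT) (F w) +
      0 *: row (@o4 3 isT) (F w).
    by rewrite scale0r addr0 scaleN1r; apply/rowP => k; rewrite !mxE /= ?mxE.
  have h2 : row' (@o4 3 isT) (F w) = row' (@o4 3 isT) (F (- w)).
    apply/matrixP => k l; rewrite !mxE; congr (fun_of_matrix _ 0 l).
    by case: k => -[|[|[|//]]] k4.
  by rewrite (determinant_multilinear h1 h2 h2) mul0r addr0 mulN1r.
have F1 : F w *m (F w)^T = 1%:M by exact: FF.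
have F2 : F (- w) *m (F (- w))^T = 1%:M.
  apply: FF.
  - by rewrite dot4N dC dot4N opprK.
  - by rewrite dC dot4N dC pw oppr0.
  - by rewrite dC dot4N dC vw oppr0.
  - by rewrite dC dot4N dC uw oppr0.
have : \det (F w) ^+ 2 = 1 by rewrite -[RHS](det1 R 4) -F1 det_mulmx det_tr expr2.
move/eqP; rewrite sqrf_eq1 => /orP[]/eqP d; [left|right]; split=> //.
by rewrite FN d opprK.
Qed.

(** With the multiplicativity of [path_class], this lets homotopies between composite loops be
    proved by computing in the group. *)
Lemma path_class_inj (f f' : pathI x0 x0) :
  path_class (base_path x0) f = path_class (base_path x0) f' ->
  homotopy_class f = homotopy_class f'.
Proof. by rewrite !path_class_loop => /mulIg/mulgI. Qed.

Lemma path_class_rev x y (f : pathI x y) :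
  path_class (base_path x0) (path_rev f) = (path_class (base_path x0) f)^-1%g.
Proof.
have c1 z : path_class (base_path x0) (path_cst z : pathI z z) = 1%g.
  apply: (mulgI (path_class (base_path x0) (path_cst z : pathI z z))).
  by rewrite -path_class_cat mulg1; apply: path_class_homotopic; exact: path_cat_cst.
apply: (mulIg (path_class (base_path x0) f)); rewrite -path_class_cat mulVg -(c1 y).
by apply: path_class_homotopic; exact: path_rev_cat.
Qed.

Lemma positive_meridianJ (m c : pi1) : positive_meridian x0 m ->
  positive_meridian x0 (m ^ c)%g.
Proof.
case=> p [v [u [w [eps [y [l [b [h1 h2 h3 h4 ->]]]]]]]].
have [f ->] := homotopy_class_surj c.
exists p, v, u, w, eps, y, l, (path_cat (path_rev f) b); split=> //.
rewrite /conjg [X in (X * _)%g]homotopy_class_rev.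
rewrite [X in (_ * X)%g]homotopy_class_cat [LHS]homotopy_class_cat.
apply: path_class_inj; rewrite !path_class_cat !path_class_rev !path_class_cat path_class_rev.
by rewrite !invgM !invgK !mulgA.
Qed.

(** A thin circle around the midpoint of an arc of column [i] is a positive meridian for one of the
    two frames. Its class is a conjugate of the generator or of its inverse, and conjugating back
    leaves the stated alternative. *)
Lemma gen_positive_meridian i : (i < 8)%N ->
  positive_meridian x0 (grid_gen x0 i) \/ positive_meridian x0 (grid_gen x0 i)^-1%g.
Proof.
move=> i8; pose j := nth 0%N O_9_42 i; have p0 := pi_gt0 R.
have j8 : (j < 8)%N by rewrite /j; move: (i) i8; apply: lt8_ind.
have ij : mark i j by rewrite /mark eqxx orbT.
pose t : R := pi / 4; have t0 : 0 < t < pi / 2 by rewrite /t; lra.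
pose p := grid_arc X_9_42 i j t; pose v := grid_arc_tangent X_9_42 i j t.
pose u := first_circle (grid_angle R X_9_42 i + pi / 2).
pose w := second_circle (grid_angle R X_9_42 j + pi / 2).
have [s0 /andP[s00 s02] s0P] := thin_ex t0.
suff [m [mP mi]] : exists m, positive_meridian x0 m /\ conj_gen i m.
  case: mi => c [] mE; [left|right]; have := positive_meridianJ c^-1%g mP;
    by rewrite mE conjgK.
have [w' [e [e1 fr wE]]] : exists w' e, [/\ e = 1 \/ e = -1, oriented_frame p v u w' &
    w' = e *: w].
  have D := cos2Dsin2; set th := grid_angle R X_9_42 i; set th' := grid_angle R X_9_42 j.
  have ts := D _ t; have h1 := D _ th; have h2 := D _ th'.
  case: (@frame_of_dots p v u w).
  - split; rewrite /dot4 /c0 /c1 /c2 /c3 !mxE /= -/th -/th' ?cosDpihalf ?sinDpihalf.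
    + transitivity (cos t ^+ 2 * (cos th ^+ 2 + sin th ^+ 2) +
        sin t ^+ 2 * (cos th' ^+ 2 + sin th' ^+ 2)); first by ring.
      by rewrite h1 h2 !mulr1.
    + transitivity (sin t ^+ 2 * (cos th ^+ 2 + sin th ^+ 2) +
        cos t ^+ 2 * (cos th' ^+ 2 + sin th' ^+ 2)); first by ring.
      by rewrite h1 h2 !mulr1 addrC.
    + by transitivity (cos th ^+ 2 + sin th ^+ 2); [ring|].
    + by transitivity (cos th' ^+ 2 + sin th' ^+ 2); [ring|].
  - split; rewrite /dot4 /c0 /c1 /c2 /c3 !mxE /= -/th -/th' ?cosDpihalf ?sinDpihalf;
      try ring.
    transitivity (cos t * sin t * ((cos th' ^+ 2 + sin th' ^+ 2) -
      (cos th ^+ 2 + sin th ^+ 2))); first by ring.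
    by rewrite h1 h2 subrr mulr0.
  - split; rewrite /dot4 /c0 /c1 /c2 /c3 !mxE /= -/th -/th' ?cosDpihalf ?sinDpihalf;
      by ring.
  - by move=> fr; exists w, 1; split; [left| |rewrite scale1r].
  - by move=> fr; exists (- w), (-1); split; [right| |rewrite scaleN1r].
have dE s a : disc_point p u w' s a = link_circle i j t s (0 + e * a).
  rewrite /disc_point /link_circle wE add0r scalerA; congr (_ + _ *: (_ *: _ + _ *: _)).
    by case: e1 => ->; rewrite ?mul1r ?mulN1r ?cosN.
  by case: e1 => ->; rewrite ?mul1r ?mulN1r ?mulr1 ?mulrN1 ?sinN.
have avoid s a : 0 < s <= s0 -> ~ K (link_circle i j t s a).
  by move=> /s0P; exact: link_circle_avoid.
pose q (tau : I) := link_circle i j t s0 (0 + e * (2 * pi * coord tau)).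
have qY tau := complement_id (sumsq_link_circle i j t s0 (0 + e * (2 * pi * coord tau)))
  (@avoid s0 (0 + e * (2 * pi * coord tau)) (introT andP (conj s00 (lexx s0)))).
pose y := to_complement x0 (q zero).
have cq : continuous (fun tau => to_complement x0 (q tau)).
  apply: to_complement_cts => [|tau|tau]; [|by rewrite sumsq_link_circle|by case: (qY tau)].
  apply: link_circle_cts; first exact: cst_continuous.
  have -> : (fun tau : I => 0 + e * (2 * pi * coord tau)) =
      (fun tau => e * (2 * pi) * coord tau + 0).
    by apply/funext => tau; rewrite addr0 add0r mulrA.
  exact: (affine_cts (@coord_continuous R)).
have q1 : to_complement x0 (q one) = y.
  congr (to_complement _ _); rewrite /q coord0 coord1 /link_circle !mulr0 mulr1 !add0r.
  by rewrite -[e * _]add0r; have [-> ->] := trig_period 0 e1.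
pose c : pathI y y := mk_path cq erefl q1.
have cE tau : set_val (c tau) = link_circle i j t s0 (0 + e * (2 * pi * coord tau)).
  by case: (qY tau).
exists (homotopy_class (path_cat (path_cat (base_path x0 y) c) (path_rev (base_path x0 y)))).
split; last exact: (link_circle_class (base_path x0 y) i8 j8 ij t0 e1 s00 avoid cE).
exists p, v, u, w', s0, y, c, (base_path x0 y); split=> //.
- by split=> //; exists i, t; split=> //; left.
- by rewrite s00 /=; lra.
- move=> s a /andP[]; rewrite le_eqVlt => /predU1P[->//|sp] ss.
  by rewrite dE => /avoid h; case: h; rewrite sp.
- by move=> tau; rewrite cE dE.
Qed.

End Meridians.

(** * Solving the row relations in terms of two elements *)

Ltac free_reduce :=
  rewrite ?(invgM, invgK, mulgA); rewrite ?(mulgK, mulgVK, mulgV, mulVg, mul1g, mulg1).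

Section WordSolutions.
Context {G : groupType}.

(* The generators expressed through b = x_1 and g = x_0 x_1 x_2. *)
Definition meridian_word (b g : G) (i : nat) : G :=
  let c := (g * b * g^-1)%g in let d := (g * c * g^-1)%g in let k := (b * c)%g in
  nth 1%g [:: g * k^-1; b; c; d; k^-1 * g; (g * k^-1)^-1; d^-1 * c^-1 * d; d^-1]%g i.

(** Row 4 after the substitution, with factors moved across so that both sides remain products of
    low degree. *)
Definition word_relation (b g : G) : Prop :=
  let k := (b * (g * b * g^-1))%g in
  (k * (g * g) * b = g * k * ((g * g)^-1 * (k * (g * g))))%g.

Lemma mulgV1_eq (x y : G) : (x * y^-1 = 1)%g -> x = y.
Proof. by move=> xy; rewrite -[x](mulgVK y) xy mul1g. Qed.

(** Rows 0, 6 and 5 give [x_5], [x_7] and [x_6]. Row 2 yields the second expression [c * d * a] of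
    [g], which with row 1 shows that conjugation by [g] takes [b] to [c] and [c] to [d]. Row 3 gives
    [x_4], and row 4 remains as the relation. *)
Lemma grid_relations_word (x : nat -> G) : grid_relations x ->
  let b := x 1%N in let g := (x 0%N * x 1%N * x 2)%g in
  word_relation b g /\ forall i, (i < 8)%N -> x i = meridian_word b g i.
Proof.
move=> xP.
have r0 := xP 0%N isT; have r1 := xP 1%N isT; have r2 := xP 2%N isT.
have r3 := xP 3%N isT; have r4 := xP 4%N isT; have r5 := xP 5%N isT.
have r6 := xP 6%N isT; move: r0 r1 r2 r3 r4 r5 r6 {xP}.
rewrite /= /letter /active /lo /hi /= !(mul1g, mulg1).
set a := x 0%N; set b := x 1%N; set c := x 2; set d := x 3.
set x4 := x 4; set x5 := x 5; set x6 := x 6; set x7 := x 7.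
move=> r0 r1 r2 r3 r4 r5 r6; set g := (a * b * c)%g.
have e5 : x5 = a^-1%g by rewrite (mulg1_eq r0).
have e7 : x7 = d^-1%g by rewrite (mulg1_eq r6).
have e6 : x6 = (d^-1 * c^-1 * d)%g.
  apply: mulgV1_eq; transitivity ((c * d)^-1 * (c * d * x6 * x7) * (c * d))%g.
    by rewrite e7; free_reduce.
  by rewrite r5; free_reduce.
have gE : g = (c * d * a)%g.
  apply: mulgV1_eq; transitivity (a * b * c * x5 * x6 * x7)%g => //.
  by rewrite e5 e6 e7 /g; free_reduce.
have abE : (d^-1 * c * d * a * b^-1 * a^-1 = 1)%g.
  transitivity (a * b * x5 * x6)^-1%g; last by rewrite r1 invg1.
  by rewrite e5 e6; free_reduce.
have e4 : x4 = ((b * c)^-1 * g)%g.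
  apply: mulgV1_eq; transitivity ((b * c)^-1 * (b * c * x4 * x5 * x6 * x7) * (b * c))%g.
    by rewrite gE e5 e6 e7; free_reduce.
  by rewrite r3; free_reduce.
have cE : c = (g * b * g^-1)%g.
  apply: mulgV1_eq; transitivity (c * d * (d^-1 * c * d * a * b^-1 * a^-1) * (c * d)^-1)%g.
    by rewrite gE; free_reduce.
  by rewrite abE; free_reduce.
have aE : a = (g * (b * c)^-1)%g by rewrite /g; free_reduce.
have dE : d = (g * c * g^-1)%g.
  have d1 : d = (c^-1 * g * a^-1)%g by rewrite gE; free_reduce.
  have c1 : (c^-1 * g * b = g)%g by rewrite [in (c^-1)%g]cE; free_reduce.
  transitivity (c^-1 * g * b * c * g^-1)%g; last by rewrite c1.
  by rewrite {1}d1 aE; free_reduce.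
split; last first.
  rewrite /meridian_word -!cE -!dE -aE.
  by apply: lt8_ind.
rewrite /word_relation -cE; set k := (b * c)%g.
have cd : (c * d = g * k * g^-1)%g.
  transitivity ((g * b * g^-1) * (g * c * g^-1))%g; first by rewrite -cE -dE.
  by rewrite /k; free_reduce.
have d2 : d = (g * g * b * (g * g)^-1)%g by rewrite dE cE; free_reduce.
apply: mulgV1_eq; transitivity (b * c * d * x4 * x6 * x7)%g => //.
transitivity (k * d * k^-1 * g * (c * d)^-1)%g.
  by rewrite cd d2; free_reduce.
by rewrite e4 e6 e7 /k; free_reduce.
Qed.

(** All rows but row 4 become identities of the free group on [b] and [g]. *)
Lemma word_grid_relations (b g : G) : word_relation b g ->
  grid_relations (meridian_word b g).
Proof.
rewrite /word_relation /grid_relations /= /letter /meridian_word => rel.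
apply: lt8_ind; rewrite /active /lo /hi /= ?(mul1g, mulg1).
- by free_reduce.
- by free_reduce.
- by free_reduce.
- by free_reduce.
- move: rel; set k := (b * _)%g => rel; have {}rel := congr1 (fun z =>
    z * (g * k * ((g * g)^-1 * (k * (g * g))))^-1)%g rel.
  rewrite /= mulgV in rel; rewrite -[RHS]rel /k.
  by free_reduce.
- by free_reduce.
- by free_reduce.
- by [].
Qed.

Lemma meridian_wordJ (b g q : G) i : (i < 8)%N ->
  meridian_word (b ^ q)%g (g ^ q)%g i = (meridian_word b g i ^ q)%g.
Proof.
by move: i; apply: lt8_ind; rewrite /meridian_word /= ?(conjMg, conjVg).
Qed.

Lemma word_relationJ (b g q : G) : word_relation (b ^ q)%g (g ^ q)%g <-> word_relation b g.
Proof.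
have E (x y p : G) : word_relation x y -> word_relation (x ^ p)%g (y ^ p)%g.
  by rewrite /word_relation /= => /(congr1 (fun z => z ^ p)%g); rewrite !(conjMg, conjVg).
by split=> [/(E _ _ q^-1%g)|]; [rewrite !conjgK|exact: E].
Qed.

Lemma meridian_word_closed (X : Type) (P : (X -> G) -> Prop) (b g : X -> G) :
  (forall u v, P u -> P v -> P (fun x => u x * v x)%g) ->
  (forall u, P u -> P (fun x => (u x)^-1)%g) ->
  P b -> P g -> forall i, (i < 8)%N -> P (fun x => meridian_word (b x) (g x) i).
Proof.
move=> PM PV Pb Pg.
have Pc := PM _ _ (PM _ _ Pg Pb) (PV _ Pg); have Pd := PM _ _ (PM _ _ Pg Pc) (PV _ Pg).
have Pk := PM _ _ Pb Pc; have Pa := PM _ _ Pg (PV _ Pk).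
apply: lt8_ind => //.
- exact: PM _ _ (PV _ Pk) Pg.
- exact: PV _ Pa.
- exact: PM _ _ (PM _ _ (PV _ Pd) (PV _ Pc)) Pd.
- exact: PV _ Pd.
Qed.

(** Each word is a conjugate of [b], of the word of [x_0], or of an inverse of these; for instance
    [x_4] is [x_0] conjugated by [b * c]. *)
Lemma meridian_word_conj (P : G -> Prop) (b g : G) :
  (forall x y, P x -> P (x ^ y)%g) -> (forall x, P x -> P x^-1%g) ->
  P b -> P (meridian_word b g 0) -> forall i, (i < 8)%N -> P (meridian_word b g i).
Proof.
move=> PJ PV Pb Pa.
have Pc : P (g * b * g^-1)%g by have := PJ _ g^-1%g Pb; rewrite /conjg invgK mulgA.
have Pd : P (g * (g * b * g^-1) * g^-1)%g.
  by have := PJ _ g^-1%g Pc; rewrite /conjg invgK !mulgA.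
apply: lt8_ind => //; rewrite /meridian_word /=.
- by have := PJ _ (b * (g * b * g^-1))%g Pa; rewrite /meridian_word /= /conjg mulgVK.
- exact: PV.
- have := PJ _ (g * (g * b * g^-1) * g^-1)%g (PV _ Pc).
  by rewrite /conjg !mulgA.
- exact: PV.
Qed.

Lemma meridian_word_product (b g : G) :
  (meridian_word b g 0 * meridian_word b g 1 * meridian_word b g 2 = g)%g.
Proof. by rewrite /meridian_word /=; free_reduce. Qed.

(** The abelian representations: for [g = b] every generator is [b] or its inverse. *)
Lemma word_relation_diagonal (b : G) :
  word_relation b b /\ (meridian_word b b 0 = b^-1)%g.
Proof. by rewrite /word_relation /meridian_word /=; split; free_reduce. Qed.

End WordSolutions.

(** * SU(2) as the group of unit quaternions *)

Section Quaternions.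
Context {R : realType}.

Record quat := Quat { qre : R; qi : R; qj : R; qk : R }.

Definition qmul (p q : quat) : quat :=
  let: Quat a b c d := p in let: Quat e f g h := q in
  Quat (a * e - b * f - c * g - d * h) (a * f + b * e + c * h - d * g)
       (a * g - b * h + c * e + d * f) (a * h + b * g - c * f + d * e).

Definition qconj (p : quat) : quat := Quat (qre p) (- qi p) (- qj p) (- qk p).

Definition qnorm (p : quat) : R := qre p ^+ 2 + qi p ^+ 2 + qj p ^+ 2 + qk p ^+ 2.

Definition quat_mx (p : quat) : 'M[Cplx R]_2 := \matrix_(i, j)
  if i == 0 then if j == 0 then Complex (qre p) (qi p) else Complex (qj p) (qk p)
  else if j == 0 then Complex (- qj p) (qk p) else Complex (qre p) (- qi p).

(** Only the first row is read: for a unitary matrix of determinant 1 it determines the second, as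
    [SU2_shape] shows. *)
Definition quat_of (A : SU2 R) : quat :=
  Quat (complex.Re (SU2_mx A 0 0)) (complex.Im (SU2_mx A 0 0))
       (complex.Re (SU2_mx A 0 1)) (complex.Im (SU2_mx A 0 1)).

Lemma sum2 (V : nmodType) (F : 'I_2 -> V) : \sum_i F i = F 0 + F 1.
Proof.
rewrite !big_ord_recl big_ord0 addr0; congr (_ + F _); exact: val_inj.
Qed.

Lemma mx2P (K : Type) (A B : 'M[K]_2) : A 0 0 = B 0 0 -> A 0 1 = B 0 1 ->
  A 1 0 = B 1 0 -> A 1 1 = B 1 1 -> A = B.
Proof.
move=> h1 h2 h3 h4; apply/matrixP => i j.
have E (k : 'I_2) : k = 0 \/ k = 1.
  by case: k => -[|[|//]] h; [left|right]; apply: val_inj.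
by case: (E i) => ->; case: (E j) => ->.
Qed.

Lemma det2 (K : comNzRingType) (A : 'M[K]_2) :
  \det A = A 0 0 * A 1 1 - A 0 1 * A 1 0.
Proof.
rewrite (expand_det_row _ 0) sum2 /cofactor !det_mx11 !mxE /= expr0 expr1 mul1r.
rewrite mulN1r mulrN; congr (_ * A _ _ - _ * A _ _); exact: val_inj.
Qed.

Lemma unitary_entries (K : comNzRingType) (a b c d a' b' : K) :
  a * a' + b * b' = 1 -> c * a' + d * b' = 0 -> a * d - b * c = 1 ->
  d = a' /\ c = - b'.
Proof.
move=> h1 h2 h3; split.
  rewrite -[LHS]mulr1 -h1.
  transitivity (a' * (a * d - b * c) + b * (c * a' + d * b')); first by ring.
  by rewrite h2 h3 mulr1 mulr0 addr0.
rewrite -[LHS]mulr1 -h1.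
transitivity (- b' * (a * d - b * c) + a * (c * a' + d * b')); first by ring.
by rewrite h2 h3 mulr1 mulr0 addr0.
Qed.

Lemma SU2_shape (A : SU2 R) : SU2_mx A = quat_mx (quat_of A) /\ qnorm (quat_of A) = 1.
Proof.
have [/unitarymxP UA dA] := SU2_mxP A; rewrite det2 in dA.
have E (i j : 'I_2) : SU2_mx A i 0 * Num.conj (SU2_mx A j 0) +
    SU2_mx A i 1 * Num.conj (SU2_mx A j 1) = (i == j)%:R.
  by have /matrixP/(_ i j) := UA; rewrite !mxE sum2 !mxE.
have E00 := E 0 0; have E10 := E 1 0; rewrite /= in E00 E10.
have [h1 h2] := unitary_entries E00 E10 dA.
split.
  apply: mx2P; rewrite ?h1 ?h2 !mxE /quat_of /=.
  - by case: (SU2_mx A 0 0).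
  - by case: (SU2_mx A 0 1).
  - by case: (SU2_mx A 0 1) => u v; congr Complex; rewrite /= opprK.
  - by case: (SU2_mx A 0 0).
move: E00; rewrite /qnorm /quat_of /=.
case: (SU2_mx A 0 0) => u v; case: (SU2_mx A 0 1) => z w [E00 _] /=.
by rewrite -E00; ring.
Qed.

Lemma quat_of_mul (A B : SU2 R) : quat_of (A * B)%g = qmul (quat_of A) (quat_of B).
Proof.
have -> : quat_of (A * B)%g = Quat
    (complex.Re ((SU2_mx A *m SU2_mx B) 0 0)) (complex.Im ((SU2_mx A *m SU2_mx B) 0 0))
    (complex.Re ((SU2_mx A *m SU2_mx B) 0 1)) (complex.Im ((SU2_mx A *m SU2_mx B) 0 1)).
  by [].
rewrite !mxE !sum2 (SU2_shape A).1 (SU2_shape B).1 !mxE /=.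
case: (quat_of A) => a b c d; case: (quat_of B) => e f g h /=.
by congr Quat; ring.
Qed.

Lemma quat_of_inj : injective quat_of.
Proof.
by move=> A B AB; apply: SU2_mx_inj; rewrite (SU2_shape A).1 (SU2_shape B).1 AB.
Qed.

Lemma quat_mx_SU2 q : qnorm q = 1 -> SU2_set R (quat_mx q).
Proof.
case: q => a b c d; rewrite /qnorm /= => N; split.
  apply/unitarymxP; apply: mx2P; rewrite !mxE sum2 !mxE /=;
    apply/eqP; rewrite eq_complex /=; apply/andP; split; apply/eqP; try ring;
    by rewrite -N; ring.
rewrite det2 !mxE /=; apply/eqP; rewrite eq_complex /=; apply/andP; split; apply/eqP.
  by rewrite -N; ring.
by ring.
Qed.

Definition su2_of (q : quat) : SU2 R :=
  match pselect (qnorm q = 1) with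
  | left h => exist _ (quat_mx q) (mem_set (quat_mx_SU2 h))
  | right _ => 1%g
  end.

Lemma SU2_mx_su2_of q : qnorm q = 1 -> SU2_mx (su2_of q) = quat_mx q.
Proof. by rewrite /su2_of; case: pselect. Qed.

Lemma su2_ofK q : qnorm q = 1 -> quat_of (su2_of q) = q.
Proof. by move=> N; rewrite /quat_of SU2_mx_su2_of // !mxE /=; case: q {N}. Qed.

Lemma quat_ofK (A : SU2 R) : su2_of (quat_of A) = A.
Proof. by apply: quat_of_inj; rewrite su2_ofK //; case: (SU2_shape A). Qed.

Lemma quat_of1 : quat_of 1%g = Quat 1 0 0 0.
Proof. by rewrite /quat_of -[SU2_mx _]/(1%:M : 'M[Cplx R]_2) !mxE. Qed.

Lemma quat_ofV (A : SU2 R) : quat_of A^-1%g = qconj (quat_of A).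
Proof.
have NA := (SU2_shape A).2.
have NC : qnorm (qconj (quat_of A)) = 1 by rewrite -NA /qnorm /=; ring.
rewrite -[RHS]su2_ofK //; congr quat_of; apply/esym/(mulgI A)/quat_of_inj.
rewrite mulgV quat_of_mul su2_ofK // quat_of1; move: NA.
by case: (quat_of A) => a b c d; rewrite /qnorm /= => <-; congr Quat; ring.
Qed.

Lemma SU2_tracelessP (A : SU2 R) : SU2_traceless R A <-> qre (quat_of A) = 0.
Proof.
rewrite /SU2_traceless /= /mxtrace sum2 (SU2_shape A).1 !mxE /=.
case: (quat_of A) => a b c d /=; split=> [[+ _]|->]; first by lra.
by apply/eqP; rewrite eq_complex /= addr0 subrr !eqxx.
Qed.

Lemma tracelessJ (A B : SU2 R) : SU2_traceless R (A ^ B)%g <-> SU2_traceless R A.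
Proof.
rewrite !SU2_tracelessP /conjg !quat_of_mul quat_ofV.
have := (SU2_shape B).2; case: (quat_of A) => a b c d; case: (quat_of B) => e f g h.
rewrite /qnorm /= => N; rewrite (_ : _ - _ = a * (e ^+ 2 + f ^+ 2 + g ^+ 2 + h ^+ 2)).
  by rewrite N mulr1.
by ring.
Qed.

Lemma tracelessV (A : SU2 R) : SU2_traceless R A^-1%g <-> SU2_traceless R A.
Proof. by rewrite !SU2_tracelessP quat_ofV. Qed.

Lemma complex_cts (X : topologicalType) (f g : X -> R) : continuous f ->
  continuous g -> continuous (fun x => Complex (f x) (g x) : Cplx R).
Proof.
move=> cf cg x; apply/cvgrPdist_lt => e e0.
(* Norms and radii on [R[i]] are complex numbers; in its order, positivity includes being real. *)
have [er ei] : 0 < complex.Re e /\ complex.Im e = 0.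
  by move: e0; rewrite ltcE /= => /andP[/eqP ? ?].
have e2 : 0 < complex.Re e / 2 by rewrite divr_gt0.
near=> y.
have h : `|f x - f y| < complex.Re e / 2.
  by near: y; move/cvgrPdist_lt: (cf x); apply.
have h' : `|g x - g y| < complex.Re e / 2.
  by near: y; move/cvgrPdist_lt: (cg x); apply.
have -> : (Complex (f x) (g x) - Complex (f y) (g y) : Cplx R) =
    Complex (f x - f y) (g x - g y) by [].
rewrite normc_def /= ltcE /= ei eqxx /=.
have E : complex.Re e = Num.sqrt (complex.Re e ^+ 2) by rewrite sqrtr_sqr gtr0_norm.
rewrite E ltr_sqrt ?exprn_gt0 //.
move: h h'; rewrite !ltr_norml => /andP[? ?] /andP[? ?]; nra.
Unshelve. all: by end_near.
Qed.

Lemma mx_cts (X K : topologicalType) m n (f : X -> 'M[K]_(m, n)) :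
  (forall i j, continuous (fun x => f x i j)) -> continuous f.
Proof.
move=> cf x A [P Px PA].
have H : nbhs x (fun y => forall i j, P i j (f y i j)).
  by apply: filter_forall => i; apply: filter_forall => j; exact: cf (Px i j).
by apply: filterS H => y; exact: PA.
Qed.

Lemma su2_of_cts (X : topologicalType) (f : X -> quat) :
  continuous (fun x => qre (f x)) -> continuous (fun x => qi (f x)) ->
  continuous (fun x => qj (f x)) -> continuous (fun x => qk (f x)) ->
  (forall x, qnorm (f x) = 1) -> continuous (fun x => su2_of (f x)).
Proof.
move=> ca cb cc cd N; apply/continuous_comp_initial.
rewrite (_ : _ \o _ = fun x => quat_mx (f x)); last first.
  by apply/funext => x; exact: SU2_mx_su2_of.
have oppc (h : X -> R) : continuous h -> continuous (fun x => - h x).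
  by move=> ch x; apply: cvgN; exact: ch.
apply: mx_cts => i j; rewrite (_ : (fun x => _) = fun x =>
  if i == 0 then if j == 0 then Complex (qre (f x)) (qi (f x)) : Cplx R
    else Complex (qj (f x)) (qk (f x))
  else if j == 0 then Complex (- qj (f x)) (qk (f x))
    else Complex (qre (f x)) (- qi (f x))); last by apply/funext => x; rewrite mxE.
by case: (i == 0); case: (j == 0); apply: complex_cts => //; exact: oppc.
Qed.

End Quaternions.
Arguments quat R : clear implicits.

(** * Traceless solutions of the relation *)

Section Solutions.
Context {R : realType}.
Implicit Types (s x y : R) (B W Q : SU2 R).

(** Equality modulo the norm equation: [c] is the explicit quotient of [l - r] by [n - 1], and
    [ring] verifies it. *)
Lemma eq_mod1 (n l r c : R) : n = 1 -> l - r = c * (n - 1) -> l = r.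
Proof. by move=> ->; rewrite subrr mulr0 => /eqP; rewrite subr_eq0 => /eqP. Qed.

Lemma quat_eq (a b c d a' b' c' d' : R) : a = a' -> b = b' -> c = c' -> d = d' ->
  Quat a b c d = Quat a' b' c' d'.
Proof. by move=> -> -> -> ->. Qed.

(* For b = i and g = s + x i + y j the relation and the vanishing of the trace of
   x_0 become these polynomial equations. *)
Definition normal_solution s x y : Prop :=
  [/\ s ^+ 2 + x ^+ 2 + y ^+ 2 = 1, s * (4 * y ^+ 2 - 1) = 0 &
  [/\ 64 * s * x ^+ 4 * y ^+ 2 + 64 * s * x ^+ 2 * y ^+ 4 - 48 * s * x ^+ 2 * y ^+ 2
        + 4 * s * y ^+ 2 - s + 2 * s * x = 0,
      64 * x ^+ 5 * y ^+ 2 + 64 * x ^+ 3 * y ^+ 4 - 80 * x ^+ 3 * y ^+ 2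
        - 32 * x * y ^+ 4 + 28 * x * y ^+ 2 - x + 2 * x ^+ 2 - 1 = 0 &
      64 * x ^+ 4 * y ^+ 3 + 64 * x ^+ 2 * y ^+ 5 - 48 * x ^+ 2 * y ^+ 3
        - 8 * x ^+ 2 * y - 4 * y ^+ 3 + 3 * y - 2 * x * y = 0]].

Lemma normal_solutionP B W s x y : quat_of B = Quat 0 1 0 0 ->
  quat_of W = Quat s x y 0 ->
  (word_relation B W /\ SU2_traceless R (meridian_word B W 0)) <-> normal_solution s x y.
Proof.
move=> BE WE; have N : s ^+ 2 + x ^+ 2 + y ^+ 2 = 1.
  by have := (SU2_shape W).2; rewrite WE /qnorm /= => <-; ring.
have cE : quat_of (W * B * W^-1)%g =
    Quat 0 (1 - 2 * y ^+ 2) (2 * x * y) (- (2 * s * y)).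
  rewrite !quat_of_mul quat_ofV BE WE /qconj /=; apply: quat_eq; try ring.
  by apply: (eq_mod1 (c := 1) N); ring.
have kE : quat_of (B * (W * B * W^-1))%g =
    Quat (2 * y ^+ 2 - 1) 0 (2 * s * y) (2 * x * y).
  by rewrite quat_of_mul BE cE /=; apply: quat_eq; ring.
set k := (B * (W * B * W^-1))%g in kE.
have hE : quat_of (W * W)%g =
    Quat (1 - 2 * x ^+ 2 - 2 * y ^+ 2) (2 * s * x) (2 * s * y) 0.
  rewrite quat_of_mul WE /=; apply: quat_eq; try ring.
  by apply: (eq_mod1 (c := 1) N); ring.
have khE : quat_of (k * (W * W))%g =
    Quat (2 * x ^+ 2 - 1) (- (2 * s * x)) 0 (- (2 * x * y)).
  rewrite quat_of_mul kE hE /=; apply: quat_eq; try ring.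
    by apply: (eq_mod1 (c := - (4 * y ^+ 2)) N); ring.
  by apply: (eq_mod1 (c := - (4 * x * y)) N); ring.
have LE : quat_of (k * (W * W) * B)%g =
    Quat (2 * s * x) (2 * x ^+ 2 - 1) (- (2 * x * y)) 0.
  by rewrite quat_of_mul khE BE /=; apply: quat_eq; ring.
have mE : quat_of ((W * W)^-1 * (k * (W * W)))%g = Quat (2 * y ^+ 2 - 1)
    (8 * s * x * y ^+ 2) (- (8 * s * x ^+ 2 * y) + 2 * s * y)
    (8 * x ^+ 3 * y + 8 * x * y ^+ 3 - 6 * x * y).
  rewrite quat_of_mul quat_ofV khE hE /qconj /=; apply: quat_eq; try ring.
    by apply: (eq_mod1 (c := - (4 * x ^+ 2)) N); ring.
  by apply: (eq_mod1 (c := - (4 * x * y)) N); ring.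
have gkE : quat_of (W * k)%g =
    Quat (- s) (4 * x * y ^+ 2 - x) (y - 4 * x ^+ 2 * y) (4 * s * x * y).
  rewrite quat_of_mul kE WE /=; apply: quat_eq; try ring.
  by apply: (eq_mod1 (c := 2 * y) N); ring.
have RE : quat_of (W * k * ((W * W)^-1 * (k * (W * W))))%g = Quat
    (- (64 * s * x ^+ 4 * y ^+ 2) - 64 * s * x ^+ 2 * y ^+ 4 + 48 * s * x ^+ 2 * y ^+ 2
       - 4 * s * y ^+ 2 + s)
    (- (64 * x ^+ 5 * y ^+ 2) - 64 * x ^+ 3 * y ^+ 4 + 80 * x ^+ 3 * y ^+ 2
       + 32 * x * y ^+ 4 - 28 * x * y ^+ 2 + x)
    (- (64 * x ^+ 4 * y ^+ 3) - 64 * x ^+ 2 * y ^+ 5 + 48 * x ^+ 2 * y ^+ 3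
       + 8 * x ^+ 2 * y + 4 * y ^+ 3 - 3 * y) 0.
  rewrite quat_of_mul gkE mE /=; apply: quat_eq; try ring.
    by apply: (eq_mod1 (c := 32 * x ^+ 3 * y ^+ 2 - 16 * x * y ^+ 2) N); ring.
  by apply: (eq_mod1 (c := 32 * x ^+ 2 * y ^+ 3 + 8 * x ^+ 2 * y - 2 * y) N); ring.
have aE : SU2_traceless R (meridian_word B W 0) <-> s * (4 * y ^+ 2 - 1) = 0.
  have -> : meridian_word B W 0 = (W * k^-1)%g by [].
  rewrite SU2_tracelessP quat_of_mul quat_ofV kE WE /qconj /=.
  by rewrite (_ : _ - _ = s * (4 * y ^+ 2 - 1)) //; ring.
rewrite aE /normal_solution /word_relation -/k; split.
  case=> /(congr1 quat_of); rewrite LE RE => -[e1 e2 e3] ->; split=> //.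
  by split; [move: e1|move: e2|move: e3] => /eqP; rewrite -subr_eq0 => /eqP <-; ring.
case=> _ -> [e1 e2 e3]; split=> //; apply: quat_of_inj; rewrite LE RE.
by apply: quat_eq => //; apply/eqP; rewrite -subr_eq0; apply/eqP;
  [rewrite -[RHS]e1|rewrite -[RHS]e2|rewrite -[RHS]e3]; ring.
Qed.

(** For [s = 0], eliminating [y ^+ 2] leaves the cubic times [2 * x - 1], up to a factor [y];
    another equation excludes x = 1/2. For [s <> 0] the trace of [x_0] forces y = 1/2, and the
    quadratic carries all common roots of the remaining equations. *)
Lemma normal_solution_cases s x y : 0 <= y -> normal_solution s x y ->
  [\/ [/\ y = 0, s = 0 & x = 1],
      [/\ 0 < y, s = 0, x ^+ 2 + y ^+ 2 = 1 & 8 * x ^+ 3 + 4 * x ^+ 2 - 4 * x - 1 = 0] |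
      [/\ y = 2^-1, s ^+ 2 = 3 / 4 - x ^+ 2 & 4 * x ^+ 2 + 2 * x - 1 = 0]].
Proof.
move=> y0 [N T [E0 E1 E2]].
have [s0|s0] := eqVneq s 0.
  have Y2 : y ^+ 2 = 1 - x ^+ 2 by rewrite -N s0; ring.
  have F1 : 16 * x ^+ 5 - 20 * x ^+ 3 - 2 * x ^+ 2 + 5 * x + 1 = 0.
    rewrite -[RHS]oppr0 -[X in _ = - X]E1.
    rewrite (_ : y ^+ 4 = (y ^+ 2) ^+ 2); last by ring.
    by rewrite Y2; ring.
  have F2 : y * (16 * x ^+ 4 - 12 * x ^+ 2 + 2 * x + 1) = 0.
    rewrite -[RHS]oppr0 -[X in _ = - X]E2.
    rewrite (_ : y ^+ 5 = y * (y ^+ 2) ^+ 2); last by ring.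
    rewrite (_ : y ^+ 3 = y * y ^+ 2); last by ring.
    by rewrite Y2; ring.
  have [y1|y1] := eqVneq y 0.
    constructor 1; split=> //; move/eqP: Y2; rewrite y1 expr0n /= eq_sym subr_eq0.
    rewrite eq_sym sqrf_eq1 => /orP[]/eqP // x1; move: F1; rewrite x1; lra.
  constructor 2; split=> //; [by rewrite lt_def y1|by rewrite -N s0; ring|].
  move/eqP: F2; rewrite mulf_eq0 (negbTE y1) /= => /eqP F2.
  have /eqP : (8 * x ^+ 3 + 4 * x ^+ 2 - 4 * x - 1) * (2 * x - 1) = 0.
    by rewrite -[RHS]F2; ring.
  rewrite mulf_eq0 => /orP[/eqP //|/eqP x2].
  have {}x2 : x = 2^-1 by lra.
  by move: F1; rewrite x2; lra.
constructor 3.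
move/eqP: T; rewrite mulf_eq0 (negbTE s0) /= => /eqP y4.
have y2 : y = 2^-1.
  have /eqP : (y - 2^-1) * (y + 2^-1) = 0 by lra.
  by rewrite mulf_eq0 => /orP[]/eqP; lra.
split=> //; first by move: N; rewrite y2 => N; lra.
have F0 : x * ((4 * x ^+ 2 + 2 * x - 1) * (2 * x - 1)) = 0.
  have s20 : 2 * s != 0 by rewrite mulf_neq0 ?pnatr_eq0.
  by apply: (mulfI s20); rewrite mulr0 -[RHS]E0 y2; field.
have F2 : (4 * x ^+ 2 + 2 * x - 1) * ((2 * x + 1) * (x - 1)) = 0.
  by rewrite -[RHS]E2 y2; field.
move/eqP: F2; rewrite mulf_eq0 => /orP[/eqP //|].
rewrite mulf_eq0 => /orP[]/eqP h.
  have xE : x = - 2^-1 by lra.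
  by move: F0; rewrite xE; lra.
have xE : x = 1 by lra.
by move: F0; rewrite xE; lra.
Qed.

Lemma cubic_normal_solution x y : x ^+ 2 + y ^+ 2 = 1 ->
  8 * x ^+ 3 + 4 * x ^+ 2 - 4 * x - 1 = 0 -> normal_solution 0 x y.
Proof.
move=> N C; have Y2 : y ^+ 2 = 1 - x ^+ 2 by rewrite -N; ring.
have Y3 : y ^+ 3 = y * (1 - x ^+ 2) by rewrite -Y2; ring.
have Y4 : y ^+ 4 = (1 - x ^+ 2) ^+ 2 by rewrite -Y2; ring.
have Y5 : y ^+ 5 = y * (1 - x ^+ 2) ^+ 2 by rewrite -Y2; ring.
split; [by rewrite -[RHS]N; ring|by rewrite mul0r|split; first by ring].
  rewrite Y4 Y2.
  transitivity (- (8 * x ^+ 3 + 4 * x ^+ 2 - 4 * x - 1) * (2 * x ^+ 2 - x - 1)).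
    by ring.
  by rewrite C; ring.
rewrite Y5 Y3.
transitivity (- y * (8 * x ^+ 3 + 4 * x ^+ 2 - 4 * x - 1) * (2 * x - 1)); first by ring.
by rewrite C; ring.
Qed.

Lemma quadratic_normal_solution s x : s ^+ 2 = 3 / 4 - x ^+ 2 ->
  4 * x ^+ 2 + 2 * x - 1 = 0 -> normal_solution s x 2^-1.
Proof.
move=> S C; split; [by rewrite S; field|by field|split].
- transitivity (2 * s * x * (4 * x ^+ 2 + 2 * x - 1) * (2 * x - 1)); first by field.
  by rewrite C; ring.
- transitivity ((4 * x ^+ 2 + 2 * x - 1) * (4 * x ^+ 3 - 2 * x ^+ 2 - 2 * x + 1)).
    by field.
  by rewrite C; ring.
- transitivity ((4 * x ^+ 2 + 2 * x - 1) * ((2 * x + 1) * (x - 1))); first by field.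
  by rewrite C; ring.
Qed.

(** The values at -1, -1/2, 0 and 1 are -1, 1, -1 and 7, so the intermediate value theorem gives
    three separated roots. *)
Lemma cubic_roots : exists r1 r2 r3 : R, [/\ -1 < r1 < - 2^-1, - 2^-1 < r2 < 0 &
  0 < r3 < 1] /\ forall x, 8 * x ^+ 3 + 4 * x ^+ 2 - 4 * x - 1 = 0 <->
    [\/ x = r1, x = r2 | x = r3].
Proof.
pose c x := 8 * x ^+ 3 + 4 * x ^+ 2 - 4 * x - 1.
pose p : {poly R} := 8%:P * 'X^3 + 4%:P * 'X^2 - 4%:P * 'X - 1.
have pE x : p.[x] = c x.
  by rewrite /p /c !(hornerD, hornerN, hornerM, hornerC, hornerXn, hornerX).
have ivt (a b : R) : a <= b -> c a * c b < 0 -> exists2 r, a < r < b & c r = 0.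
  move=> ab cab.
  have E z : c z = 0 -> a <= z <= b -> exists2 r, a < r < b & c r = 0.
    move=> cz /andP[az zb]; exists z => //.
    rewrite !lt_neqAle az zb !andbT; apply/andP; split; apply/eqP => e.
      by move: cab; rewrite e cz mul0r ltxx.
    by move: cab; rewrite -e cz mulr0 ltxx.
  have [h|h] := leP (c a) 0.
    have [|z zab /rootP z0] := @poly_ivt R p a b ab.
      by rewrite !pE h /=; nra.
    by apply: (E z) => //; rewrite -pE.
  have [|z zab /rootP z0] := @poly_ivt R (- p) a b ab.
    by rewrite !hornerN !pE; nra.
  by apply: (E z) => //; apply/eqP; rewrite -pE -oppr_eq0 -hornerN; apply/eqP.
have L1 : (-1) <= (- 2^-1) :> R by lra.
have H1 : c (-1) * c (- 2^-1) < 0 by rewrite /c; lra.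
have [r1 h1 c1] := ivt _ _ L1 H1.
have L2 : (- 2^-1) <= 0 :> R by lra.
have H2 : c (- 2^-1) * c 0 < 0 by rewrite /c; lra.
have [r2 h2 c2] := ivt _ _ L2 H2.
have L3 : 0 <= 1 :> R by lra.
have H3 : c 0 * c 1 < 0 by rewrite /c; lra.
have [r3 h3 c3] := ivt _ _ L3 H3.
exists r1, r2, r3; split=> // x; split; last by case=> ->; [exact: c1|exact: c2|exact: c3].
move=> cx.
(* The first divided difference of the cubic; [l] uses the second one. Both [x] and [r3] then have
   the same sum with [r1] and [r2]. *)
pose q (a b : R) := 8 * (a ^+ 2 + a * b + b ^+ 2) + 4 * (a + b) - 4.
have cq a b : c a = 0 -> c b = 0 -> a != b -> q a b = 0.
  move=> ca cb ab; have /eqP : (a - b) * q a b = 0.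
    by transitivity (c a - c b); [rewrite /c /q; ring|rewrite ca cb subrr].
  by rewrite mulf_eq0 subr_eq0 (negbTE ab) => /eqP.
have [x1|x1] := eqVneq x r1; first by constructor 1.
have [x2|x2] := eqVneq x r2; first by constructor 2.
have n12 : r2 != r1 by apply/eqP; lra.
have n13 : r3 != r1 by apply/eqP; lra.
have n23 : r2 != r3 by apply/eqP; lra.
have q1 := cq _ _ cx c1 x1; have q2 := cq _ _ c2 c1 n12; have q3 := cq _ _ c3 c1 n13.
have l a b : q a r1 = 0 -> q b r1 = 0 -> a != b -> 8 * (a + b + r1) + 4 = 0.
  move=> qa qb ab; have /eqP : (a - b) * (8 * (a + b + r1) + 4) = 0.
    by transitivity (q a r1 - q b r1); [rewrite /q; ring|rewrite qa qb subrr].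
  by rewrite mulf_eq0 subr_eq0 (negbTE ab) => /eqP.
have l1 := l _ _ q1 q2 x2.
have n32 : r3 != r2 by rewrite eq_sym.
have l2 := l _ _ q3 q2 n32.
by constructor 3; lra.
Qed.

Lemma quadratic_roots : exists u1 u2 : R, [/\ -1 < u1 < 0, 0 < u2 < 1 &
  forall x, 4 * x ^+ 2 + 2 * x - 1 = 0 <-> x = u1 \/ x = u2].
Proof.
pose w : R := Num.sqrt 5; have w0 : 0 <= w by exact: sqrtr_ge0.
have w2 : w ^+ 2 = 5 by rewrite sqr_sqrtr.
exists ((- 1 - w) / 4), ((w - 1) / 4); split; [nra|nra|move=> x; split].
  move=> h; have /eqP : (x - (- 1 - w) / 4) * (x - (w - 1) / 4) = 0.
    transitivity ((4 * x ^+ 2 + 2 * x - 1) / 4 - (w ^+ 2 - 5) / 16); first by field.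
    by rewrite h w2; ring.
  by rewrite mulf_eq0 !subr_eq0 => /orP[]/eqP; [left|right].
case=> ->.
  by transitivity ((w ^+ 2 - 5) / 4); [field|rewrite w2 subrr mul0r].
by transitivity ((w ^+ 2 - 5) / 4); [field|rewrite w2 subrr mul0r].
Qed.

(** Only [s] and [x] are compared, because these are the trace invariants that tell the orbits
    apart. *)
Lemma parameter_list_inj (r1 r2 r3 u1 u2 y1 y2 y3 s1 s2 y : R) :
  r1 < r2 -> r2 < r3 -> u1 < u2 -> 0 < s1 -> 0 < s2 ->
  let l := [:: (0, r1, y1); (0, r2, y2); (0, r3, y3); (s1, u1, y); (- s1, u1, y);
               (s2, u2, y); (- s2, u2, y)] in
  forall i j : 'I_7, (nth (0, 0, 0) l i).1.1 = (nth (0, 0, 0) l j).1.1 ->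
    (nth (0, 0, 0) l i).1.2 = (nth (0, 0, 0) l j).1.2 -> i = j.
Proof.
move=> r12 r23 u12 s10 s20 l.
case=> -[|[|[|[|[|[|[|//]]]]]]] i7 [[|[|[|[|[|[|[|//]]]]]]] j7] /= a b;
  by [exact: val_inj|exfalso; lra].
Qed.

Lemma seven_parameters : exists par : 'I_7 -> R * R * R,
  [/\ forall i, 0 < (par i).2 /\ normal_solution (par i).1.1 (par i).1.2 (par i).2,
      forall i j, (par i).1.1 = (par j).1.1 -> (par i).1.2 = (par j).1.2 -> i = j &
      forall s x y, 0 < y -> normal_solution s x y -> exists i, par i = (s, x, y)].
Proof.
have [r1 [r2 [r3 [[h1 h2 h3] rP]]]] := cubic_roots.
have [u1 [u2 [g1 g2 uP]]] := quadratic_roots.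
pose e x : R := Num.sqrt (1 - x ^+ 2); pose f x : R := Num.sqrt (3 / 4 - x ^+ 2).
have e0 x : -1 < x < 1 -> 0 < e x /\ x ^+ 2 + e x ^+ 2 = 1.
  move=> h; have h' : 0 < 1 - x ^+ 2 by nra.
  by split; [rewrite sqrtr_gt0|rewrite sqr_sqrtr ?ltW //; ring].
(* A root satisfies [4 * x ^+ 2 = 1 - 2 * x < 3] because [x > -1], so the radicand is positive and
   both signs of [s] occur. *)
have f0 x : -1 < x -> 4 * x ^+ 2 + 2 * x - 1 = 0 -> 0 < f x /\ f x ^+ 2 = 3 / 4 - x ^+ 2.
  move=> h hq; have h' : 0 < 3 / 4 - x ^+ 2 by nra.
  by split; [rewrite sqrtr_gt0|rewrite sqr_sqrtr ?ltW].
have [e1 N1] : 0 < e r1 /\ r1 ^+ 2 + e r1 ^+ 2 = 1 by apply: e0; lra.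
have [e2 N2] : 0 < e r2 /\ r2 ^+ 2 + e r2 ^+ 2 = 1 by apply: e0; lra.
have [e3 N3] : 0 < e r3 /\ r3 ^+ 2 + e r3 ^+ 2 = 1 by apply: e0; lra.
have U1 : 4 * u1 ^+ 2 + 2 * u1 - 1 = 0 by apply/uP; left.
have U2 : 4 * u2 ^+ 2 + 2 * u2 - 1 = 0 by apply/uP; right.
have [f1 M1] : 0 < f u1 /\ f u1 ^+ 2 = 3 / 4 - u1 ^+ 2 by apply: f0 => //; lra.
have [f2 M2] : 0 < f u2 /\ f u2 ^+ 2 = 3 / 4 - u2 ^+ 2 by apply: f0 => //; lra.
pose l := [:: (0, r1, e r1); (0, r2, e r2); (0, r3, e r3); (f u1, u1, 2^-1);
  (- f u1, u1, 2^-1); (f u2, u2, 2^-1); (- f u2, u2, 2^-1)] : seq (R * R * R).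
have half0 : 0 < 2^-1 :> R by rewrite invr_gt0.
exists (fun i : 'I_7 => nth (0, 0, 0) l i); split.
- case=> -[|[|[|[|[|[|[|//]]]]]]] i7 /=; split=> //;
    (by apply: cubic_normal_solution => //; apply/rP; constructor) ||
    (by apply: quadratic_normal_solution; rewrite ?sqrrN).
- by apply: parameter_list_inj => //; lra.
- move=> s x y y0 /(normal_solution_cases (ltW y0))[[y1 _ _]|[_ -> N /rP X]|[-> S Q]].
  + by rewrite y1 ltxx in y0.
  + have yE : y = e x.
      by rewrite /e (_ : 1 - x ^+ 2 = y ^+ 2) ?sqrtr_sqr ?gtr0_norm // -N; ring.
    rewrite yE; case: X => ->.
    * by exists (@Ordinal 7 0 isT).
    * by exists (@Ordinal 7 1 isT).
    * by exists (@Ordinal 7 2 isT).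
  + have sE : s = f x \/ s = - f x.
      have : s ^+ 2 == f x ^+ 2 by rewrite S sqr_sqrtr //; nra.
      by rewrite eqf_sqr => /orP[]/eqP; [left|right].
    move/uP: Q sE => [->|->] [->|->].
    * by exists (@Ordinal 7 3 isT).
    * by exists (@Ordinal 7 4 isT).
    * by exists (@Ordinal 7 5 isT).
    * by exists (@Ordinal 7 6 isT).
Qed.

Lemma normal_form B W : SU2_traceless R B -> exists Q s x y,
  [/\ 0 <= y, quat_of (B ^ Q)%g = Quat 0 1 0 0 & quat_of (W ^ Q)%g = Quat s x y 0].
Proof.
move=> /SU2_tracelessP tB.
pose J : SU2 R := su2_of (Quat 0 1 0 0).
have JE : quat_of J = Quat 0 1 0 0 by apply: su2_ofK; rewrite /qnorm /=; ring.
have conjE (X Y Z : SU2 R) : (X * Z = Z * Y)%g -> (X ^ Z = Y)%g.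
  by rewrite /conjg => ->; rewrite mulKg.
have [Q1 BQ1] : exists Q1, (B ^ Q1)%g = J.
  case BE : (quat_of B) tB (SU2_shape B).2 => [b0 b1 b2 b3] /= b00 N.
  rewrite b00 in BE N.
  have {}N : b1 ^+ 2 + b2 ^+ 2 + b3 ^+ 2 = 1.
    by move: N; rewrite /qnorm /= expr0n /= add0r.
  have [b1N|b1N] := eqVneq b1 (-1).
    have [b20 b30] : b2 = 0 /\ b3 = 0.
      have : b2 ^+ 2 + b3 ^+ 2 = 0 by move: N; rewrite b1N; lra.
      by move/eqP; rewrite paddr_eq0 ?sqr_ge0 // !sqrf_eq0 => /andP[/eqP -> /eqP ->].
    exists (su2_of (Quat 0 0 1 0)); apply: conjE; apply: quat_of_inj.
    rewrite !quat_of_mul BE JE su2_ofK; last by rewrite /qnorm /=; ring.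
    by rewrite b1N b20 b30 /=; apply: quat_eq; ring.
  have b1g : 0 < 1 + b1.
    rewrite lt_neqAle; apply/andP; split; last by nra.
    by apply: contra b1N => /eqP h; apply/eqP; lra.
  pose n := Num.sqrt (2 * (1 + b1)); have n0 : 0 < n by rewrite sqrtr_gt0 mulr_gt0.
  have n2 : n ^+ 2 = 2 * (1 + b1) by rewrite sqr_sqrtr // ltW // mulr_gt0.
  (* This is [1 - b i] divided by its norm. Since the square of [b] is -1, it satisfies [b q = q i].
     It degenerates only at [b = -i], where [j] was taken instead. *)
  pose q := Quat ((1 + b1) / n) 0 (- b3 / n) (b2 / n).
  have qN : qnorm q = 1.
    rewrite /qnorm /=.
    have -> : ((1 + b1) / n) ^+ 2 + 0 ^+ 2 + (- b3 / n) ^+ 2 + (b2 / n) ^+ 2 =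
      (1 + 2 * b1 + (b1 ^+ 2 + b2 ^+ 2 + b3 ^+ 2)) / n ^+ 2 by field; rewrite gt_eqF.
    by rewrite N n2; field; rewrite gt_eqF.
  exists (su2_of q); apply: conjE; apply: quat_of_inj.
  rewrite !quat_of_mul BE JE su2_ofK //=; apply: quat_eq; try ring.
  by apply: (eq_mod1 (c := n^-1) N); ring.
have [s [x [y [z WE]]]] : exists s x y z, quat_of (W ^ Q1)%g = Quat s x y z.
  by case: (quat_of _) => s x y z; exists s, x, y, z.
have NW := (SU2_shape (W ^ Q1)%g).2; rewrite WE /qnorm /= in NW.
(* Conjugation by [cos phi + sin phi i] fixes [i] and turns the plane of [j] and [k] by twice the
   angle, hence polar coordinates with half the argument. *)
have [r [phi [r0 yE zE]]] : exists r phi : R,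
    [/\ 0 <= r, y = r * (cos phi ^+ 2 - sin phi ^+ 2) & z = r * (2 * cos phi * sin phi)].
  have [yz|yz] := eqVneq (y ^+ 2 + z ^+ 2) 0.
    move/eqP: yz; rewrite paddr_eq0 ?sqr_ge0 // !sqrf_eq0 => /andP[/eqP -> /eqP ->].
    by exists 0, 0; rewrite !mul0r.
  have yz0 : 0 < y ^+ 2 + z ^+ 2 by rewrite lt_def yz addr_ge0 ?sqr_ge0.
  pose r := Num.sqrt (y ^+ 2 + z ^+ 2); have r0 : 0 < r by rewrite sqrtr_gt0.
  have r2 : r ^+ 2 = y ^+ 2 + z ^+ 2 by rewrite sqr_sqrtr // ltW.
  have [|phi [cp sp]] := @unit_angle R (y / r) (z / r).
    by rewrite !exprMn !exprVn -mulrDl -r2 divff // expf_neq0 // gt_eqF.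
  exists r, (phi / 2); split; first exact: ltW.
    have <- : cos phi = cos (phi / 2) ^+ 2 - sin (phi / 2) ^+ 2.
      by rewrite [in LHS](splitr phi) cosD !expr2.
    by rewrite cp mulrC divfK // gt_eqF.
  have <- : sin phi = 2 * cos (phi / 2) * sin (phi / 2).
    by rewrite [in LHS](splitr phi) sinD; ring.
  by rewrite sp mulrC divfK // gt_eqF.
pose Q2 := su2_of (Quat (cos phi) (sin phi) 0 0).
have CS := cos2Dsin2 phi.
have Q2E : quat_of Q2 = Quat (cos phi) (sin phi) 0 0.
  by apply: su2_ofK; rewrite /qnorm /= -CS; ring.
exists (Q1 * Q2)%g, s, x, r; split=> //.
  rewrite conjgM BQ1 (conjE _ J) //; apply: quat_of_inj.
  by rewrite !quat_of_mul JE Q2E /=; apply: quat_eq; ring.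
have NV : qnorm (Quat s x r 0) = 1.
  have rr : y ^+ 2 + z ^+ 2 = r ^+ 2.
    transitivity (r ^+ 2 * (cos phi ^+ 2 + sin phi ^+ 2) ^+ 2); last by rewrite CS; ring.
    by rewrite yE zE; ring.
  by rewrite -[RHS]NW -[in RHS]addrA rr /qnorm /=; ring.
rewrite conjgM; move: (W ^ Q1)%g WE => V WE.
rewrite (conjE _ (su2_of (Quat s x r 0))) ?su2_ofK //.
apply: quat_of_inj; rewrite !quat_of_mul WE Q2E su2_ofK //= yE zE.
apply: quat_eq; try ring.
  by apply: (eq_mod1 (c := r * cos phi) CS); ring.
by apply: (eq_mod1 (c := r * sin phi) CS); ring.
Qed.

End Solutions.

(** * Compactness of the model and separation by real functions *)

Section CompactHausdorff.

Lemma homeomorphic_of_bijection (K J : topologicalType) (f : K -> J) :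
  compact [set: K] -> hausdorff_space J -> continuous f -> injective f ->
  (forall y, exists x, f x = y) -> homeomorphic J K.
Proof.
move=> cK hJ cf fi fs; pose g y := projT1 (cid (fs y)).
have fg y : f (g y) = y by exact: projT2 (cid (fs y)).
have gf x : g (f x) = x by apply: fi; rewrite fg.
exists g, f; split=> //; apply/continuous_closedP => A cA.
have -> : g @^-1` A = f @` A.
  by apply/seteqP; split=> [y Ay|y [x Ax <-]]; [exists (g y)|rewrite /= gf].
apply: compact_closed => //; apply: continuous_compact; first exact: continuous_subspaceT.
exact: (subclosed_compact cA cK).
Qed.

Lemma hausdorff_separated (R : realType) (J : topologicalType) :
  (forall x y : J, x <> y -> exists2 f : J -> R, continuous f & f x <> f y) ->
  hausdorff_space J.
Proof.
move=> sep p q pq; apply: contrapT => /sep[f cf]; apply.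
apply: norm_hausdorff => A B fA fB.
by have [z [zA zB]] := pq _ _ (cf _ _ fA) (cf _ _ fB); exists (f z).
Qed.

Lemma compact_set_type (T : topologicalType) (A : set T) :
  compact A -> compact [set: set_type A].
Proof.
move=> cA F FF _.
pose incl : set_type A -> T := set_val.
have FA : F (incl @^-1` A) by apply: filterE => x; exact: (set_mem (svalP x)).
have [p [Ap clp]] := cA (incl @ F) _ FA.
pose p' : set_type A := exist _ p (mem_set Ap).
exists p'; split=> // B C FB [D [[U oU UD] Dp DC]].
have h1 : F (incl @^-1` (incl @` B)) by apply: filterS FB => x Bx; exists x.
have h2 : nbhs p U by apply: open_nbhs_nbhs; split=> //; move: Dp; rewrite -UD.
have [_ [[x Bx <-] Ux]] := clp _ _ h1 h2.
by exists x; split=> //; apply: DC; rewrite -UD.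
Qed.

Lemma sphere_compact (R : realType) n : compact [set: set_type (sphere R n)].
Proof.
apply: compact_set_type; apply: bounded_closed_compact.
  exists 1; split; first exact: num_real.
  move=> r r1 v v1; rewrite /= /Num.norm /= mx_normrE; apply: bigmax_le => [|[i j] _ /=].
    by apply: ltW; apply: lt_trans r1.
  apply: ltW; apply: le_lt_trans r1; rewrite ord1.
  rewrite -(@ler_pXn2r _ 2) ?nnegrE // expr1n real_normK ?num_real // -[leRHS]v1.
  by rewrite (bigD1 j) //= lerDl; apply: sumr_ge0 => k _; exact: sqr_ge0.
have cs : continuous (fun v : 'rV[R]_n.+1 => \sum_i v 0 i ^+ 2).
  suff H (r : seq 'I_n.+1) : continuous (fun v : 'rV[R]_n.+1 => \sum_(i <- r) v 0 i ^+ 2).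
    exact: H.
  elim: r => [|i r IH].
    rewrite (_ : (fun _ => _) = fun=> 0); first exact: cst_continuous.
    by apply/funext => v; rewrite big_nil.
  have c := @matrix_normedtype.coord_continuous R 1 n.+1 0 i.
  rewrite (_ : (fun _ => _) =
      fun v : 'rV[R]_n.+1 => v 0 i * v 0 i + \sum_(j <- r) v 0 j ^+ 2).
    by move=> v; exact: (cvgD (cvgM (c v) (c v)) (IH v)).
  by apply/funext => v; rewrite big_cons.
have -> : sphere R n = (fun v : 'rV[R]_n.+1 => \sum_i v 0 i ^+ 2) @^-1` [set 1].
  by [].
by move/continuous_closedP: cs; apply; exact: closed_eq.
Qed.

Lemma projective_space_compact (R : realType) n : compact [set: projective_space R n].
Proof.
have -> : [set: projective_space R n] =
    \pi_(quotient_topology {eq_quot @antipodal R n})%qT @` [set: sphere R n].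
  by apply/seteqP; split=> [z _|//]; exists (repr z) => //; exact: reprK.
apply: continuous_compact; last exact: sphere_compact.
by apply: continuous_subspaceT; exact: pi_continuous.
Qed.

Lemma model_compact (R : realType) : compact [set: sphere_and_seven_RP3 R].
Proof.
apply: sigT_compact; first exact: finite_finset.
by case=> [i|]; [exact: projective_space_compact|exact: sphere_compact].
Qed.

Lemma prod_topology_cts (X : topologicalType) (I : Type) (K : I -> topologicalType)
    (f : X -> prod_topology K) :
  (forall i, continuous (fun x => f x i)) -> continuous f.
Proof.
move=> cf x; apply/cvg_sup => i.
exact: (@continuous_comp_initial _ X (K i) (fun g => g i) f (cf i) x).
Qed.

End CompactHausdorff.

(** * Continuity of SU(2)-valued maps in quaternion coordinates *)

Section QuaternionContinuity.
Context {R : realType} {X : topologicalType}.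

(** Stated in coordinates, so that products and inverses reduce to polynomials over [R];
    [quat_cts_continuous] returns to the topology of matrices. *)
Definition quat_cts (f : X -> SU2 R) : Prop :=
  [/\ continuous (fun x => qre (quat_of (f x))), continuous (fun x => qi (quat_of (f x))),
      continuous (fun x => qj (quat_of (f x))) & continuous (fun x => qk (quat_of (f x)))].

Lemma quat_ctsM f g : quat_cts f -> quat_cts g -> quat_cts (fun x => f x * g x)%g.
Proof.
move=> [a b c d] [e i j k].
have M (u v : X -> R) : continuous u -> continuous v -> continuous (fun x => u x * v x).
  by move=> cu cv x; apply: cvgM; [exact: cu|exact: cv].
have D (u v : X -> R) : continuous u -> continuous v -> continuous (fun x => u x + v x).
  by move=> cu cv x; apply: cvgD; [exact: cu|exact: cv].
have B (u v : X -> R) : continuous u -> continuous v -> continuous (fun x => u x - v x).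
  by move=> cu cv x; apply: cvgB; [exact: cu|exact: cv].
pose f1 x := qre (quat_of (f x)); pose f2 x := qi (quat_of (f x)).
pose f3 x := qj (quat_of (f x)); pose f4 x := qk (quat_of (f x)).
pose g1 x := qre (quat_of (g x)); pose g2 x := qi (quat_of (g x)).
pose g3 x := qj (quat_of (g x)); pose g4 x := qk (quat_of (g x)).
have [F1 F2 F3 F4] : [/\ continuous f1, continuous f2, continuous f3 & continuous f4].
  by [].
have [G1 G2 G3 G4] : [/\ continuous g1, continuous g2, continuous g3 & continuous g4].
  by [].
have E (pr : quat R -> R) : (fun x => pr (quat_of (f x * g x)%g)) = (fun x => pr (Quat
    (f1 x * g1 x - f2 x * g2 x - f3 x * g3 x - f4 x * g4 x)
    (f1 x * g2 x + f2 x * g1 x + f3 x * g4 x - f4 x * g3 x)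
    (f1 x * g3 x - f2 x * g4 x + f3 x * g1 x + f4 x * g2 x)
    (f1 x * g4 x + f2 x * g3 x - f3 x * g2 x + f4 x * g1 x))).
  apply/funext => x; rewrite quat_of_mul /f1 /f2 /f3 /f4 /g1 /g2 /g3 /g4.
  by case: (quat_of (f x)); case: (quat_of (g x)).
split; rewrite E /=.
- by apply: (B _ _ (B _ _ (B _ _ (M _ _ F1 G1) (M _ _ F2 G2)) (M _ _ F3 G3)) (M _ _ F4 G4)).
- by apply: (B _ _ (D _ _ (D _ _ (M _ _ F1 G2) (M _ _ F2 G1)) (M _ _ F3 G4)) (M _ _ F4 G3)).
- by apply: (D _ _ (D _ _ (B _ _ (M _ _ F1 G3) (M _ _ F2 G4)) (M _ _ F3 G1)) (M _ _ F4 G2)).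
- by apply: (D _ _ (B _ _ (D _ _ (M _ _ F1 G4) (M _ _ F2 G3)) (M _ _ F3 G2)) (M _ _ F4 G1)).
Qed.

Lemma quat_ctsV f : quat_cts f -> quat_cts (fun x => (f x)^-1)%g.
Proof.
move=> [a b c d]; have N (u : X -> R) : continuous u -> continuous (fun x => - u x).
  by move=> cu x; apply: cvgN; exact: cu.
have E (pr : quat R -> R) : (fun x => pr (quat_of (f x)^-1%g)) =
    (fun x => pr (qconj (quat_of (f x)))) by apply/funext => x; rewrite quat_ofV.
split; rewrite E /=; [exact: a|exact: N _ b|exact: N _ c|exact: N _ d].
Qed.

Lemma quat_cts_cst A : quat_cts (fun=> A).
Proof. by split; exact: cst_continuous. Qed.

Lemma quat_cts_continuous f : quat_cts f -> continuous f.
Proof.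
move=> [a b c d]; rewrite (_ : f = fun x => su2_of (quat_of (f x))); last first.
  by apply/funext => x; rewrite quat_ofK.
by apply: su2_of_cts => // x; case: (SU2_shape (f x)).
Qed.

End QuaternionContinuity.

Section ComponentContinuity.
Context {R : realType}.

Lemma Re_cts : continuous (fun z : Cplx R => complex.Re z).
Proof.
move=> z A /nbhs_ballP[e /= e0 eA]; have e1 : 0 < (Complex e 0 : Cplx R) by rewrite ltcE /= eqxx.
have H : nbhs z (ball z (Complex e 0 : Cplx R)) by apply/nbhs_ballP; exists (Complex e 0).
suff HA : ball z (Complex e 0 : Cplx R) `<=` (fun z : Cplx R => complex.Re z) @^-1` A.
  exact: (filterS HA H).
move=> w zw; apply: eA; move: zw; rewrite /ball /=.
rewrite normc_def ltcE /= eqxx /=; apply: le_lt_trans.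
move: {H} z w => [a b] [c d] /=; rewrite -sqrtr_sqr ler_wsqrtr //.
by rewrite lerDl sqr_ge0.
Qed.

Lemma Im_cts : continuous (fun z : Cplx R => complex.Im z).
Proof.
move=> z A /nbhs_ballP[e /= e0 eA]; have e1 : 0 < (Complex e 0 : Cplx R) by rewrite ltcE /= eqxx.
have H : nbhs z (ball z (Complex e 0 : Cplx R)) by apply/nbhs_ballP; exists (Complex e 0).
suff HA : ball z (Complex e 0 : Cplx R) `<=` (fun z : Cplx R => complex.Im z) @^-1` A.
  exact: (filterS HA H).
move=> w zw; apply: eA; move: zw; rewrite /ball /=.
rewrite normc_def ltcE /= eqxx /=; apply: le_lt_trans.
move: {H} z w => [a b] [c d] /=; rewrite -sqrtr_sqr ler_wsqrtr //.
by rewrite lerDr sqr_ge0.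
Qed.

Lemma SU2_separated (A B : SU2 R) : A <> B ->
  exists2 f : SU2 R -> R, continuous f & f A <> f B.
Proof.
move=> AB; apply: contrapT => H; apply: AB; apply: quat_of_inj.
have E (i j : 'I_2) (f : Cplx R -> R) : continuous f ->
    f (SU2_mx A i j) = f (SU2_mx B i j).
  move=> cf; apply: contrapT => ne; apply: H; exists (fun C => f (SU2_mx C i j)) => //.
  have c1 : continuous (SU2_mx : SU2 R -> 'M[Cplx R]_2) by exact: initial_continuous.
  have c2 := @matrix_normedtype.coord_continuous (Cplx R) 2 2 i j.
  exact: (comp_cts (comp_cts c1 c2) cf).
by rewrite /quat_of !(E _ _ _ Re_cts) !(E _ _ _ Im_cts).
Qed.

End ComponentContinuity.

(** * Representations as solutions, and their orbits *)

Section RepresentationVariety.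
Context {R : realType} (x0 : complement_9_42 R).
Local Notation pi1 := (fundamental_group R x0).
Local Notation rep := (traceless_representation (x0 := x0)).
Local Notation gen := (grid_gen x0).

(* The library's gmulf1, gmulfV and gmulfJ take the preservation of 1 as part of
   the structure; between groups it is automatic. *)
Lemma multiplicative1 (G H : groupType) (f : {multiplicative G -> H}) : f 1%g = 1%g.
Proof. by apply: (mulgI (f 1%g)); rewrite -gmulfM !mulg1. Qed.

Lemma multiplicativeV (G H : groupType) (f : {multiplicative G -> H}) x : f x^-1%g = (f x)^-1%g.
Proof. by apply: (mulgI (f x)); rewrite -gmulfM !mulgV multiplicative1. Qed.

Lemma multiplicativeJ (G H : groupType) (f : {multiplicative G -> H}) x y :
  f (x ^ y)%g = (f x ^ f y)%g.
Proof. by rewrite /conjg !gmulfM multiplicativeV. Qed.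

Lemma row_word_mult (G H : groupType) (f : {multiplicative G -> H}) x j n :
  f (row_word x j n) = row_word (fun i => f (x i)) j n.
Proof.
elim: n => [|n IH] /=; first exact: multiplicative1.
by rewrite gmulfM IH /letter; case: ifP => // _; rewrite multiplicative1.
Qed.

Lemma rep_eq (r r' : SU2_representation x0) :
  (forall i, (i < 8)%N -> r (gen i) = r' (gen i)) -> r = r'.
Proof.
move=> H; have E m : r m = r' m.
  suff : m \in [pred m | r m == r' m] by move/eqP.
  apply: (grid_gen_generates (x0 := x0)) => [|i i8]; last by rewrite inE H.
  split=> [|u v]; first by rewrite inE !multiplicative1.
  by rewrite !inE !gmulfM !multiplicativeV => /eqP -> /eqP ->.
(* Besides the function, the bundled morphism contains only a proof, so equality of the functions is
   enough. *)
move: r r' {H} E => [f [[fM]]] [f' [[f'M]]] /= E.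
have ff' : f = f' by apply/funext.
by move: fM f'M {E}; rewrite ff' => fM f'M; rewrite (Prop_irrelevance fM f'M).
Qed.

Definition solution (b g : SU2 R) : Prop :=
  [/\ word_relation b g, SU2_traceless R b & SU2_traceless R (meridian_word b g 0)].

Lemma solution_traceless b g i : solution b g -> (i < 8)%N ->
  SU2_traceless R (meridian_word b g i).
Proof.
case=> _ tb ta; apply: meridian_word_conj => [A B|A||] //.
  by move/tracelessJ.
by move/tracelessV.
Qed.

(** Each generator or its inverse is a positive meridian; either way the image of the generator is
    traceless. *)
Lemma rep_solution (rho : rep) : let r := set_val rho in
  let b := r (gen 1) in let g := (r (gen 0) * r (gen 1) * r (gen 2))%g in
  solution b g /\ forall i, (i < 8)%N -> r (gen i) = meridian_word b g i.
Proof.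
set r := set_val rho => b g.
have rel : grid_relations (fun i => r (gen i)).
  by move=> j j8; rewrite -row_word_mult grid_gen_relations // multiplicative1.
have [wr wE] := grid_relations_word rel; split=> //.
have tr i : (i < 8)%N -> SU2_traceless R (r (gen i)).
  move=> i8; have := set_mem (svalP rho); rewrite -[sval rho]/r => tl.
  have [/tl//|/tl] := gen_positive_meridian x0 i8.
  by rewrite multiplicativeV => /tracelessV.
by split=> //; [exact: tr|rewrite -wE //; exact: tr].
Qed.

Lemma rep_solution_ex (rho : rep) : exists b g, [/\ solution b g,
  set_val rho (gen 1) = b &
  (set_val rho (gen 0) * set_val rho (gen 1) * set_val rho (gen 2))%g = g].
Proof. by have [sol _] := rep_solution rho; do 2!eexists; split; first exact: sol. Qed.

Lemma solution_rep b g : solution b g -> exists rho : rep,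
  forall i, (i < 8)%N -> set_val rho (gen i) = meridian_word b g i.
Proof.
move=> sol; have [rel _ _] := sol.
have [r rE] := grid_gen_universal x0 (word_grid_relations rel).
have tr : rep r.
  move=> m /positive_meridian_conj_gen[i i8 [c [->|->]]].
    by rewrite multiplicativeJ; apply/tracelessJ; rewrite rE //; exact: solution_traceless.
  rewrite multiplicativeJ multiplicativeV; apply/tracelessJ/tracelessV; rewrite rE //.
  exact: solution_traceless.
by exists (exist _ r (mem_set tr)).
Qed.

Definition make_rep b g (h : solution b g) : rep := projT1 (cid (solution_rep h)).

Lemma make_repE b g (h : solution b g) i : (i < 8)%N ->
  set_val (make_rep h) (gen i) = meridian_word b g i.
Proof. by move: i; exact: (projT2 (cid (solution_rep h))). Qed.

Lemma make_rep_inj b g b' g' (h : solution b g) (h' : solution b' g') :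
  make_rep h = make_rep h' -> b = b' /\ g = g'.
Proof.
move=> E; have H i : (i < 8)%N -> meridian_word b g i = meridian_word b' g' i.
  by move=> i8; rewrite -(make_repE h) // E make_repE.
split; first exact: (H 1%N isT).
by rewrite -(meridian_word_product b g) -(meridian_word_product b' g') !H.
Qed.

Lemma make_rep_eq b g (h : solution b g) (rho : rep) :
  set_val rho (gen 1) = b ->
  (set_val rho (gen 0) * set_val rho (gen 1) * set_val rho (gen 2))%g = g ->
  make_rep h = rho.
Proof.
move=> bE gE; have [_ H] := rep_solution rho.
apply: val_inj; apply: rep_eq => i i8.
rewrite -[LHS]/(set_val (make_rep h) (gen i)) -[RHS]/(set_val rho (gen i)).
by rewrite make_repE // H // gE bE.
Qed.

(** The elements at which evaluation is continuous form a subgroup. Continuity therefore passes from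
    the grid generators to all elements, in particular to any meridians that define the topology of
    [J_C]. *)
Lemma rep_quat_cts (X : topologicalType) (h : X -> rep) :
  (forall i, (i < 8)%N -> quat_cts (fun x => set_val (h x) (gen i))) ->
  forall m, quat_cts (fun x => set_val (h x) m).
Proof.
move=> H m; pose S := [pred m | `[< quat_cts (fun x => set_val (h x) m) >]].
suff : m \in S by move/asboolP.
apply: (grid_gen_generates (x0 := x0)) => [|i i8]; last by apply/asboolP; exact: H.
split=> [|u v /asboolP cu /asboolP cv]; apply/asboolP.
  rewrite (_ : (fun x => _) = fun=> 1%g); first exact: quat_cts_cst.
  by apply/funext => x; rewrite multiplicative1.
rewrite (_ : (fun x => _) = fun x => (set_val (h x) u * (set_val (h x) v)^-1)%g).
  by apply: quat_ctsM => //; exact: quat_ctsV.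
by apply/funext => x; rewrite gmulfM multiplicativeV.
Qed.

Lemma make_rep_cts (X : topologicalType) (b g : X -> SU2 R)
    (h : forall x, solution (b x) (g x)) : quat_cts b -> quat_cts g ->
  forall m, quat_cts (fun x => set_val (make_rep (h x)) m).
Proof.
move=> cb cg; apply: rep_quat_cts => i i8.
rewrite (_ : (fun x => _) = fun x => meridian_word (b x) (g x) i); last first.
  by apply/funext => x; rewrite make_repE.
by apply: (meridian_word_closed (P := quat_cts)) => // u; [exact: quat_ctsM|exact: quat_ctsV].
Qed.

Definition sphere_quat (v : sphere R 2) : quat R :=
  Quat 0 (set_val v 0 0) (set_val v 0 1) (set_val v 0 ord_max).

Lemma sphere_quat_norm v : qnorm (sphere_quat v) = 1.
Proof.
have := set_mem (svalP v); rewrite /sphere /= -/(set_val v).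
rewrite !big_ord_recl big_ord0 addr0 => <-.
rewrite /qnorm /= expr0n /= add0r addrA.
by do ![congr (_ + _)]; congr (set_val v 0 _ ^+ 2); exact: val_inj.
Qed.

Definition sphere_elt (v : sphere R 2) : SU2 R := su2_of (sphere_quat v).

Lemma diagonal_solution b : SU2_traceless R b -> solution b b.
Proof.
by move=> tb; have [w e] := word_relation_diagonal b; split=> //; rewrite e; exact/tracelessV.
Qed.

Lemma sphere_solution v : solution (sphere_elt v) (sphere_elt v).
Proof.
apply: diagonal_solution; apply/SU2_tracelessP.
by rewrite su2_ofK ?sphere_quat_norm.
Qed.

Definition sphere3_quat (q : sphere R 3) : quat R :=
  Quat (c0 (set_val q)) (c1 (set_val q)) (c2 (set_val q)) (c3 (set_val q)).

Lemma sphere3_quat_norm q : qnorm (sphere3_quat q) = 1.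
Proof.
have : sumsq (set_val q) = 1 by exact: set_mem (svalP q).
by rewrite sumsqE /qnorm /= !addrA.
Qed.

Definition sphere3_elt (q : sphere R 3) : SU2 R := su2_of (sphere3_quat q).

Lemma sphere3_eltE q : quat_of (sphere3_elt q) = sphere3_quat q.
Proof. by rewrite su2_ofK ?sphere3_quat_norm. Qed.

Definition unit_i : SU2 R := su2_of (Quat 0 1 0 0).

Lemma unit_iE : quat_of unit_i = Quat 0 1 0 0.
Proof. by apply: su2_ofK; rewrite /qnorm /=; ring. Qed.

Definition orbit_elt (s x y : R) : SU2 R := su2_of (Quat s x y 0).

Lemma orbit_eltE s x y : normal_solution s x y ->
  quat_of (orbit_elt s x y) = Quat s x y 0.
Proof. by case=> N _ _; apply: su2_ofK; rewrite /qnorm /= -[RHS]N; ring. Qed.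

Lemma solutionJ b g q : solution (b ^ q)%g (g ^ q)%g <-> solution b g.
Proof.
rewrite /solution meridian_wordJ //.
by split=> -[/word_relationJ w /tracelessJ t /tracelessJ t'].
Qed.

(** Conjugation by the inverse makes [q] act on the left, as q A q^-1; two points of an orbit then
    agree when q^-1 q' centralizes the pair. *)
Lemma orbit_solution (s x y : R) (q : sphere R 3) : normal_solution s x y ->
  solution (unit_i ^ (sphere3_elt q)^-1)%g (orbit_elt s x y ^ (sphere3_elt q)^-1)%g.
Proof.
move=> ns; apply/solutionJ.
have [_ H] := normal_solutionP unit_iE (orbit_eltE ns); have [w t] := H ns.
by split=> //; apply/SU2_tracelessP; rewrite unit_iE.
Qed.

Lemma qre_conj (A B : SU2 R) : qre (quat_of (A ^ B)%g) = qre (quat_of A).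
Proof.
rewrite /conjg !quat_of_mul quat_ofV.
have := (SU2_shape B).2; case: (quat_of A) => a b c d; case: (quat_of B) => e f g h.
rewrite /qnorm /= => N; transitivity (a * (e ^+ 2 + f ^+ 2 + g ^+ 2 + h ^+ 2)).
  by ring.
by rewrite N mulr1.
Qed.

(** By conjugation invariance, the real parts of [g] and [b g] recover [s] and [- x], which separate
    the seven orbits. *)
Lemma qre_orbit_mul (s x y : R) (Q : SU2 R) : normal_solution s x y ->
  qre (quat_of ((unit_i ^ Q) * (orbit_elt s x y ^ Q))%g) = - x.
Proof.
move=> ns; rewrite -conjMg qre_conj quat_of_mul unit_iE orbit_eltE //=.
by ring.
Qed.

Lemma conjgV_antipodal (A Q Q' : SU2 R) :
  quat_of Q' = Quat (- qre (quat_of Q)) (- qi (quat_of Q)) (- qj (quat_of Q)) (- qk (quat_of Q)) ->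
  (A ^ Q'^-1 = A ^ Q^-1)%g.
Proof.
move=> E; apply: quat_of_inj; rewrite /conjg !invgK !quat_of_mul !quat_ofV E.
by case: (quat_of A) => a b c d; case: (quat_of Q) => e f g h /=; apply: quat_eq; ring.
Qed.

(** Commuting with [i] leaves only [a + b i]; commuting with an element whose [j] coordinate is
    nonzero then kills [b]. *)
Lemma centralizer_pm1 (s x y : R) (Q : SU2 R) : 0 < y -> normal_solution s x y ->
  (unit_i ^ Q = unit_i)%g -> (orbit_elt s x y ^ Q = orbit_elt s x y)%g ->
  quat_of Q = Quat 1 0 0 0 \/ quat_of Q = Quat (-1) 0 0 0.
Proof.
move=> y0 ns /conjg_fixP/commgP/(congr1 quat_of) + /conjg_fixP/commgP/(congr1 quat_of).
rewrite !quat_of_mul unit_iE orbit_eltE //.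
have := (SU2_shape Q).2; case: (quat_of Q) => a b c d; rewrite /qnorm /= => N.
case=> _ _ h1 h2; case=> _ _ _ h3.
have c0 : c = 0 by lra.
have d0 : d = 0 by lra.
rewrite c0 d0 in N h3 *.
have b0 : b = 0.
  have /eqP : y * b = 0 by lra.
  by rewrite mulf_eq0 gt_eqF //= => /eqP.
rewrite b0 in N *.
have /eqP : a ^+ 2 = 1 by rewrite -N; ring.
by rewrite sqrf_eq1 => /orP[]/eqP ->; [left|right].
Qed.

Section Homeomorphism.
Context (par : 'I_7 -> R * R * R).
Hypothesis par_sol : forall i,
  0 < (par i).2 /\ normal_solution (par i).1.1 (par i).1.2 (par i).2.
Hypothesis par_inj : forall i j,
  (par i).1.1 = (par j).1.1 -> (par i).1.2 = (par j).1.2 -> i = j.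
Hypothesis par_surj : forall s x y, 0 < y -> normal_solution s x y ->
  exists i, par i = (s, x, y).

Definition orbit_rep (i : 'I_7) (q : sphere R 3) : rep :=
  make_rep (orbit_solution q (par_sol i).2).

(** The chosen representative is immaterial by [orbit_rep_antipodal], which is also what makes the
    map continuous on the quotient. *)
Definition component_rep (i : option 'I_7) : sphere_or_RP3 R i -> rep :=
  match i with
  | None => fun v => make_rep (sphere_solution v)
  | Some k => fun z => orbit_rep k (repr z)
  end.

Definition model_rep (z : sphere_and_seven_RP3 R) : rep :=
  component_rep (projT2 z).

Lemma make_rep_irr b g b' g' (h : solution b g) (h' : solution b' g') :
  b = b' -> g = g' -> make_rep h = make_rep h'.
Proof.
by move=> bb gg; move: h h'; rewrite bb gg => h h'; rewrite (Prop_irrelevance h h').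
Qed.

Lemma orbit_rep_antipodal i (q q' : sphere R 3) :
  antipodal q q' -> orbit_rep i q = orbit_rep i q'.
Proof.
move=> /orP[/eqP/val_inj -> //|/eqP qq].
have E : quat_of (sphere3_elt q) = Quat (- qre (quat_of (sphere3_elt q')))
    (- qi (quat_of (sphere3_elt q'))) (- qj (quat_of (sphere3_elt q')))
    (- qk (quat_of (sphere3_elt q'))).
  by rewrite !sphere3_eltE /sphere3_quat qq /= /c0 /c1 /c2 /c3 !mxE.
by apply: make_rep_irr; exact: conjgV_antipodal.
Qed.

Lemma orbit_rep_inj i j (q q' : sphere R 3) : orbit_rep i q = orbit_rep j q' ->
  i = j /\ antipodal q q'.
Proof.
move=> /make_rep_inj[bE gE].
have [yi nsi] := par_sol i; have [yj nsj] := par_sol j.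
have ij : i = j.
  apply: par_inj.
    have F s x y Q : normal_solution s x y -> qre (quat_of (orbit_elt s x y ^ Q)%g) = s.
      by move=> ns; rewrite qre_conj orbit_eltE.
    by rewrite -(F _ _ _ (sphere3_elt q)^-1%g nsi) gE F.
  by apply: oppr_inj; rewrite -(qre_orbit_mul (sphere3_elt q)^-1%g nsi) bE gE qre_orbit_mul.
split; first exact: ij.
rewrite ij in gE.
have cb : (unit_i ^ ((sphere3_elt q)^-1 * sphere3_elt q') = unit_i)%g.
  by rewrite conjgM bE conjgKV.
have cg : (orbit_elt (par j).1.1 (par j).1.2 (par j).2 ^
    ((sphere3_elt q)^-1 * sphere3_elt q') = orbit_elt (par j).1.1 (par j).1.2 (par j).2)%g.
  by rewrite conjgM gE conjgKV.
case: (centralizer_pm1 yj nsj cb cg).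
- move=> E; apply/orP; left; apply/eqP.
  have qq : sphere3_elt q' = sphere3_elt q.
    apply: (mulgI (sphere3_elt q)^-1%g); rewrite mulVg; apply: quat_of_inj.
    by rewrite E quat_of1.
  have := congr1 quat_of qq; rewrite !sphere3_eltE => -[h0 h1 h2 h3].
  by apply: row4P.
- move=> E; apply/orP; right; apply/eqP.
  have : quat_of (sphere3_elt q') = qmul (quat_of (sphere3_elt q)) (Quat (-1) 0 0 0).
    by rewrite -E -quat_of_mul mulVKg.
  rewrite !sphere3_eltE /= => -[h0 h1 h2 h3].
  have [z0 z1 z2 z3] := cZ (-1) (set_val q'); rewrite -scaleN1r.
  by apply: row4P; rewrite ?z0 ?z1 ?z2 ?z3 ?h0 ?h1 ?h2 ?h3; ring.
Qed.

Lemma model_rep_inj : injective model_rep.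
Proof.
case=> [[i|] z] [[j|] w]; rewrite /model_rep /=.
- move=> /orbit_rep_inj[ij a]; move: z w a; rewrite ij => z w a.
  congr (existT _ _ _); rewrite -(reprK z) -(reprK w).
  by apply/eqmodP.
(* A diagonal solution on an orbit would make the two elements of its normal form equal,
   contradicting [y > 0]. *)
- move=> /make_rep_inj[bE gE]; exfalso.
  have [yi nsi] := par_sol i.
  have /conjg_inj/(congr1 quat_of) : (unit_i ^ (sphere3_elt (repr z))^-1 =
      orbit_elt (par i).1.1 (par i).1.2 (par i).2 ^ (sphere3_elt (repr z))^-1)%g.
    by rewrite bE gE.
  by rewrite unit_iE orbit_eltE // => -[_ _ y0]; rewrite -y0 ltxx in yi.
- move=> /make_rep_inj[bE gE]; exfalso.
  have [yj nsj] := par_sol j.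
  have /conjg_inj/(congr1 quat_of) : (unit_i ^ (sphere3_elt (repr w))^-1 =
      orbit_elt (par j).1.1 (par j).1.2 (par j).2 ^ (sphere3_elt (repr w))^-1)%g.
    by rewrite -bE -gE.
  by rewrite unit_iE orbit_eltE // => -[_ _ y0]; rewrite -y0 ltxx in yj.
- move=> /make_rep_inj[/(congr1 quat_of) + _].
  rewrite !su2_ofK ?sphere_quat_norm // => -[h0 h1 h2].
  congr (existT _ _ _); apply: val_inj; apply/rowP => k.
  rewrite -/(set_val z) -/(set_val w).
  case: k => -[|[|[|//]]] k3.
  + by move: h0; rewrite (_ : Ordinal k3 = 0) //; exact: val_inj.
  + by move: h1; rewrite (_ : Ordinal k3 = 1) //; exact: val_inj.
  + by move: h2; rewrite (_ : Ordinal k3 = ord_max) //; exact: val_inj.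
Qed.

Lemma sphere_point n (v : 'rV[R]_n.+1) : \sum_i v 0 i ^+ 2 = 1 ->
  exists w : sphere R n, set_val w = v.
Proof. by move=> v1; exists (exist _ v (mem_set v1)). Qed.

Lemma model_rep_surj (rho : rep) : exists z, model_rep z = rho.
Proof.
have [b [g [sol bD gD]]] := rep_solution_ex rho.
have [w tb t] := sol; have [Q [s [x [y [y0 bE gE]]]]] := normal_form g tb.
have ns : normal_solution s x y.
  have [H _] := normal_solutionP bE gE; apply: H; split; first exact/word_relationJ.
  by rewrite meridian_wordJ //; apply/tracelessJ.
have bQ : (b ^ Q = unit_i)%g by apply: quat_of_inj; rewrite bE unit_iE.
have gQ : (g ^ Q = orbit_elt s x y)%g by apply: quat_of_inj; rewrite gE orbit_eltE.
have orbit : 0 < y -> exists z, model_rep z = rho.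
  move=> yp; have [i iE] := par_surj yp ns.
  have [q qE] : exists q : sphere R 3, sphere3_elt q = Q.
    have N := (SU2_shape Q).2; case qE : (quat_of Q) N => [q0 q1 q2 q3] N.
    have [v0 v1 v2 v3] := vec4E q0 q1 q2 q3.
    have [v vE] : exists v : sphere R 3, set_val v = vec4 q0 q1 q2 q3.
      apply: sphere_point; rewrite -[LHS]/(sumsq _) sumsqE v0 v1 v2 v3 -[RHS]N.
      by rewrite /qnorm /= !addrA.
    exists v; apply: quat_of_inj; rewrite sphere3_eltE /sphere3_quat vE v0 v1 v2 v3.
    by rewrite qE.
  pose z : projective_space R 3 := \pi_(quotient_topology {eq_quot @antipodal R 3})%qT q.
  exists (existT _ (Some i) z); rewrite /model_rep /=.
  have -> : orbit_rep i (repr z) = orbit_rep i q.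
    by apply: orbit_rep_antipodal; apply/eqmodP; rewrite reprK.
  apply: make_rep_eq.
    by rewrite bD qE -bQ conjgK.
  by rewrite gD qE iE -gQ conjgK.
have [[y1 s1 x1]|h|h] := normal_solution_cases y0 ns.
- have gb : g = b.
    apply: (@conjg_inj _ Q); apply: quat_of_inj.
    by rewrite bE gE y1 s1 x1.
  have [tre N] : qre (quat_of b) = 0 /\ qnorm (quat_of b) = 1.
    by split; [apply/SU2_tracelessP|case: (SU2_shape b)].
  case qE : (quat_of b) tre N => [b0 b1 b2 b3] /= b00 N.
  have [v vE] : exists v : sphere R 2, set_val v = \row_i [:: b1; b2; b3]`_i.
    apply: sphere_point; rewrite !big_ord_recl big_ord0 addr0 !mxE /=.
    by rewrite -N /qnorm /= b00 expr0n /= add0r addrA.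
  exists (existT _ None v); rewrite /model_rep /=.
  have vb : sphere_elt v = b.
    apply: quat_of_inj; rewrite su2_ofK ?sphere_quat_norm // qE /sphere_quat vE !mxE /=.
    by rewrite b00.
  by apply: make_rep_eq; rewrite vb // gD.
- by case: h => yp _ _ _; exact: orbit yp.
- by case: h => yE _ _; apply: orbit; rewrite yE invr_gt0.
Qed.

End Homeomorphism.
End RepresentationVariety.

(** * The topology of J_C and the homeomorphism *)

Section Topology.
Context {R : realType} {x0 : complement_9_42 R} {k : nat}.
Context {m : 'I_k -> fundamental_group R x0} (mP : forall i, positive_meridian x0 (m i)).
Local Notation rep := (traceless_representation (x0 := x0)).

Lemma J_C_cts (X : topologicalType) (h : X -> rep) :
  (forall i, quat_cts (fun x => set_val (h x) (m i))) ->
  continuous (h : X -> J_C mP).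
Proof.
move=> ch; apply: (@continuous_comp_initial _ X _ (meridian_eval mP) h).
apply: prod_topology_cts => i.
apply: (@continuous_comp_initial _ X (SU2 R) (set_val : SU2_traceless R -> SU2 R)).
exact: (quat_cts_continuous (ch i)).
Qed.

Lemma J_C_eval_cts i : continuous (fun rho : J_C mP => set_val (rho : rep) (m i)).
Proof.
have c1 : continuous (meridian_eval mP : J_C mP -> _) by exact: initial_continuous.
have c2 : continuous (fun e : prod_topology (fun _ : 'I_k => SU2_traceless R) => e i).
  exact: (@proj_continuous _ _ i).
have c3 : continuous (set_val : SU2_traceless R -> SU2 R) by exact: initial_continuous.
exact: (comp_cts (comp_cts c1 c2) c3).
Qed.

(** Generation makes distinct representations differ at some [m i], where evaluation is continuous
    with values in SU(2). *)
Lemma J_C_hausdorff : generates (range m) -> hausdorff_space (J_C mP).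
Proof.
move=> gen; apply: (@hausdorff_separated R) => rho rho' ne.
have [i iE] : exists i, set_val (rho : rep) (m i) <> set_val (rho' : rep) (m i).
  apply: contrapT => /forallNP H; apply: ne; apply: val_inj.
  have E u : u \in [pred u | set_val (rho : rep) u == set_val (rho' : rep) u].
    apply: gen u => [|_ [i _ <-]]; last first.
      by apply/eqP; apply: contrapT; apply: H.
    split=> [|u v]; first by rewrite inE !multiplicative1.
    by rewrite !inE !gmulfM !multiplicativeV => /eqP -> /eqP ->.
  by apply: rep_eq => j _; exact/eqP/E.
have [f cf fE] := SU2_separated iE.
exists (fun rho : J_C mP => f (set_val (rho : rep) (m i))) => //.
exact: (comp_cts (@J_C_eval_cts i) cf).
Qed.

Lemma sphere_coord_cts n (j : 'I_n.+1) :
  continuous (fun v : sphere R n => (set_val v : 'rV[R]_n.+1) 0 j).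
Proof.
have c1 : continuous (set_val : sphere R n -> 'rV[R]_n.+1) by exact: initial_continuous.
exact: (comp_cts c1 (@matrix_normedtype.coord_continuous R 1 n.+1 0 j)).
Qed.

Lemma sphere_elt_cts : quat_cts (sphere_elt : sphere R 2 -> SU2 R).
Proof.
have E : (fun v : sphere R 2 => quat_of (sphere_elt v)) = sphere_quat.
  by apply/funext => v; rewrite su2_ofK ?sphere_quat_norm.
have H (p : quat R -> R) : continuous (fun v : sphere R 2 => p (sphere_quat v)) ->
    continuous (fun v : sphere R 2 => p (quat_of (sphere_elt v))).
  by rewrite -E.
split; [apply: (H (@qre R))|apply: (H (@qi R))|apply: (H (@qj R))|apply: (H (@qk R))].
- exact: cst_continuous.
- exact: sphere_coord_cts.
- exact: sphere_coord_cts.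
- exact: sphere_coord_cts.
Qed.

Lemma sphere3_elt_cts : quat_cts (sphere3_elt : sphere R 3 -> SU2 R).
Proof.
have E : (fun v : sphere R 3 => quat_of (sphere3_elt v)) = sphere3_quat.
  by apply/funext => v; rewrite sphere3_eltE.
have H (p : quat R -> R) : continuous (fun v : sphere R 3 => p (sphere3_quat v)) ->
    continuous (fun v : sphere R 3 => p (quat_of (sphere3_elt v))).
  by rewrite -E.
split; [apply: (H (@qre R))|apply: (H (@qi R))|apply: (H (@qj R))|apply: (H (@qk R))];
  exact: sphere_coord_cts.
Qed.

Lemma quat_ctsJ (X : topologicalType) (f g : X -> SU2 R) :
  quat_cts f -> quat_cts g -> quat_cts (fun x => f x ^ g x)%g.
Proof. by move=> cf cg; apply: quat_ctsM; [exact: quat_ctsV|exact: quat_ctsM]. Qed.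

Lemma model_rep_cts (par : 'I_7 -> R * R * R) par_sol :
  continuous (@model_rep R x0 par par_sol : sphere_and_seven_RP3 R -> J_C mP).
Proof.
have -> : @model_rep R x0 par par_sol =
    unstable.sigT_fun (fun i => @component_rep R x0 par par_sol i).
  by apply/funext => -[].
apply: (@sigT_continuous _ _ (J_C mP)) => -[i|].
  (* Continuity on projective space is continuity on the 3-sphere together with antipodal
     invariance. *)
  apply: (@repr_comp_continuous _ _ (J_C mP) (orbit_rep x0 par_sol i)).
    apply: J_C_cts => j; apply: make_rep_cts.
      by apply: quat_ctsJ; [exact: quat_cts_cst|exact: quat_ctsV sphere3_elt_cts].
    by apply: quat_ctsJ; [exact: quat_cts_cst|exact: quat_ctsV sphere3_elt_cts].
  move=> q q' /eqP/eqmodP qq; apply/eqP.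
  exact: orbit_rep_antipodal.
by apply: J_C_cts => j; apply: make_rep_cts; exact: sphere_elt_cts.
Qed.

End Topology.

(** A subgroup containing an inverse contains the element, so each grid generator may be replaced by
    whichever of itself and its inverse is known to be positive. *)
Lemma positive_meridian_generators (R : realType) (x0 : complement_9_42 R) :
  exists m : 'I_8 -> fundamental_group R x0,
    (forall i, positive_meridian x0 (m i)) /\ generates (range m).
Proof.
pose good (i : 'I_8) n := positive_meridian x0 n /\
  (n = grid_gen x0 i \/ n = (grid_gen x0 i)^-1%g).
have ex i : exists n, good i n.
  have [h|h] := gen_positive_meridian x0 (ltn_ord i).
    by exists (grid_gen x0 i); split=> //; left.
  by exists (grid_gen x0 i)^-1%g; split=> //; right.
have [m mP] := choice ex; exists m; split=> [i|S Sg mS]; first by case: (mP i).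
apply: (grid_gen_generates Sg) => i i8.
have [_] := mP (Ordinal i8); have := mS (m (Ordinal i8)) (imageT m _) => + [] E; rewrite E //.
by move=> /(group_closedV Sg); rewrite invgK.
Qed.

Theorem proposition10p1 (R : realType) (x0 : complement_9_42 R) :
  (exists (k : nat) (m : 'I_k -> fundamental_group R x0),
     (forall i, positive_meridian x0 (m i)) /\ generates (range m)) /\
  (forall (k : nat) (m : 'I_k -> fundamental_group R x0)
     (mP : forall i, positive_meridian x0 (m i)),
     generates (range m) ->
     homeomorphic (J_C mP) (sphere_and_seven_RP3 R)).
Proof.
split=> [|k m mP gen]; first by exists 8%N; exact: positive_meridian_generators.
have [par [par_sol par_inj par_surj]] := @seven_parameters R.
apply: (@homeomorphic_of_bijection _ (J_C mP) (model_rep x0 par_sol)).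
- exact: model_compact.
- exact: J_C_hausdorff.
- exact: model_rep_cts.
- exact: model_rep_inj par_inj.
- exact: model_rep_surj par_surj.
Qed.
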